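(* Let $\mu$ be a positive, finite Borel measure on $\mathbb{T}^2$ with moments $c_u=\int z^{-u}d\mu$, $u\in\mathbb{Z}^2$. There exists a polynomial $p\in\mathbb{C}[z_1,z_2]$ of degree at most $(n,m)$ with no zeros on $\mathbb{T}\times\overline{\mathbb{D}}$ such that $$d\mu=\frac{1}{|p|^2}d\sigma$$ if and only if (1) for all $N,M\ge0$, $\det(c_{v-u})_{u,v\in[0,N]\times[0,M]}\ne0$; (2) for all $N\ge n$, $M\ge m-1$ and $j,k=0,1,\dots,M$, $\ \gamma^{N+1,M}_{(0,j),(N+1,k)}=0$; and (3) for all $M\ge m+1$ and $j=0,1,\dots,2n$, $\ \xi^{M}_{(n,0),(j,M)}=0$; where $$(\gamma^{N,M}_{u,v})_{u,v\in[0,N]\times[0,M]}=\big((c_{v-u})_{u,v\in[0,N]\times[0,M]}\big)^{-1},\qquad (\xi^M_{u,v})_{u,v\in[0,2n]\times[0,M]}=\big((c_{v-u})_{u,v\in[0,2n]\times[0,M]}\big)^{-1}.$$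
   Context: $\mathbb{D}=\{|z|<1\}$, $\mathbb{T}=\partial\mathbb{D}$; $n,m$ are nonnegative integers. $\sigma$ is normalized Lebesgue measure on $\mathbb{T}^2$. For $z=(z_1,z_2)$ and $u=(u_1,u_2)\in\mathbb{Z}^2$, $z^u=z_1^{u_1}z_2^{u_2}$. $[0,N]=\{0,1,\dots,N\}$ is an interval of integers. $(c_{v-u})_{u,v}$ is the matrix with rows indexed by $u$ and columns indexed by $v$; the inverses are matrix inverses (which exist under (1)). Degree at most $(n,m)$ means degree at most $n$ in $z_1$ and at most $m$ in $z_2$. Condition (2) is vacuous for $M=-1$. *)

(* Defs.v *)
From HB Require Import structures.
From mathcomp Require Import all_boot all_order all_algebra.
From mathcomp Require Import all_classical all_reals all_analysis.
From mathcomp Require Import measurable_realfun.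
From mathcomp Require Import complex.
From mathcomp Require Import lra.

Set Implicit Arguments.
Unset Strict Implicit.
Unset Printing Implicit Defensive.

Import Order.TTheory GRing.Theory Num.Theory.
Import numFieldNormedType.Exports.

Local Open Scope classical_set_scope.
Local Open Scope ring_scope.
Local Open Scope complex_scope.

(* [R[i]^o] rather than [R[i]]: the norm topology is attached to the former. *)
Definition unit_circle (R : realType) : set R[i]^o :=
  [set z : R[i] | `|z| = 1].
Arguments unit_circle R : clear implicits.

Lemma unit_circle_cis (R : realType) (t : R) :
  (cos t +i* sin t : R[i]) \in unit_circle R.
Proof.
apply/mem_set => /=; rewrite /unit_circle /= normc_def /=.
by rewrite cos2Dsin2 sqrtr1.
Qed.

Definition cis (R : realType) (t : R) : set_type (unit_circle R) :=
  exist _ (cos t +i* sin t : R[i]) (unit_circle_cis t).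

HB.instance Definition _ (R : realType) :=
  isPointed.Build (set_type (unit_circle R)) (cis 0).

(* The circle with the Borel sigma-algebra of its subspace topology.  The      *)
(* product sigma-algebra on [circle R * circle R] is the Borel sigma-algebra   *)
(* of the torus, the circle being second countable.                            *)
Definition circle (R : realType) :=
  g_sigma_algebraType (@open (set_type (unit_circle R))).

HB.instance Definition _ (R : realType) := Measurable.on (circle R).

Definition circle_val (R : realType) (z : circle R) : R[i] := set_val z.

Definition circle_cis (R : realType) (t : measurableTypeR R) : circle R := cis t.

Lemma cis_continuous (R : realType) : continuous (@cis R).
Proof.
apply: continuous_comp_initial => t; apply/cvgrPdist_lt => /= e e0.
have [d d0 ->] : exists2 d : R, 0 < d & e = d%:C.
  move: e0; rewrite ltcE => /andP[/eqP/= Ime Ree].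
  by exists (complex.Re e) => //; rewrite [LHS]complexE Ime rmorph0 mulr0 addr0.
have d20 : 0 < d / 2 by rewrite divr_gt0.
have /cvgrPdist_lt/(_ _ d20) hc := @continuous_cos R t.
have /cvgrPdist_lt/(_ _ d20) hs := @continuous_sin R t.
near=> u.
have uc : `|cos t - cos u| < d / 2 by near: u.
have us : `|sin t - sin u| < d / 2 by near: u.
rewrite !set_valE /= normc_def ltcR /= -(ger0_norm (ltW d0)) -sqrtr_sqr.
rewrite ltr_sqrt ?exprn_gt0// -[ltLHS]/((cos t - cos u) ^+ 2 + (sin t - sin u) ^+ 2).
move: uc us; rewrite !ltr_norml => /andP[? ?] /andP[? ?]; nra.
Unshelve. all: by end_near. Qed.

Lemma measurable_circle_cis (R : realType) :
  measurable_fun [set: measurableTypeR R] (@circle_cis R).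
Proof.
apply: measurability => // _ [U oU <-]; rewrite setTI.
by apply: open_measurable; move/continuousP : (@cis_continuous R); exact.
Qed.

HB.instance Definition _ (R : realType) :=
  isMeasurableFun.Build _ _ _ _ (@circle_cis R) (@measurable_circle_cis R).

Lemma twopi_gt0 (R : realType) : 0 < 2 * pi :> R.
Proof. by rewrite mulr_gt0 ?pi_gt0. Qed.

(* Normalized Lebesgue measure on the circle: the image of dt/(2 pi) on        *)
(* [0, 2 pi] under t |-> exp(it).                                              *)
Definition circle_measure (R : realType) : probability (circle R) R :=
  distribution (uniform_prob (twopi_gt0 R)) (@circle_cis R).

Definition torus_measure (R : realType) :
    {measure set (circle R * circle R) -> \bar R} :=
  (circle_measure R \x circle_measure R)%E.

Definition cintegral d (T : measurableType d) (R : realType)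
    (mu : {measure set T -> \bar R}) (f : T -> R[i]) : R[i] :=
  (\int[mu]_x complex.Re (f x)) +i* (\int[mu]_x complex.Im (f x)).

Definition lattice_point (N M : nat) (u : 'I_N.+1 * 'I_M.+1) : int * int :=
  ((u.1 : nat)%:Z, (u.2 : nat)%:Z).

Section moments.
Context (R : realType) (mu : {measure set (circle R * circle R) -> \bar R}).

Definition moment (u : int * int) : R[i] :=
  cintegral mu (fun z => circle_val z.1 ^ (- u.1) * circle_val z.2 ^ (- u.2)).

(* Rows and columns follow the enumeration of [0,N] x [0,M] as a finite type;  *)
(* [moment_inv] is indexed by the lattice points themselves.                   *)
Definition moment_mx (N M : nat) : 'M[R[i]]_#|{: 'I_N.+1 * 'I_M.+1}| :=
  \matrix_(a, b) moment (lattice_point (enum_val b) - lattice_point (enum_val a)).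

Definition moment_inv (N M : nat) (u v : 'I_N.+1 * 'I_M.+1) : R[i] :=
  invmx (moment_mx N M) (enum_rank u) (enum_rank v).

End moments.

Arguments moment_inv {R} mu N M u v.

(* Main.v *)
(* Let <f, g> be the integral of f conj(g) against mu.  A row of an inverse
   moment matrix is the coefficient vector of a polynomial biorthogonal to the
   monomials of the box.

   Conditions => density.  By (2) the rows at the two ends of [0,N] stabilize
   for N >= n, so the polynomial L_j of the middle row (n,j) of the box
   [0,2n] x [0,M], together with all its shifts z1^t L_j, is biorthogonal to
   every monomial of z2-degree at most M; thus (z1^-n L_j)_j inverts the symbol
   of mu, a Toeplitz matrix in z2, as a function of z1.  By (3), q = L_0 does not
   depend on M.  Positivity of z1^-n L and the Levinson recursions in M show
   that q has no zero on T x closed D, and that q_0 divides conj(q_j) q_k on T;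
   removing the zeros of q_0 in pairs a, 1/conj(a) yields q = B p with
   p_0 = z1^n conj(B) on T.  Then |p|^2 dmu has the moments of sigma, because B
   annihilates the bounded sequence of their differences, and expanding |p|^-2
   in a geometric series shows that mu and |p|^-2 dsigma have equal moments.

   Density => conditions.  The integral of phi(z1) z2^k / p vanishes for k > 0,
   so a Gohberg-Semencul formula in p gives the L_j; in particular
   L_0 = z1^n conj(p_0) p has z2-degree at most m, which is (3).  For (2), the
   dual polynomial g is compared with the combination of shifts of the L_j that
   has the same products with far monomials; these products tend to 0 by
   Bessel's inequality, so the error vanishes in the limit. *)

Require Import Defs.
From HB Require Import structures.
From mathcomp Require Import all_boot all_order all_algebra.
From mathcomp Require Import all_classical all_reals all_analysis.
From mathcomp Require Import measurable_realfun.
From mathcomp Require Import complex.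
From mathcomp Require Import ring lra zify.

Set Implicit Arguments.
Unset Strict Implicit.
Unset Printing Implicit Defensive.

Import Order.TTheory GRing.Theory Num.Theory.
Import numFieldNormedType.Exports.

Local Open Scope classical_set_scope.
Local Open Scope ring_scope.

(** * Polynomials on the unit circle *)

(** The measure is not assumed absolutely continuous, so its symbol has no values on the circle:
    inverting the symbol can only mean biorthogonality against monomials, and positivity at a point
    has to be reached through test functions that concentrate there. The width 2n comes from (2):
    the rows at the two ends of [0,N] involve only the n + 1 powers of z1 nearest to their end, so
    the index n, at distance n from both ends of [0,2n], feels neither. The row q cannot serve as p,
    since it carries an extra factor in z1 alone; B has to be recovered from q, as a polynomial that
    divides every q_k and satisfies |B|^2 = |q_0| on T. Where Cauchy's theorem or Fourier inversion
    might be expected, one principle is used instead: a bounded sequence annihilated by a polynomial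
    in the shift is zero, if the polynomial has no zero on T (two-sided sequences) or on the closed
    disc (one-sided sequences). *)

Section CirclePoly.
Context {C : numClosedFieldType}.
Implicit Types (z : C) (P Q H : {poly C}).

Lemma circle_neq0 z : `|z| = 1 -> z != 0.
Proof. by move=> z1; rewrite -normr_eq0 z1 oner_eq0. Qed.

Lemma circle_conj z : `|z| = 1 -> z^* = z^-1.
Proof. by move=> z1; rewrite invC_norm z1 expr1n invr1 mul1r. Qed.

Lemma circle_mulC z : `|z| = 1 -> z * z^* = 1.
Proof. by move=> z1; rewrite -normCK z1 expr1n. Qed.

(** The Cayley images (1 + ik) / (1 - ik) of the naturals are infinitely many distinct points of the
    circle, so P has more roots than its size allows. *)
Lemma poly_circle_eq0 P : (forall z, `|z| = 1 -> P.[z] = 0) -> P = 0.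
Proof.
move=> P0; pose c (k : nat) : C := (1 + 'i * k%:R) / (1 - 'i * k%:R).
have d0 (k : nat) : 1 - 'i * k%:R != 0 :> C.
  apply/eqP => /(congr1 (fun x : C => 'Re x)).
  by rewrite -mulrN Re_rect ?realN ?realn ?real1 // raddf0 => /eqP; rewrite oner_eq0 .
have cn k : `|c k| = 1.
  rewrite normrM normfV -[X in X / _]norm_conjC rmorphD rmorphM /= rmorph1 rmorph_nat conjCi.
  by rewrite mulNr divff // normr_eq0.
have cI : injective c.
  move=> k l /eqP; rewrite eqr_div // => /eqP e.
  have : 2 * 'i * (k%:R - l%:R) = 0 :> C by move/eqP: e; rewrite -subr_eq0 => /eqP <-; set x := 'i; ring.
  move/eqP; rewrite !mulf_eq0 pnatr_eq0 (negbTE (neq0Ci _)) /= subr_eq0 eqr_nat.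
  by move/eqP.
apply: (@roots_geq_poly_eq0 _ _ (map c (iota 0 (size P)))).
- by apply/allP => _ /mapP[k _ ->]; apply/rootP/P0.
- by rewrite map_inj_uniq // iota_uniq.
- by rewrite size_map size_iota.
Qed.

Lemma poly_circle_eq P Q : (forall z, `|z| = 1 -> P.[z] = Q.[z]) -> P = Q.
Proof.
move=> PQ; apply/eqP; rewrite -subr_eq0; apply/eqP/poly_circle_eq0 => z z1.
by rewrite hornerD hornerN PQ // subrr.
Qed.

(** The conjugate reciprocal polynomial. On the circle it represents z^d conj(P(z)), so that
    identities containing conjugates become polynomial identities and extend off the circle. *)
Definition rv (d : nat) P : {poly C} := \poly_(i < d.+1) (P`_(d - i))^*.

Lemma size_rv d P : (size (rv d P) <= d.+1)%N.
Proof. exact: size_poly. Qed.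

Lemma coef_rv d P i : (rv d P)`_i = if (i <= d)%N then (P`_(d - i))^* else 0.
Proof. by rewrite coef_poly ltnS. Qed.

Lemma horner_rv d P z : z != 0 -> (size P <= d.+1)%N ->
  (rv d P).[z] = z ^+ d * (P.[(z^*)^-1])^*.
Proof.
move=> z0 sP; rewrite horner_poly (horner_coef_wide _ sP) rmorph_sum /= mulr_sumr.
rewrite (reindex_inj rev_ord_inj) /=; apply: eq_bigr => i _.
have id : (i <= d)%N by rewrite -ltnS.
rewrite subSS subKn // rmorphM rmorphXn /= fmorphV /= conjCK mulrCA; congr (_ * _).
have -> : z ^+ d = z ^+ (d - i) * z ^+ i by rewrite -exprD subnK.
by rewrite exprVn mulfK // expf_neq0.
Qed.

Lemma horner_rv_circle d P z : `|z| = 1 -> (size P <= d.+1)%N ->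
  (rv d P).[z] = z ^+ d * (P.[z])^*.
Proof.
move=> z1 sP; rewrite horner_rv ?circle_neq0 //.
by rewrite [z^*]circle_conj // invrK.
Qed.

(* If H vanishes at a, then it vanishes at 1/conj(a), and either all Q_k vanish at
   a or all vanish at 1/conj(a): one divides H by both factors and Q by one. *)
Lemma circle_factor (I : finType) H (Q : I -> {poly C}) :
    (forall z, `|z| = 1 -> H.[z] != 0) ->
    (exists (a b : nat) (u : C), u != 0 /\
       forall z, `|z| = 1 -> z ^+ a * (H.[z])^* = u * z ^+ b * H.[z]) ->
    (forall j k, exists (b : nat) (w : {poly C}), forall z, `|z| = 1 ->
        z ^+ b * ((Q j).[z])^* * (Q k).[z] = H.[z] * w.[z]) ->
  exists (B : {poly C}) (P : I -> {poly C}) (c : C),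
    [/\ 0 < c, forall k, Q k = B * P k &
        forall z, `|z| = 1 -> `|B.[z]| ^+ 2 = c * `|H.[z]|].
Proof.
have [s] := ubnP (size H); elim: s => // s IH in H Q * => sH H0 Hsym Hdiv.
have [sH1|sH1] := leqP (size H) 1.
  rewrite (size1_polyC sH1) in H0 *.
  have h0 : H`_0 != 0 by have := H0 1; rewrite hornerC normr1; apply.
  exists 1, Q, (`|H`_0|^-1); split=> [|k|z z1]; first by rewrite invr_gt0 normr_gt0.
    by rewrite mul1r.
  by rewrite !hornerC normr1 expr1n mulVf // normr_eq0.
have [al ral] : exists al, root H al by apply: closed_rootP; rewrite neq_ltn sH1 orbT.
have [H' HE] := factor_theorem _ _ ral.
have HN0 : H != 0 by apply: contraTneq sH1 => ->; rewrite size_poly0.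
have sH' : (size H = (size H').+1)%N.
  by rewrite HE size_Mmonic ?monicXsubC ?size_XsubC ?addn2 //; apply: contraNneq HN0 => H'0; rewrite HE H'0 mul0r.
(* A zero at the origin has no reflection; the factor z is dropped from H alone, as it has modulus 1
   on the circle. *)
have [al0|al0] := eqVneq al 0.
  have HzE z : H.[z] = z * H'.[z] by rewrite HE al0 subr0 hornerM hornerX mulrC.
  have [| | | |B [P [c [c0 QE BE]]]] := IH H' Q _ _ _ _.
  - by rewrite -ltnS -sH'.
  - by move=> z z1; have := H0 z z1; rewrite HzE mulf_eq0 negb_or => /andP[].
  - have [a [b [u [u0 ab]]]] := Hsym; exists a, b.+2, u; split=> // z z1.
    have z0 := circle_neq0 z1; apply: (mulfI (invr_neq0 z0)).
    have := ab z z1; rewrite HzE rmorphM /= circle_conj // mulrCA => ->.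
    by rewrite !exprS; field.
  - move=> j k; have [b [w E]] := Hdiv j k.
    by exists b, ('X * w) => z z1; rewrite E // HzE hornerM hornerX; ring.
  exists B, P, c; split=> // z z1; rewrite BE // HzE normrM z1 mul1r //.
have aln1 : `|al| != 1 by apply/negP => /eqP al1; have := H0 al al1; rewrite (rootP ral) eqxx.
pose be := (al^*)^-1.
have be0 : be != 0 by rewrite invr_neq0 // conjC_eq0.
have beal : be != al.
  by apply: contra aln1 => /eqP e; rewrite -sqrp_eq1 ?normr_ge0 // normCK -{1}e /be mulVf ?conjC_eq0.
have Hbe : root H be.
  have [a [b [u [u0 ab]]]] := Hsym.
  (* Written with [rv], the symmetry of H is a polynomial identity and may be evaluated at the
     reflected point [be]. *)
  have e : 'X^a * rv (size H) H = u%:P * 'X^b * 'X^(size H) * H.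
    apply: poly_circle_eq => z z1; rewrite !hornerM !hornerXn hornerC horner_rv_circle //.
    by rewrite mulrCA ab //; ring.
  have := congr1 (fun p => p.[be]) e; rewrite !hornerM !hornerXn horner_rv // hornerC /be.
  rewrite fmorphV /= conjCK invrK (rootP ral) rmorph0 !mulr0 => /esym/eqP.
  by rewrite -/be !mulf_eq0 !expf_eq0 (negbTE u0) (negbTE be0) !andbF /= => /eqP/rootP.
have [H2 H2E] : exists H2, H' = H2 * ('X - be%:P).
  apply: factor_theorem; move: Hbe; rewrite HE rootM => /orP[//|].
  by rewrite root_XsubC (negbTE beal).
have be_al z : `|z| = 1 -> z - be = - (z / al^* ) * (z - al)^*.
  move=> z1; rewrite rmorphB /= mulrBr mulNr -(mulrAC z) circle_mulC //.
  rewrite mulNr mulfVK ?conjC_eq0 // /be; ring.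
(* On the circle the two reflected factors multiply to |z - al|^2 up to -z / conj(al), so the
   cofactor [H2] inherits the symmetry. *)
have HzE z : `|z| = 1 -> H.[z] = - (z / al^* ) * `|z - al| ^+ 2 * H2.[z].
  move=> z1; rewrite HE H2E !hornerM !hornerXsubC be_al // normCK; ring.
have nz0 z : `|z| = 1 -> z - al != 0.
  by move=> z1; rewrite subr_eq0; apply: contraNneq aln1 => <-; rewrite z1.
have H2sym : exists (a b : nat) (u : C), u != 0 /\
    forall z, `|z| = 1 -> z ^+ a * (H2.[z])^* = u * z ^+ b * H2.[z].
  have [a [b [u [u0 ab]]]] := Hsym; exists a, b.+2, (u * al / al^* ); split.
    by rewrite !mulf_eq0 invr_eq0 conjC_eq0 !negb_or u0 al0.
  move=> z z1; have z0 := circle_neq0 z1.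
  have nz : `|z - al| ^+ 2 != 0 by rewrite expf_neq0 // normr_eq0 nz0.
  have := ab z z1; rewrite HzE // !rmorphM rmorphN rmorphM /= fmorphV /= conjCK circle_conj //.
  rewrite conj_normC -expr2; set t := `|_| ^+ 2 in nz * => e.
  have al'0 : al^* != 0 by rewrite conjC_eq0.
  apply: (mulfI nz); apply: (mulfI (_ : - (z^-1 / al) != 0)).
    by rewrite oppr_eq0 mulf_eq0 !invr_eq0 negb_or z0.
  transitivity (z ^+ a * (- (z^-1 / al) * t * (H2.[z])^* )); first by ring.
  by rewrite e !exprS; field; rewrite al'0 z0 al0.
have [g ga gE] : exists2 g : C, (g = al \/ g = be) & forall k, root (Q k) g.
  have [/forallP Qa|] := boolP [forall k, root (Q k) al]; first by exists al; [left|].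
  rewrite negb_forall => /existsP[k Qk].
  (* Here Q_k does not vanish at [al]; the divisibility, read at [al], then forces the reversal of
     every Q_j to vanish there, that is, Q_j vanishes at [be]. *)
  exists be; first by right.
  move=> j; have [b [w E]] := Hdiv j k.
  have e : 'X^b * rv (size (Q j)) (Q j) * Q k = 'X^(size (Q j)) * (H * w).
    apply: poly_circle_eq => z z1; rewrite !hornerM !hornerXn horner_rv_circle //.
    by rewrite -E //; ring.
  have := congr1 (fun p => p.[al]) e; rewrite !hornerM !hornerXn horner_rv //.
  rewrite (rootP ral) mul0r mulr0 => /eqP; rewrite !mulf_eq0 !expf_eq0 (negbTE al0) !andbF /=.
  by rewrite -rootE (negbTE Qk) orbF conjC_eq0.
have [ka [ka0 kaE]] : exists ka : C, 0 < ka /\ forall z, `|z| = 1 -> `|z - g| ^+ 2 = ka * `|z - al| ^+ 2.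
  case: ga => ->; first by exists 1; split=> // z _; rewrite mul1r.
  exists (`|al| ^- 2); split; first by rewrite invr_gt0 exprn_gt0 // normr_gt0.
  move=> z z1; rewrite be_al // mulNr normrN !normrM normfV !norm_conjC z1 mul1r.
  by rewrite exprMn exprVn.
pose Q' k := Q k %/ ('X - g%:P).
have Q'E k : Q k = Q' k * ('X - g%:P) by rewrite divpK // dvdp_XsubCl.
have [| | |B [P [c [c0 PE BE]]]] := IH H2 Q' _ _ H2sym _.
- rewrite -ltnS (leq_trans _ sH) // sH' H2E size_Mmonic ?monicXsubC ?size_XsubC ?addn2 //.
  by apply: contraNneq HN0 => H20; rewrite HE H2E H20 !mul0r.
- by move=> z z1; have := H0 z z1; rewrite HE H2E !hornerM !mulf_eq0 !negb_or -andbA => /and3P[].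
- move=> j k; have [b [w E]] := Hdiv j k.
  exists b, ((- (al^* * ka)^-1) *: ('X * w)) => z z1; have := E z z1.
  have nz : `|z - al| ^+ 2 != 0 by rewrite expf_neq0 // normr_eq0 nz0.
  rewrite (Q'E j) (Q'E k) !hornerM HzE // !hornerXsubC hornerZ hornerM hornerX rmorphM /= => e.
  have ka00 : ka != 0 by rewrite gt_eqF.
  apply: (mulfI nz); apply: (mulfI ka00).
  have -> : ka * (`|z - al| ^+ 2 * (z ^+ b * ((Q' j).[z])^* * (Q' k).[z])) =
    z ^+ b * (((Q' j).[z])^* * (z - g)^* ) * ((Q' k).[z] * (z - g)).
    by rewrite [LHS]mulrA -kaE // normCK; ring.
  by rewrite e; field; rewrite conjC_eq0 al0 ka00.
exists (B * ('X - g%:P)), P, (c * ka * `|al|); split=> [|k|z z1].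
- by rewrite !mulr_gt0 // normr_gt0.
- by rewrite Q'E PE mulrAC.
rewrite hornerM hornerXsubC normrM exprMn BE // kaE // HzE // !mulNr normrN !normrM normfV norm_conjC z1 normr_id expr2.
by field; rewrite normr_eq0.
Qed.
End CirclePoly.

(** * Bounded solutions of linear recurrences, and estimates of central binomial coefficients *)

Section Recurrence.
Context {R : realType}.
Local Notation C := R[i].

Lemma geometric_unbounded (x t B : R) : 1 < x -> 0 <= t ->
  (forall n : nat, x ^+ n * t <= B) -> t = 0.
Proof.
move=> x1 t0 tB; apply/eqP; rewrite eq_le t0 andbT leNgt; apply/negP => tp.
have xn (n : nat) : 1 + n%:R * (x - 1) <= x ^+ n.
  elim: n => [|n IH]; first by rewrite mul0r addr0 expr0.
  rewrite exprS -natr1; apply: (@le_trans _ _ (x * (1 + n%:R * (x - 1)))).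
    by have := mulr_ge0 (ler0n R n) (sqr_ge0 (x - 1)); lra.
  by rewrite ler_pM2l //; lra.
have B0 : 0 <= B by apply: le_trans (tB 0%N); rewrite expr0 mul1r.
have := archi_boundP (divr_ge0 B0 (mulr_ge0 (ltW tp) (ltW (_ : 0 < x - 1)))).
rewrite subr_gt0 => /(_ x1); set n := Num.bound _ => hn.
have := tB n; rewrite leNgt => /negP; apply.
apply: lt_le_trans (ler_wpM2r t0 (xn n)).
move: hn; rewrite ltr_pdivrMr ?mulr_gt0 ?subr_gt0 //; nra.
Qed.

Lemma geometric_unboundedC (a y B : C) : 1 < `|a| ->
  (forall n : nat, `|a| ^+ n * `|y| <= B) -> y = 0.
Proof.
rewrite !normc_def => a1 H.
(* The order of [R[i]] only compares numbers with equal imaginary part, so an upper bound of a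
   nonnegative number is real. *)
have BE : B = (complex.Re B)%:C%C.
  have := H 0%N; rewrite mul1r lecE /= => /andP[/eqP ImB _].
  by rewrite [LHS]complexE ImB mulr0 addr0.
move: a1 H; set na := Num.sqrt _; set ny := Num.sqrt _ => a1 H.
have ny0 : ny = 0.
  apply: (@geometric_unbounded na ny (complex.Re B)); rewrite ?sqrtr_ge0 //.
    by rewrite -ltcR.
  by move=> n; rewrite -lecR rmorphM rmorphXn -BE H.
by apply/eqP; rewrite -normr_eq0 normc_def -/ny ny0.
Qed.

(** P(S) y, with S the shift of two-sided sequences. *)
Definition shift_apply (P : {poly C}) (y : int -> C) (s : int) :=
  \sum_(i < size P) P`_i * y (s + i%:Z).

Lemma shift_applyE (P : {poly C}) y s n : (size P <= n)%N ->
  shift_apply P y s = \sum_(i < n) P`_i * y (s + i%:Z).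
Proof.
move=> sP; rewrite /shift_apply (big_ord_widen n (fun i => P`_i * y (s + i%:Z))) // big_mkcond.
apply: eq_bigr => i _; case: ltnP => // Pi.
by rewrite nth_default // mul0r.
Qed.

(** Split off a root a of P: (S - a) y is bounded and annihilated by the cofactor, hence zero by
    induction, so y is geometric of ratio a. As |a| is not 1, y would be unbounded in one of the two
    directions unless it is zero. *)
Lemma shift_apply_inj (P : {poly C}) (y : int -> C) (B : C) :
    (forall z, `|z| = 1 -> P.[z] != 0) -> (forall s, `|y s| <= B) ->
    (forall s, shift_apply P y s = 0) ->
  forall s, y s = 0.
Proof.
have [n] := ubnP (size P); elim: n => // n IH in P y B * => sP P0 yB Py.
have [sP1|sP1] := leqP (size P) 1.
  have p0 : P`_0 != 0.
    by have := P0 1; rewrite (size1_polyC sP1) coefC hornerC normr1; apply.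
  move=> s; have := Py s; rewrite (@shift_applyE _ _ _ 1) // big_ord1 addr0.
  by move/eqP; rewrite mulf_eq0 (negbTE p0) => /eqP.
have [a ra] : exists a, root P a by apply: closed_rootP; rewrite neq_ltn sP1 orbT.
have [P' PE] := factor_theorem _ _ ra.
have PN0 : P != 0 by apply: contraTneq sP1 => ->; rewrite size_poly0.
have sP' : (size P = (size P').+1)%N.
  by rewrite PE size_Mmonic ?monicXsubC ?size_XsubC ?addn2 //; apply: contraNneq PN0 => H'0; rewrite PE H'0 mul0r.
have an1 : `|a| != 1 by apply/negP => /eqP al1; have := P0 a al1; rewrite (rootP ra) eqxx.
have y1 : forall s, y (s + 1) - a * y s = 0.
  apply: (IH P' _ (B + `|a| * B)).
  - by rewrite -ltnS -sP'.
  - by move=> z z1; have := P0 z z1; rewrite PE hornerM mulf_eq0 negb_or => /andP[].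
  - by move=> s; rewrite (le_trans (ler_normB _ _)) // normrM lerD ?ler_wpM2l.
  move=> s; rewrite -[RHS](Py s) (@shift_applyE P _ _ (size P').+1) ?sP' //.
  rewrite (@shift_applyE P' _ _ (size P').+1) //.
  under eq_bigr do rewrite mulrBr.
  have cE i : P`_i = (if i == 0%N then 0 else P'`_i.-1) - P'`_i * a.
    by rewrite PE mulrBr coefB coefMX coefMC.
  under [RHS]eq_bigr do rewrite cE mulrBl.
  rewrite big_split /=.
  rewrite [RHS]big_split /=; congr (_ + _).
    rewrite big_ord_recr /= nth_default // mul0r addr0 [RHS]big_ord_recl /= mul0r add0r.
    by apply: eq_bigr => i _; rewrite /bump /= add1n -addrA intS [1 + _]addrC.
  by apply: eq_bigr => i _; rewrite mulrA.
have yn (n' : nat) s : y (s + n'%:Z) = a ^+ n' * y s.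
  elim: n' => [|m IHm]; first by rewrite addr0 mul1r.
  have /eqP := y1 (s + m%:Z); rewrite subr_eq0 -addrA => /eqP e.
  by rewrite intS [1 + _]addrC e IHm exprS mulrA.
move=> s; case: (real_ltgtP (normr_real a) (@real1 C)) an1 => // [a1|a1] _.
- have [a0|a0] := eqVneq a 0.
    by have := yn 1%N (s - 1); rewrite a0 expr1 mul0r subrK.
  apply: (@geometric_unboundedC a^-1 _ B).
    by rewrite normfV invf_gt1 // normr_gt0.
  move=> m; have := yn m (s - m%:Z); rewrite subrK => ->.
  by rewrite normrM normrX normfV mulrA -exprMn mulVf ?normr_eq0 // expr1n mul1r.
- by apply: (@geometric_unboundedC a _ B) => // m; rewrite -normrX -normrM -yn.
Qed.

Lemma central_binomial_max (N t : nat) : ('C(N.*2, N + t) <= 'C(N.*2, N))%N.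
Proof.
elim: t => [|t IHt]; first by rewrite addn0.
apply: leq_trans IHt; have := mul_bin_left (N.*2) (N + t); rewrite -addnS => e.
rewrite -(leq_pmul2l (ltn0Sn (N + t))) -addnS e addnS leq_mul2r; apply/orP; right; lia.
Qed.

(** Consecutive coefficients have ratio (N - s) / (N + s + 1), so the step from s to s + 1 loses at
    most (2s + 1) / N of the central value; the odd numbers add up to s^2. *)
Lemma central_binomial_shift (N s : nat) : (s <= N)%N ->
  'C(N.*2, N)%:R - 'C(N.*2, N + s)%:R <= s%:R ^+ 2 * 'C(N.*2, N)%:R / N%:R :> R.
Proof.
move=> sN; have [N0|N0] := posnP N.
  by move: sN; rewrite N0 leqn0 => /eqP ->; rewrite addn0 subrr invr0 mulr0.
have Np : 0 < N%:R :> R by rewrite ltr0n.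
set b0 := 'C(N.*2, N)%:R : R.
have mono (t : nat) : 'C(N.*2, N + t)%:R <= b0.
  by rewrite ler_nat central_binomial_max.
elim: s sN => [|s IH] sN; first by rewrite addn0 subrr expr0n mul0r mul0r.
have {}IH := IH (ltnW sN).
have e := mul_bin_left (N.*2) (N + s).
have e' : (N%:R + s%:R + 1) * 'C(N.*2, N + s.+1)%:R = (N%:R - s%:R) * 'C(N.*2, N + s)%:R :> R.
  have -> : (N%:R - s%:R = (N.*2 - (N + s))%:R :> R).
    by rewrite -natrB ?(ltnW sN) //; congr (_%:R); lia.
  by rewrite -natrD natr1 -!natrM addnS e mulnC.
have := mono s; move: e' IH.
set bs := 'C(_, N + s)%:R; set bs1 := 'C(_, N + s.+1)%:R => e' IH bsb.
have bs10 : 0 <= bs1 by rewrite ler0n.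
have d : bs - bs1 <= (2 * s%:R + 1) * b0 / N%:R.
  rewrite ler_pdivlMr //; have s0 : 0 <= s%:R :> R by []. 
  have h1 : bs1 <= bs.
    have b0s : 0 <= bs by rewrite ler0n.
    have : 0 <= (2 * s%:R + 1) * bs by rewrite mulr_ge0 // addr_ge0 ?mulr_ge0.
    nra.
  have : (bs - bs1) * (N%:R + s%:R + 1) = (2 * s%:R + 1) * bs by rewrite mulrBl [bs1 * _]mulrC e'; ring.
  nra.
have -> : s.+1%:R ^+ 2 * b0 / N%:R = s%:R ^+ 2 * b0 / N%:R + (2 * s%:R + 1) * b0 / N%:R.
  by rewrite -natr1; field; rewrite gt_eqF.
lra.
Qed.

(** This is 4^N <= 2 sqrt(N) C(2N,N), squared to stay within the naturals. The induction step
    reduces to 4k(k + 1) <= (2k + 1)^2. *)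
Lemma central_binomial_lower (N : nat) : (0 < N)%N -> (16 ^ N <= 4 * N * 'C(N.*2, N) ^ 2)%N.
Proof.
elim: N => // -[|N] IH _; first by [].
have {}IH := IH isT.
set k := N.+1 in IH *.
have e : (k.+1 * 'C(k.+1.*2, k.+1) = 2 * (2 * k + 1) * 'C(k.*2, k))%N.
  have e1 := mul_bin_diag k.*2.+2 k; have e2 := mul_bin_diag k.*2.+1 k.
  have e3 : ('C(k.*2.+1, k) = 'C(k.*2.+1, k.+1))%N.
    by rewrite -bin_sub; [congr 'C(_, _)|]; lia.
  rewrite doubleS -e1 /= e3; move: e2 => /=.
  have -> : (k.*2.+2 = 2 * k.+1)%N by lia.
  by rewrite -mulnA => <-; rewrite mulnA; congr (_ * _)%N; lia.
have : (k.+1 * k.+1 * 16 ^ k.+1 <= k.+1 * k.+1 * (4 * k.+1 * 'C(k.+1.*2, k.+1) ^ 2))%N.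
  have -> : (k.+1 * k.+1 * (4 * k.+1 * 'C(k.+1.*2, k.+1) ^ 2) = 4 * k.+1 * (k.+1 * 'C(k.+1.*2, k.+1)) ^ 2)%N by ring.
  rewrite e expnS; move: IH; set c := 'C(_, _); set p := (16 ^ k)%N => IH.
  have : ((k.+1 * k.+1 * 16) * p <= (k.+1 * k.+1 * 16) * (4 * k * c ^ 2))%N by rewrite leq_mul2l IH orbT.
  have : ((k.+1 * k.+1 * 16) * (4 * k * c ^ 2) <= 4 * k.+1 * (2 * (2 * k + 1) * c) ^ 2)%N.
    have -> : ((k.+1 * k.+1 * 16) * (4 * k * c ^ 2) = (16 * k.+1 * c ^ 2) * (4 * k * k.+1))%N by ring.
    have -> : (4 * k.+1 * (2 * (2 * k + 1) * c) ^ 2 = (16 * k.+1 * c ^ 2) * ((2 * k + 1) ^ 2))%N by ring.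
    by rewrite leq_mul2l; apply/orP; right; nia.
  lia.
by rewrite leq_pmul2l // muln_gt0.
Qed.

End Recurrence.

(** * Normalization and degree bounds for the factorization on the circle *)

Section Factor.
Context {C : numClosedFieldType}.

(** [circle_factor] cannot see powers of z, which are unimodular on the circle. Once the common ones
    are extracted, some member has a nonzero constant term, which is the pivot of the degree count
    in [circle_factor_bounded]. *)
Lemma common_power_X (I : finType) (P : I -> {poly C}) (i0 : I) : P i0 != 0 ->
  exists (r : nat) (P' : I -> {poly C}), (forall i, P i = 'X^r * P' i) /\ exists j, (P' j)`_0 != 0.
Proof.
have [s] := ubnP (size (P i0)); elim: s P => // s IH P sP Pi0.
have [/forallP P0|] := boolP [forall j, (P j)`_0 == 0]; last first.
  rewrite negb_forall => /existsP[j Pj]; exists 0%N, P; split; last by exists j.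
  by move=> i; rewrite expr0 mul1r.
have PE j : P j = 'X * (P j %/ 'X).
  by rewrite mulrC divpK // -['X]subr0 -polyC0 dvdp_XsubCl /root horner_coef0.
have Q0 : P i0 %/ 'X != 0 by apply: contraNneq Pi0 => e; rewrite PE e mulr0.
have [|r [P' [P'E hj]]] := IH (fun j => P j %/ 'X) _ Q0.
  by move: sP; rewrite (PE i0) mulrC size_mulX // mulrC -PE.
exists r.+1, P'; split=> // i; by rewrite PE P'E exprS mulrA.
Qed.

Lemma circle_factor_bounded (n m : nat) (Q : 'I_m.+1 -> {poly C}) :
    let H := Q ord0 in
    (forall k, size (Q k) <= (2 * n).+1)%N ->
    rv (2 * n) H = H -> (forall z : C, `|z| = 1 -> 0 < H.[z] / z ^+ n) ->
    (forall j k, exists2 w : {poly C}, (size w <= (2 * n).+1)%N & rv (2 * n) (Q j) * Q k = H * w) ->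
  exists (B : {poly C}) (P : 'I_m.+1 -> {poly C}),
    [/\ forall k, Q k = B * P k, forall k, (size (P k) <= n.+1)%N &
        forall z : C, `|z| = 1 -> (P ord0).[z] = z ^+ n * (B.[z])^*].
Proof.
move=> H sQ Hrv Hpos Hdiv.
have z00 (z : C) : `|z| = 1 -> z ^+ n != 0 by move=> z1; exact/expf_neq0/circle_neq0.
have H0 (z : C) : `|z| = 1 -> H.[z] != 0.
  by move=> z1; have := Hpos z z1; apply: contraTneq => ->; rewrite mul0r ltxx.
have Hn (z : C) : `|z| = 1 -> `|H.[z]| = H.[z] / z ^+ n.
  move=> z1; rewrite -[RHS]gtr0_norm ?Hpos // normrM normfV normrX z1 expr1n invr1 mulr1 //.
have [| |B [P [c [c0 QE BE]]]] := @circle_factor _ _ H Q H0.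
- exists (2 * n)%N, 0%N, 1; split; first exact: oner_neq0.
  by move=> z z1; rewrite expr0 !mul1r -horner_rv_circle ?sQ // Hrv.
- move=> j k; have [w _ e] := Hdiv j k; exists (2 * n)%N, w => z z1.
  by rewrite -horner_rv_circle ?sQ // -!hornerM e.
have B0 (z : C) : `|z| = 1 -> B.[z] != 0.
  move=> z1; rewrite -normr_eq0 -sqrf_eq0 BE //.
  by rewrite mulf_neq0 ?gt_eqF // normr_gt0 H0.
have P00 : P ord0 != 0.
  have := H0 1 (normr1 _); apply: contraNneq => e; rewrite /H QE e mulr0 horner0 //.
have [r [P' [P'E [j Pj]]]] := common_power_X P00.
(* The factor is divided by sqrt(c) and takes over the power z^r, so that |B|^2 = H / z^n on the
   circle; then H = B P_0 gives P_0 = z^n conj(B). *)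
pose s := sqrtC c; have s0 : s != 0 by rewrite sqrtC_eq0 gt_eqF.
have sr : s^* = s by apply/CrealP/ger0_real; rewrite sqrtC_ge0 ltW.
exists (s^-1 *: ('X^r * B)), (fun k => s *: P' k).
have QE' k : Q k = (s^-1 *: ('X^r * B)) * (s *: P' k).
  by rewrite -scalerAl -scalerAr scalerA mulVf // scale1r QE P'E; ring.
split=> // [k|z z1]; last first.
  rewrite !hornerZ hornerM hornerXn !rmorphM /= fmorphV /= sr rmorphXn /= [z^*]circle_conj //.
  have := BE z z1; rewrite normCK Hn // /H QE P'E !hornerM hornerXn => e.
  have zr : z ^+ r != 0 by exact/expf_neq0/circle_neq0.
  apply: (mulfI (B0 z z1)).
  transitivity (s^-1 * (z ^+ n * z^-1 ^+ r * (B.[z] * (B.[z])^* ))).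
    rewrite e exprVn -[c]sqrtCK -/s; field; by rewrite s0 zr z00.
  ring.
rewrite (leq_trans (size_scale_leq _ _)) //.
have [->|Pk0] := eqVneq (P' k) 0; first by rewrite size_poly0.
have [w sw e] := Hdiv j k.
pose d := (size (P' j)).-1.
have Pj0 : P' j != 0 by apply: contraNneq Pj => ->; rewrite coef0.
have sPj : size (P' j) = d.+1 by rewrite /d prednK // size_poly_gt0.
(* The divisibility with B cancelled. As P'_j has a nonzero constant term, its reversal has degree
   exactly d, and comparing degrees gives n + d + deg P'_k <= d + 2n. *)
have E : 'X^n * rv d (P' j) * P' k = 'X^d * (c^-1 *: w).
  apply: poly_circle_eq => z z1.
  have := congr1 (fun p => p.[z]) e.
  rewrite !hornerM !hornerXn hornerZ horner_rv_circle // horner_rv_circle ?sPj //.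
  rewrite (QE j) (QE k) (P'E j) (P'E k) !hornerM hornerXn !rmorphM rmorphXn /= [z^*]circle_conj //.
  have hE : H.[z] = z ^+ n * (c^-1 * (B.[z] * (B.[z])^* )).
    by rewrite -normCK BE // Hn //; field; rewrite z00 // gt_eqF.
  rewrite hE.
  have zr : z ^+ r != 0 by exact/expf_neq0/circle_neq0.
  have Bc : (B.[z])^* != 0 by rewrite conjC_eq0 B0.
  have cn0 : c != 0 by rewrite gt_eqF.
  rewrite mulnC exprM expr2 exprVn => e'.
  apply: (mulfI (z00 z z1)); apply: (mulfI (B0 z z1)); apply: (mulfI Bc).
  transitivity (z ^+ d * (z ^+ n * z ^+ n * (B.[z]^* * ((z ^+ r)^-1 * (P' j).[z]^*)) * (B.[z] * (z ^+ r * (P' k).[z])))).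
    by field.
  by rewrite e'; field.
have cd : (rv d (P' j))`_d != 0 by rewrite coef_rv leqnn subnn conjC_eq0.
have rv0 : rv d (P' j) != 0 by apply: contraNneq cd => ->; rewrite coef0.
have srv : size (rv d (P' j)) = d.+1.
  apply/eqP; rewrite eqn_leq size_rv /= ltnNge; apply/negP => h.
  by move: cd; rewrite nth_default ?eqxx.
have := congr1 (fun p : {poly C} => size p) E.
rewrite mulrAC size_mul ?mulf_neq0 ?expf_neq0 ?polyX_eq0 // srv mulrC size_mulXn // => e1.
have : (size ('X^d * (c^-1 *: w))%R <= d + (2 * n).+1)%N.
  rewrite mulrC; have [->|w0] := eqVneq (c^-1 *: w) 0; first by rewrite mul0r size_poly0.
  by rewrite size_mulXn // leq_add2l (leq_trans (size_scale_leq _ _)).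
by rewrite -e1 addnS /= addnC leq_add2l mul2n -addnn -addnS leq_add2l.
Qed.

End Factor.

(** * Complex integrals of bounded functions *)

Section BoundedMeasurable.
Context d (T : measurableType d) (R : realType).
Local Notation C := R[i].
Local Notation Re := complex.Re.
Local Notation Im := complex.Im.
Implicit Types f g : T -> C.

(** This class is closed under the algebra operations and conjugation, and for a finite measure all
    its members are integrable; it carries the side conditions of every linearity step for
    [cintegral]. *)
Definition bounded_measurable f :=
  [/\ measurable_fun setT (fun x => Re (f x)), measurable_fun setT (fun x => Im (f x)) &
      exists B : R, forall x, `|Re (f x)| <= B /\ `|Im (f x)| <= B].

Lemma bounded_measurable_ext f g : f =1 g -> bounded_measurable f -> bounded_measurable g.
Proof. by move=> fg; have -> : g = f by apply/funext => x; rewrite fg. Qed.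

Lemma bounded_measurable_cst (c : C) : bounded_measurable (fun=> c).
Proof.
split; [exact: measurable_cst|exact: measurable_cst|].
by exists (Num.max `|Re c| `|Im c|) => _; rewrite !le_max !lexx orbT.
Qed.

Lemma bounded_measurableD f g : bounded_measurable f -> bounded_measurable g ->
  bounded_measurable (fun x => f x + g x).
Proof.
move=> [mRf mIf [B fB]] [mRg mIg [D gD]]; split.
- by under eq_fun do rewrite raddfD /=; exact: measurable_funD.
- by under eq_fun do rewrite raddfD /=; exact: measurable_funD.
exists (B + D) => x; have [? ?] := fB x; have [? ?] := gD x.
by rewrite !raddfD /= !(le_trans (ler_normD _ _)) ?lerD.
Qed.

Lemma ReMc (x y : C) : Re (x * y) = Re x * Re y - Im x * Im y.
Proof. by case: x y => [? ?] [? ?]. Qed.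

Lemma ImMc (x y : C) : Im (x * y) = Re x * Im y + Im x * Re y.
Proof. by case: x y => [? ?] [? ?]. Qed.

Lemma bounded_measurableM f g : bounded_measurable f -> bounded_measurable g ->
  bounded_measurable (fun x => f x * g x).
Proof.
move=> [mRf mIf [B fB]] [mRg mIg [D gD]]; split.
- under eq_fun do rewrite ReMc.
  by apply: measurable_funB; exact: measurable_funM.
- under eq_fun do rewrite ImMc.
  by apply: measurable_funD; exact: measurable_funM.
exists (B * D + B * D) => x; have [? ?] := fB x; have [? ?] := gD x.
rewrite ReMc ImMc; split.
  by rewrite (le_trans (ler_normB _ _)) // !normrM lerD // ler_pM.
by rewrite (le_trans (ler_normD _ _)) // !normrM lerD // ler_pM.
Qed.

Lemma bounded_measurableN f : bounded_measurable f -> bounded_measurable (fun x => - f x).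
Proof.
move=> bf; apply: (@bounded_measurable_ext (fun x => -1 * f x)) => [x|]; first by rewrite mulN1r.
by apply: bounded_measurableM => //; exact: bounded_measurable_cst.
Qed.

Lemma ReJc (x : C) : Re (x^*) = Re x. Proof. by case: x. Qed.
Lemma ImJc (x : C) : Im (x^*) = - Im x. Proof. by case: x. Qed.

Lemma bounded_measurableJ f : bounded_measurable f -> bounded_measurable (fun x => (f x)^*).
Proof.
move=> [mRf mIf [B fB]]; split.
- by under eq_fun do rewrite ReJc.
- under eq_fun do rewrite ImJc.
  exact: measurableT_comp.
by exists B => x; have [? ?] := fB x; rewrite ReJc ImJc normrN.
Qed.

Lemma bounded_measurable_sum I (r : seq I) (P : pred I) (F : I -> T -> C) :
  (forall i, P i -> bounded_measurable (F i)) ->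
  bounded_measurable (fun x => \sum_(i <- r | P i) F i x).
Proof.
move=> FP; elim: r => [|i r IH].
  by apply: bounded_measurable_ext (bounded_measurable_cst 0) => x; rewrite big_nil.
have [Pi|Pi] := boolP (P i); last first.
  by apply: bounded_measurable_ext IH => x; rewrite big_cons (negbTE Pi).
by apply: bounded_measurable_ext (bounded_measurableD (FP i Pi) IH) => x; rewrite big_cons Pi.
Qed.

Lemma bounded_measurableX f n : bounded_measurable f -> bounded_measurable (fun x => f x ^+ n).
Proof.
move=> bf; elim: n => [|n IH]; first exact: bounded_measurable_cst.
by apply: bounded_measurable_ext (bounded_measurableM bf IH) => x; rewrite exprS.
Qed.

Section Integral.
Variable (mu : {measure set T -> \bar R}).
Hypothesis mufin : (mu setT < +oo)%E.

Lemma bounded_integrable (f : T -> R) B : measurable_fun setT f -> (forall x, `|f x| <= B) ->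
  mu.-integrable setT (EFin \o f).
Proof.
move=> mf fB; apply: measurable_bounded_integrable => //.
exists B; split; first exact: num_real.
by move=> x Bx y _; apply: (le_trans (fB y)); exact: ltW.
Qed.

Lemma bounded_measurable_integrable f : bounded_measurable f ->
  mu.-integrable setT (EFin \o (fun x => Re (f x))) /\
  mu.-integrable setT (EFin \o (fun x => Im (f x))).
Proof.
move=> [mR mI [B fB]]; split; apply: (@bounded_integrable _ B) => // x; by have [] := fB x.
Qed.

Lemma eq_cintegral f g : f =1 g -> cintegral mu f = cintegral mu g.
Proof. by move=> fg; congr cintegral; apply/funext. Qed.

Lemma cintegralD f g : bounded_measurable f -> bounded_measurable g ->
  cintegral mu (fun x => f x + g x) = cintegral mu f + cintegral mu g.
Proof.
move=> /bounded_measurable_integrable[Rf If] /bounded_measurable_integrable[Rg Ig].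
rewrite /cintegral; apply/eqP; rewrite eq_complex /=; apply/andP; split; apply/eqP.
  by rewrite -RintegralD //; apply: eq_Rintegral => x _; rewrite raddfD.
by rewrite -RintegralD //; apply: eq_Rintegral => x _; rewrite raddfD.
Qed.

Lemma cintegralZ (c : C) f : bounded_measurable f ->
  cintegral mu (fun x => c * f x) = c * cintegral mu f.
Proof.
move=> /bounded_measurable_integrable[Rf If].
have ZI (r : R) (h : T -> R) : mu.-integrable setT (EFin \o h) ->
    mu.-integrable setT (EFin \o (fun x => r * h x)).
  by move=> hi; have := integrableZl measurableT r hi; apply: eq_integrable.
rewrite /cintegral; apply/eqP; rewrite eq_complex ReMc ImMc /=; apply/andP; split; apply/eqP.
  rewrite -!RintegralZl // -RintegralB ?ZI //.
  by apply: eq_Rintegral => x _; rewrite ReMc.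
rewrite -!RintegralZl // -RintegralD ?ZI //.
by apply: eq_Rintegral => x _; rewrite ImMc.
Qed.

Lemma cintegralN f : bounded_measurable f ->
  cintegral mu (fun x => - f x) = - cintegral mu f.
Proof.
move=> bf; rewrite -[RHS]mulN1r -cintegralZ //.
by apply: eq_cintegral => x; rewrite mulN1r.
Qed.

Lemma cintegral0 : cintegral mu (fun=> 0) = 0.
Proof.
rewrite -[RHS](mul0r (cintegral mu (fun=> 0))) -cintegralZ; last exact: bounded_measurable_cst.
by apply: eq_cintegral => x; rewrite mulr0.
Qed.

Lemma cintegral_sum I (r : seq I) (P : pred I) (F : I -> T -> C) :
  (forall i, P i -> bounded_measurable (F i)) ->
  cintegral mu (fun x => \sum_(i <- r | P i) F i x) = \sum_(i <- r | P i) cintegral mu (F i).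
Proof.
move=> FP; elim: r => [|i r IH].
  by rewrite [RHS]big_nil -[RHS]cintegral0; apply: eq_cintegral => x; rewrite big_nil.
rewrite big_cons; case: ifPn => Pi.
  rewrite -IH -cintegralD; [|exact: FP|exact: bounded_measurable_sum].
  by apply: eq_cintegral => x; rewrite big_cons Pi.
by rewrite -IH; apply: eq_cintegral => x; rewrite big_cons (negbTE Pi).
Qed.

Lemma cintegralJ f : bounded_measurable f ->
  cintegral mu (fun x => (f x)^*) = (cintegral mu f)^*.
Proof.
move=> /bounded_measurable_integrable[Rf If].
rewrite /cintegral; apply/eqP; rewrite eq_complex ReJc ImJc /=; apply/andP; split; apply/eqP.
  by apply: eq_Rintegral => x _; rewrite ReJc.
rewrite -[RHS]mulN1r -RintegralZl //.
by apply: eq_Rintegral => x _; rewrite ImJc mulN1r.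
Qed.

Lemma cintegral_ge0 f : (forall x, 0 <= f x) -> 0 <= cintegral mu f.
Proof.
move=> f0; rewrite lecE /=; apply/andP; split.
  rewrite (_ : (\int[mu]_x Im (f x)) = 0) //.
  transitivity (\int[mu]_(x in setT) (0 : R)); last by rewrite Rintegral_cst // mul0r.
  by apply: eq_Rintegral => x _; exact/ger0_Im/f0.
by apply: Rintegral_ge0 => x _; have := f0 x; rewrite lecE => /andP[].
Qed.

Lemma cintegral_le (f g : T -> C) : bounded_measurable f -> bounded_measurable g ->
  (forall x, f x <= g x) -> cintegral mu f <= cintegral mu g.
Proof.
move=> bf bg fg; rewrite -subr_ge0 -cintegralN // -cintegralD //; last exact: bounded_measurableN.
by apply: cintegral_ge0 => x; rewrite subr_ge0.
Qed.

Lemma cvg_cintegral (f_ : nat -> T -> C) f (B : R) :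
    (forall n, bounded_measurable (f_ n)) ->
    (forall n x, `|f_ n x| <= B%:C%C) ->
    (forall x, (Re (f_ n x) @[n --> \oo] --> Re (f x)) /\
               (Im (f_ n x) @[n --> \oo] --> Im (f x))) ->
  (Re (cintegral mu (f_ n)) @[n --> \oo] --> Re (cintegral mu f)) /\
  (Im (cintegral mu (f_ n)) @[n --> \oo] --> Im (cintegral mu f)).
Proof.
move=> bf fB fl.
have ReB n x : `|Re (f_ n x)| <= B.
  by have := le_trans (normc_ge_Re _) (fB n x); rewrite lecR.
have ImB n x : `|Im (f_ n x)| <= B.
  rewrite -lecR; apply: le_trans (fB n x).
  have := normc_ge_Re ('i%C * f_ n x); rewrite mulrC ReiNIm normrN => /le_trans; apply.
  by rewrite normrM [X in _ * X]normc_def /= expr0n expr1n add0r sqrtr1 mulr1.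
have key (h_ : nat -> T -> R) (h : T -> R) :
    (forall n, measurable_fun setT (h_ n)) -> (forall n x, `|h_ n x| <= B) ->
    (forall x, h_ n x @[n --> \oo] --> h x) ->
    \int[mu]_x h_ n x @[n --> \oo] --> \int[mu]_x h x.
  move=> mh hB hl.
  have mh' : measurable_fun setT h by apply: measurable_fun_cvg => // x _; exact: hl.
  have [ih _ cv] : [/\ mu.-integrable setT (EFin \o h),
      [sequence (\int[mu]_(x in setT) `|(h_ n x)%:E - (h x)%:E|)%E]_n @ \oo --> 0%E &
      [sequence (\int[mu]_(x in setT) (h_ n x)%:E)%E]_n @ \oo -->
        (\int[mu]_(x in setT) (h x)%:E)%E].
    apply: (@dominated_convergence _ _ _ mu setT measurableT _ _ (cst B%:E)) => //.
    - by move=> n; exact/measurable_EFinP.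
    - exact/measurable_EFinP.
    - by apply: aeW => x _; apply: cvg_EFin; [exact: nearW|exact: hl].
    - exact: (@bounded_integrable (cst B) `|B|).
    - by apply: aeW => x n _; rewrite lee_fin.
  have fin : (\int[mu]_(x in setT) (h x)%:E)%E \is a fin_num by exact: integrable_fin_num ih.
  rewrite /Rintegral; apply: fine_cvg; rewrite fineK //.
by split; apply: key => // [n|x]; [have [] := bf n|have [] := fl x|have [] := bf n|have [] := fl x].
Qed.
End Integral.
End BoundedMeasurable.

Lemma unif_continuous_normed (R : realType) (K : numFieldType) (V : normedModType K) (f : V -> R) :
    (forall e : R, 0 < e -> exists2 d : K, 0 < d & forall x y, `|x - y| < d -> `|f x - f y| < e) ->
  continuous f.
Proof.
move=> fE z; apply/cvgrPdist_lt => /= e /fE[d d0 fd].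
have /cvgrPdist_lt/(_ _ d0) := @cvg_id _ (nbhs z).
by apply: filterS => t; exact: fd.
Qed.

Section CircleFunctions.
Context {R : realType}.
Local Notation C := R[i].
Local Notation Re := complex.Re.
Local Notation Im := complex.Im.

Lemma norm_circle_val (z : circle R) : `|circle_val z| = 1.
Proof. exact: (set_valP z). Qed.

Lemma normr_Re_le (x : C) : `|Re x| <= ComplexField.Normc.normc x.
Proof. by rewrite -lecR; exact: normc_ge_Re. Qed.

Lemma normr_Im_le (x : C) : `|Im x| <= ComplexField.Normc.normc x.
Proof.
rewrite -lecR; have := normc_ge_Re ('i%C * x); rewrite mulrC ReiNIm normrN => /le_trans; apply.
by rewrite normrM [X in _ * X]normc_def /= expr0n expr1n add0r sqrtr1 mulr1.
Qed.

Lemma continuous_circle_coord (f : C -> R) :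
  {morph f : x y / x - y} -> (forall x, `|f x| <= ComplexField.Normc.normc x) ->
  continuous (fun z : set_type (unit_circle R) => f (set_val z)).
Proof.
move=> fB fn z; apply: (@continuous_comp _ _ _ (set_val : set_type (unit_circle R) -> R[i]^o) (f : R[i]^o -> R)).
  exact: initial_continuous.
apply: (@unif_continuous_normed _ (R[i] : numFieldType) (R[i]^o : normedModType _)) => e e0; exists e%:C%C; first by rewrite ltcR.
by move=> x y xy; rewrite -fB; apply: le_lt_trans (fn _) _; rewrite -ltcR.
Qed.

Lemma measurable_circle_coord (f : C -> R) :
  {morph f : x y / x - y} -> (forall x, `|f x| <= ComplexField.Normc.normc x) ->
  measurable_fun [set: circle R] (fun z => f (circle_val z)).
Proof.
move=> fB fn; apply: (measurability _ (RGenOInfty.measurableE R)) => // _ [_ [a ->] <-].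
rewrite setTI; apply: sub_sigma_algebra => /=.
have /continuousP := continuous_circle_coord fB fn; apply.
exact: interval_open.
Qed.

Lemma bounded_measurable_circle_val : bounded_measurable (@circle_val R).
Proof.
split; [exact: (measurable_circle_coord (raddfB _) normr_Re_le) |
        exact: (measurable_circle_coord (raddfB _) normr_Im_le) |].
by exists 1 => z; split; apply: le_trans (normr_Re_le _) _ || apply: le_trans (normr_Im_le _) _;
  rewrite -lecR -[X in X <= _]/`|circle_val z| norm_circle_val.
Qed.

Lemma bounded_measurable_comp d1 d2 (T1 : measurableType d1) (T2 : measurableType d2)
  (h : T1 -> T2) (f : T2 -> C) : measurable_fun setT h -> bounded_measurable f ->
  bounded_measurable (f \o h).
Proof.
move=> mh [mR mI [B fB]]; split.
- exact: (measurableT_comp mR mh).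
- exact: (measurableT_comp mI mh).
by exists B => x; exact: fB.
Qed.

Lemma uniform_periodic_mean (f F : R -> R) :
    continuous f -> (forall x, `|f x| <= 1) -> (forall x : R, is_derive x 1 F (f x)) ->
    F (2 * pi) = F 0 ->
  \int[uniform_prob (twopi_gt0 R)]_x f x = 0.
Proof.
move=> cf fb dF F2pi.
set P := uniform_prob _.
have mf : measurable_fun setT f by exact: continuous_measurable_fun.
(* The formula for the uniform law is applied to a nonnegative integrand: 1 is added to f, whose
   values lie in [-1, 1], and subtracted at the end. *)
have cf1 : continuous (fun x => f x + 1).
  by move=> x; apply: cvgD; [exact: cf|exact: cvg_cst].
have dG (x : R) : is_derive x 1 (fun y => F y + y) (f x + 1) by exact: is_deriveD.
have P1 : P setT = 1%E by exact: (@probability_setT _ _ _ (uniform_prob (twopi_gt0 R))).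
have Pfin : (P setT < +oo)%E by rewrite P1 ltry.
have intf : P.-integrable setT (EFin \o f) by exact: (bounded_integrable Pfin (B := 1)).
have int1 : P.-integrable setT (EFin \o (cst 1 : R -> R)).
  by apply: (bounded_integrable Pfin (B := `|1|)).
have f1 : \int[P]_x (f x + 1) = 1.
  rewrite /Rintegral integral_uniform.
  - have -> : (\int[lebesgue_measure]_(x in `[(0:R)%R, (2 * pi)%R]%classic) (f x + 1)%:E)%E = (2 * pi)%:E.
      rewrite (@continuous_FTC2 _ _ (fun y => F y + y)) ?twopi_gt0 //.
      + by rewrite -EFinB F2pi; congr EFin; ring.
      + exact: continuous_subspaceT.
      + have cG : continuous (fun y => F y + y).
          by move=> x; apply: differentiable_continuous; apply/derivable1_diffP; have [] := dG x.
        split; [|exact/cvg_at_right_filter/cG|exact/cvg_at_left_filter/cG].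
        by move=> x _; have [] := dG x.
      + by move=> x _; rewrite derive1E; have [_] := dG x.
    by rewrite subr0 -EFinM /= mulVf // gt_eqF // twopi_gt0.
  - by apply/measurable_EFinP; apply: measurable_funD.
  - by move=> x; rewrite lee_fin; have := fb x; rewrite ler_norml => /andP[]; lra.
have : \int[P]_x (f x + 1) = \int[P]_x f x + 1.
  by rewrite RintegralD // Rintegral_cst // mul1r; congr (_ + _); exact: (congr1 fine P1).
by rewrite f1 -{1}[1]add0r => /addIr/esym.
Qed.

Lemma circle_val_cisX (t : R) k : circle_val (circle_cis t) ^+ k = (cos (k%:R * t) +i* sin (k%:R * t))%C.
Proof.
elim: k => [|k IH]; first by rewrite mul0r cos0 sin0.
rewrite exprS IH -natr1 mulrDl mul1r cosD sinD /circle_val /= set_valE /=.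
by apply/eqP; rewrite eq_complex /=; apply/andP; split; apply/eqP; ring.
Qed.

Lemma cintegral_circle (f : circle R -> C) : bounded_measurable f ->
  cintegral (circle_measure R) f = cintegral (uniform_prob (twopi_gt0 R)) (f \o (@circle_cis R)).
Proof.
move=> bf; have bfc : bounded_measurable (f \o (@circle_cis R)).
  by apply: bounded_measurable_comp bf; exact: measurable_circle_cis.
have Pfin : (uniform_prob (twopi_gt0 R) setT < +oo)%E.
  by rewrite [X in (X < _)%E](@probability_setT _ _ _ (uniform_prob (twopi_gt0 R))) ltry.
have [i1 i2] := bounded_measurable_integrable Pfin bfc.
have [m1 m2 _] := bf.
rewrite /cintegral /circle_measure /Rintegral; congr (fine _ +i* fine _)%C.
  by rewrite integral_distribution //; exact/measurable_EFinP.
by rewrite integral_distribution //; exact/measurable_EFinP.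
Qed.

Lemma circle_moment k : (0 < k)%N -> cintegral (circle_measure R) (fun z => circle_val z ^+ k) = 0.
Proof.
move=> k0; rewrite cintegral_circle; last exact: (bounded_measurableX k bounded_measurable_circle_val).
have kn0 : k%:R != 0 :> R by rewrite pnatr_eq0 -lt0n.
have ck : continuous (fun t : R => k%:R * t) by move=> x; apply: cvgM; [exact: cvg_cst|exact: cvg_id].
have dk (x : R) : is_derive x 1 (fun t : R => k%:R * t) k%:R.
  by apply: (is_derive_eq (is_deriveZ k%:R (is_derive_id x (1 : R)))); rewrite /GRing.scale /= mulr1.
have k2pi : k%:R * (2 * pi) = 0 + (pi *+ 2) *+ k :> R by rewrite add0r !mulr_natl.
have sin2 : sin (k%:R * (2 * pi)) = 0 :> R.
  by rewrite k2pi; elim: (k) => [|j IH]; rewrite ?mulr0n ?addr0 ?sin0 // mulrSr addrA sinD2pi.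
have cos2 : cos (k%:R * (2 * pi)) = 1 :> R.
  by rewrite k2pi; elim: (k) => [|j IH]; rewrite ?mulr0n ?addr0 ?cos0 // mulrSr addrA cosD2pi.
apply/eqP; rewrite eq_complex; apply/andP; split; apply/eqP => /=.
  transitivity (\int[uniform_prob (twopi_gt0 R)]_x cos (k%:R * x)).
    by apply: eq_Rintegral => x _ /=; rewrite circle_val_cisX.
  apply: (@uniform_periodic_mean _ (fun t => k%:R^-1 * sin (k%:R * t))).
  - by move=> x; apply: continuous_comp; [exact: ck|exact: continuous_cos].
  - by move=> x; rewrite ler_norml cos_geN1 cos_le1.
  - move=> x; apply: (is_derive_eq (is_deriveZ k%:R^-1 (is_derive1_comp (is_derive_sin (k%:R * x)) (dk x)))).
  by rewrite /GRing.scale /= mulrCA mulVf ?mulr1.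
  - by rewrite sin2 !mulr0 sin0 mulr0.
transitivity (\int[uniform_prob (twopi_gt0 R)]_x sin (k%:R * x)).
  by apply: eq_Rintegral => x _ /=; rewrite circle_val_cisX.
apply: (@uniform_periodic_mean _ (fun t => - k%:R^-1 * cos (k%:R * t))).
- by move=> x; apply: continuous_comp; [exact: ck|exact: continuous_sin].
- by move=> x; rewrite ler_norml sin_geN1 sin_le1.
- move=> x; apply: (is_derive_eq (is_deriveZ (- k%:R^-1) (is_derive1_comp (is_derive_cos (k%:R * x)) (dk x)))).
  by rewrite /GRing.scale /=; field.
- by rewrite cos2 !mulr0 cos0.
Qed.

End CircleFunctions.

(** * Integration against a measure given by a density *)

Section Density.
Context d (T : measurableType d) (R : realType).
Variables (mu sigma : {measure set T -> \bar R}) (rho : T -> R).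
Hypotheses (mrho : measurable_fun setT rho) (rho0 : forall x, 0 <= rho x).
Hypothesis muE : forall A, measurable A -> mu A = (\int[sigma]_(x in A) (rho x)%:E)%E.
Local Open Scope ereal_scope.
Import HBNNSimple.

Let integral_density_nnsfun (f : {nnsfun T >-> R}) :
  \int[mu]_x (f x)%:E = \int[sigma]_x ((f x)%:E * (rho x)%:E).
Proof.
have mrhoE : measurable_fun setT (EFin \o rho) by exact/measurable_EFinP.
under [LHS]eq_integral do rewrite fimfunE -fsumEFin//.
rewrite [LHS]ge0_integral_fsum//; last 2 first.
  - by move=> r; exact/measurable_EFinP/measurableT_comp.
  - by move=> n x _; rewrite EFinM nnfun_muleindic_ge0.
under [RHS]eq_integral.
  move=> x xD; rewrite fimfunE -fsumEFin// muleC ge0_mule_fsumr; last first.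
    by move=> r; rewrite EFinM nnfun_muleindic_ge0.
  over.
rewrite [RHS]ge0_integral_fsum//; last 2 first.
  - move=> r; apply: emeasurable_funM => //.
    by apply/measurable_EFinP; apply/measurableT_comp.
  - by move=> n x _; apply: mule_ge0; [rewrite lee_fin|rewrite EFinM nnfun_muleindic_ge0].
apply: eq_fsbigr => r _.
have mA : measurable (f @^-1` [set r]) by exact: measurable_sfunP.
have [r0|r0] := leP 0%R r; last first.
  have -> : f @^-1` [set r] = set0.
    apply/seteqP; split=> // x /= fx; have : (0 <= f x)%R by [].
    by rewrite fx leNgt r0.
  by rewrite !integral0_eq // => x _; rewrite indic0 mulr0 ?mule0.
under eq_integral do rewrite EFinM.
under [RHS]eq_integral do rewrite EFinM muleCA.
rewrite [LHS]ge0_integralZl //; last exact/measurable_EFinP/measurable_indic.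
rewrite [RHS]ge0_integralZl //; last 2 first.
- by apply: emeasurable_funM => //; exact/measurable_EFinP/measurable_indic.
- by move=> x _; rewrite mule_ge0 // lee_fin.
congr (_ * _); rewrite integral_indic // setIT muE // [LHS]integral_mkcond.
apply: eq_integral => x _; rewrite patchE indicE.
by case: ifPn => _; rewrite ?mule1 ?mule0.
Qed.

(** Simple functions are settled by the defining property of the density; monotone convergence on
    both sides does the rest. *)
Lemma ge0_integral_density (f : T -> \bar R) :
  measurable_fun setT f -> (forall x, 0 <= f x) ->
  \int[mu]_x f x = \int[sigma]_x (f x * (rho x)%:E).
Proof.
move=> mf f0.
have mrhoE : measurable_fun setT (EFin \o rho) by exact/measurable_EFinP.
pose f_ := nnsfun_approx measurableT mf.
have mf_ n : measurable_fun setT (fun x => (f_ n x)%:E) by exact/measurable_EFinP/measurable_funTS.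
transitivity (limn (fun n => \int[mu]_x (f_ n x)%:E)).
  rewrite -monotone_convergence//=.
  - apply: eq_integral => ? /[!inE] xD; apply/esym/cvg_lim => //=.
    exact: cvg_nnsfun_approx.
  - by move=> n ? _; rewrite lee_fin.
  - by move=> ? _ ? ? mn; rewrite lee_fin; exact/lefP/nd_nnsfun_approx.
transitivity (limn (fun n => \int[sigma]_x ((f_ n x)%:E * (rho x)%:E))).
  by apply: congr_lim; apply/funext => n /=; exact: integral_density_nnsfun.
rewrite -monotone_convergence//=.
- apply: eq_integral => x /[!inE] xD; apply/cvg_lim => //.
  by apply: cvgeMr => //; exact: cvg_nnsfun_approx.
- by move=> n; apply: emeasurable_funM.
- by move=> n ? _; rewrite mule_ge0 // lee_fin.
- move=> x _ n m nm; rewrite lee_wpmul2r ?lee_fin //.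
  exact/lefP/nd_nnsfun_approx.
Qed.

Hypotheses (mufin : mu setT < +oo) (sigmafin : sigma setT < +oo).
Variable (B : R).
Hypothesis rhoB : forall x, (rho x <= B)%R.
Local Close Scope ereal_scope.

Lemma Rintegral_density (f : T -> R) D : measurable_fun setT f -> (forall x, `|f x| <= D) ->
  \int[mu]_x f x = \int[sigma]_x (f x * rho x).
Proof.
move=> mf fD.
have rB x : `|rho x| <= B by rewrite ger0_norm.
have fr x : `|f x * rho x| <= D * B by rewrite normrM ler_pM.
have mfr : measurable_fun setT (fun x => f x * rho x) by exact: measurable_funM.
have mDr : measurable_fun setT (fun x => D * rho x) by exact: measurable_funM.
have Dr x : `|D * rho x| <= `|D| * B by rewrite normrM ler_wpM2l.
have pos (g : T -> R) : measurable_fun setT g -> (forall x, 0 <= g x) ->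
    \int[mu]_x g x = \int[sigma]_x (g x * rho x).
  move=> mg g0; rewrite /Rintegral ge0_integral_density //.
  exact/measurable_EFinP.
(* Adding the bound D makes the integrand nonnegative; the integral of D is cancelled afterwards,
   which uses finiteness of both measures. *)
have : \int[mu]_x (f x + D) = \int[sigma]_x ((f x + D) * rho x).
  apply: pos; first exact: measurable_funD.
  by move=> x; have := fD x; rewrite ler_norml -lerBlDr sub0r => /andP[].
have D0 (x : T) : 0 <= D by apply: le_trans (fD x).
have DE : \int[mu]_x (cst D x : R) = \int[sigma]_x (cst D x * rho x) by apply: pos.
rewrite RintegralD //; [|exact: (bounded_integrable mufin mf fD)|exact: (bounded_integrable mufin (B := `|D|))].
under [X in _ = X -> _]eq_Rintegral do rewrite mulrDl.
rewrite RintegralD //; [|exact: (bounded_integrable sigmafin mfr fr)|exact: (bounded_integrable sigmafin mDr Dr)].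
by rewrite DE => /addIr.
Qed.

Lemma cintegral_density (f : T -> R[i]) : bounded_measurable f ->
  cintegral mu f = cintegral sigma (fun x => f x * (rho x)%:C%C).
Proof.
move=> [mR mI [D fD]]; rewrite /cintegral; apply/eqP; rewrite eq_complex /=; apply/andP; split; apply/eqP.
  rewrite (@Rintegral_density _ D) //; last by move=> x; have [] := fD x.
  by apply: eq_Rintegral => x _; rewrite ReMc /= mulr0 subr0.
rewrite (@Rintegral_density _ D) //; last by move=> x; have [] := fD x.
by apply: eq_Rintegral => x _; rewrite ImMc /= mulr0 add0r.
Qed.

End Density.

(** * Iterated integrals on the torus *)

Section Torus.
Context {R : realType}.
Local Notation C := R[i].
Local Notation X := (circle R * circle R)%type.

Lemma torus_measureT : torus_measure R setT = 1%E.
Proof.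
rewrite -setXTT [LHS]product_measure1E //.
by rewrite [X in (X * _)%E = _]probability_setT [X in (_ * X)%E = _]probability_setT mule1.
Qed.

Lemma torus_measure_fin : (torus_measure R setT < +oo)%E.
Proof. by rewrite torus_measureT ltry. Qed.

Lemma circle_measure_fin : (circle_measure R setT < +oo)%E.
Proof. by rewrite [X in (X < _)%E]probability_setT ltry. Qed.

Lemma Rintegral_torus (f : X -> R) B : measurable_fun setT f -> (forall x, `|f x| <= B) ->
  measurable_fun setT (fun x => \int[circle_measure R]_y f (x, y)) /\
  \int[torus_measure R]_z f z = \int[circle_measure R]_x \int[circle_measure R]_y f (x, y).
Proof.
move=> mf fB.
have fi : (torus_measure R).-integrable setT (EFin \o f) by exact: (bounded_integrable torus_measure_fin mf fB).
have inner x : (\int[circle_measure R]_y (f (x, y))%:E)%E = (\int[circle_measure R]_y f (x, y))%:E.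
  rewrite fineK //; apply: integrable_fin_num => //.
  apply: (bounded_integrable circle_measure_fin (B := B)) => //.
  exact: measurableT_comp.
split.
  apply/measurable_EFinP.
  by have := measurable_fubini_F fi; apply: eq_measurable_fun => x _; rewrite /fubini_F /= inner.
have := integral12_prod_meas1 fi; rewrite /fubini_F /= => e.
rewrite /Rintegral -[X in fine X = _]e; congr fine.
by apply: eq_integral => x _; rewrite inner.
Qed.

Lemma cintegral_torus (f : X -> C) : bounded_measurable f ->
  cintegral (torus_measure R) f =
  cintegral (circle_measure R) (fun x => cintegral (circle_measure R) (fun y => f (x, y))).
Proof.
move=> [mR mI [B fB]]; rewrite /cintegral.
have [_ ->] := Rintegral_torus mR (fun x => (fB x).1).
by have [_ ->] := Rintegral_torus mI (fun x => (fB x).2).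
Qed.

End Torus.

(** * The sesquilinear form of a measure on the torus *)

Section Form.
Context {R : realType}.
Local Notation C := R[i].
Local Notation X := (circle R * circle R)%type.
Local Notation pol2 := {poly {poly C}}.
Implicit Types (f g : pol2).

(* The outer variable of a polynomial in [{poly {poly C}}] is z_2, the inner one is
   z_1. *)
Definition pev f (z : X) : C := f.[circle_val z.2, circle_val z.1].

Lemma pevD f g z : pev (f + g) z = pev f z + pev g z.
Proof. by rewrite /pev !hornerE. Qed.

Lemma pevN f z : pev (- f) z = - pev f z.
Proof. by rewrite /pev !hornerE. Qed.

Lemma pevM f g z : pev (f * g) z = pev f z * pev g z.
Proof. by rewrite /pev !hornerE. Qed.

Lemma pevZ (c : {poly C}) f z : pev (c *: f) z = c.[circle_val z.1] * pev f z.
Proof. by rewrite /pev !hornerE. Qed.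

Lemma pev_sum I (r : seq I) (P : pred I) (F : I -> pol2) z :
  pev (\sum_(i <- r | P i) F i) z = \sum_(i <- r | P i) pev (F i) z.
Proof. by rewrite /pev !horner_sum. Qed.

Definition mono (k l : nat) : pol2 := 'X^k *: 'X^l.

Lemma pev_mono k l z : pev (mono k l) z = circle_val z.1 ^+ k * circle_val z.2 ^+ l.
Proof. by rewrite /pev /mono hornerZ hornerXn -rmorphXn /= hornerM hornerXn hornerC. Qed.

Lemma monoM a b c d : mono a b * mono c d = mono (a + c) (b + d).
Proof. by rewrite /mono -scalerAl -scalerAr scalerA -!exprD. Qed.

Lemma coef_mono k l b a : ((mono k l)`_b)`_a = ((a == k) && (b == l))%:R.
Proof.
rewrite /mono coefZ coefXn; case: eqVneq => _ /=; rewrite ?andbF ?andbT.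
  by rewrite mulr1 coefXn.
by rewrite mulr0 coef0.
Qed.

Lemma pol2_mono f : f = \sum_(l < size f) \sum_(k < size f`_l) (f`_l`_k)%:P *: mono k l.
Proof.
rewrite -[LHS]coefK poly_def; apply: eq_bigr => l _.
rewrite -[X in X *: _ = _]coefK poly_def scaler_suml; apply: eq_bigr => k _.
by rewrite /mono scalerA mul_polyC.
Qed.

Lemma pol2_mono_wide f N M : (size f <= M.+1)%N -> (forall l, (size (f`_l)%R <= N.+1)%N) ->
  f = \sum_(l < M.+1) \sum_(k < N.+1) (f`_l`_k)%:P *: mono k l.
Proof.
move=> sf sfl; apply/polyP => b; apply/polyP => a.
rewrite !coef_sum; rewrite (eq_bigr (fun l : 'I_M.+1 => \sum_(k < N.+1) f`_l`_k * ((a == k) && (b == l))%:R)); last first.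
  move=> l _; rewrite !coef_sum; apply: eq_bigr => k _.
  by rewrite coefZ coefCM coef_mono.
have [bM|bM] := ltnP b M.+1; last first.
  have -> : f`_b = 0 by rewrite nth_default // (leq_trans sf).
  rewrite coef0 big1 // => l _; rewrite big1 // => k _.
  rewrite (_ : (b == l) = false) ?andbF ?mulr0 //.
  by apply/negbTE; rewrite neq_ltn (leq_trans (ltn_ord l) bM) orbT.
rewrite (bigD1 (Ordinal bM)) //= [X in _ + X]big1 ?addr0; last first.
  move=> l lb; rewrite big1 // => k _; rewrite (_ : (b == l) = false) ?andbF ?mulr0 //.
  by apply: contraNF lb => /eqP e; apply/eqP/val_inj.
have [aN|aN] := ltnP a N.+1; last first.
  rewrite nth_default ?(leq_trans (sfl b)) // big1 // => k _.
  rewrite (_ : (a == k) = false) ?mulr0 //.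
  by apply/negbTE; rewrite neq_ltn (leq_trans (ltn_ord k) aN) orbT.
rewrite (bigD1 (Ordinal aN)) //= [X in _ + X]big1 ?addr0 ?eqxx ?mulr1 // => k ka.
rewrite (_ : (a == k) = false) ?mulr0 //.
by apply: contraNF ka => /eqP e; apply/eqP/val_inj.
Qed.

Lemma bounded_measurable_pev d (T : measurableType d) (h1 h2 : T -> circle R) f :
  measurable_fun setT h1 -> measurable_fun setT h2 ->
  bounded_measurable (fun t => pev f (h1 t, h2 t)).
Proof.
move=> m1 m2; rewrite (pol2_mono f).
apply: (@bounded_measurable_ext _ _ _ (fun t => \sum_(l < size f) \sum_(k < size f`_l)
   f`_l`_k * (circle_val (h1 t) ^+ k * circle_val (h2 t) ^+ l))).
  move=> t; rewrite pev_sum; apply: eq_bigr => l _; rewrite pev_sum; apply: eq_bigr => k _.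
  by rewrite pevZ hornerC pev_mono.
apply: bounded_measurable_sum => l _; apply: bounded_measurable_sum => k _.
apply: bounded_measurableM; first exact: bounded_measurable_cst.
apply: bounded_measurableM; apply: bounded_measurableX.
  exact: (bounded_measurable_comp m1 bounded_measurable_circle_val).
exact: (bounded_measurable_comp m2 bounded_measurable_circle_val).
Qed.

Lemma bm_pev f : bounded_measurable (pev f).
Proof.
apply: bounded_measurable_ext (bounded_measurable_pev f measurable_fst measurable_snd).
by case.
Qed.

Lemma bm_ip f g : bounded_measurable (fun z => pev f z * (pev g z)^*).
Proof. by apply: bounded_measurableM; [|apply: bounded_measurableJ]; exact: bm_pev. Qed.

Variable (mu : {measure set X -> \bar R}).
Hypothesis mufin : (mu setT < +oo)%E.

Definition ip f g := cintegral mu (fun z => pev f z * (pev g z)^*).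

Lemma ip_eq f g f' g' : (forall z, pev f z * (pev g z)^* = pev f' z * (pev g' z)^*) ->
  ip f g = ip f' g'.
Proof. by move=> e; apply: eq_cintegral. Qed.

Lemma ipC f g : ip g f = (ip f g)^*.
Proof.
rewrite /ip -cintegralJ //; last exact: bm_ip.
by apply: eq_cintegral => z; rewrite rmorphM /= conjCK mulrC.
Qed.

Lemma ipDl f g h : ip (f + g) h = ip f h + ip g h.
Proof.
rewrite /ip -cintegralD //; try exact: bm_ip.
by apply: eq_cintegral => z; rewrite pevD mulrDl.
Qed.

Lemma ipZl c f g : ip (c%:P *: f) g = c * ip f g.
Proof.
rewrite /ip -cintegralZ //; last exact: bm_ip.
by apply: eq_cintegral => z; rewrite pevZ hornerC mulrA.
Qed.

Lemma ipDr f g h : ip h (f + g) = ip h f + ip h g.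
Proof. by rewrite ipC ipDl rmorphD /= -!ipC. Qed.

Lemma ipZr c f g : ip g (c%:P *: f) = c^* * ip g f.
Proof. by rewrite ipC ipZl rmorphM /= -ipC. Qed.

Lemma ip0l f : ip 0 f = 0.
Proof. by rewrite -(scaler0 _ (0%:P)) ipZl mul0r. Qed.

Lemma ip0r f : ip f 0 = 0.
Proof. by rewrite ipC ip0l rmorph0. Qed.

Lemma ipNl f g : ip (- f) g = - ip f g.
Proof. by apply/eqP; rewrite -addr_eq0 -ipDl addNr ip0l. Qed.

Lemma ip_suml I (r : seq I) (P : pred I) (F : I -> pol2) g :
  ip (\sum_(i <- r | P i) F i) g = \sum_(i <- r | P i) ip (F i) g.
Proof. by elim/big_rec2: _ => [|i x y _ <-]; rewrite ?ip0l ?ipDl. Qed.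

Lemma ip_sumr I (r : seq I) (P : pred I) (F : I -> pol2) g :
  ip g (\sum_(i <- r | P i) F i) = \sum_(i <- r | P i) ip g (F i).
Proof. by elim/big_rec2: _ => [|i x y _ <-]; rewrite ?ip0r ?ipDr. Qed.

Lemma ip_ge0 f : 0 <= ip f f.
Proof. by apply: cintegral_ge0 => z; rewrite -normCK exprn_ge0. Qed.

(** Monomials are unimodular on the torus. This is the Toeplitz structure of the moments, on which
    every later change of box rests. *)
Lemma ip_shift a b f g : ip (mono a b * f) (mono a b * g) = ip f g.
Proof.
apply: ip_eq => z; rewrite !pevM pev_mono !rmorphM !rmorphXn /=.
have h1 := circle_mulC (norm_circle_val z.1); have h2 := circle_mulC (norm_circle_val z.2).
set x := circle_val z.1 in h1 *; set y := circle_val z.2 in h2 *.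
transitivity (((x * x^*) ^+ a * (y * y^*) ^+ b) * (pev f z * (pev g z)^* )).
  by rewrite !exprMn; ring.
by rewrite h1 h2 !expr1n !mul1r.
Qed.

Lemma ip_CauchySchwarz f g : `|ip f g| ^+ 2 <= ip f f * ip g g.
Proof.
have key (t : C) : 0 <= ip f f - t^* * ip f g - t * (ip f g)^* + `|t| ^+ 2 * ip g g.
  have := ip_ge0 (f + (- t)%:P *: g).
  rewrite ipDl !ipDr !ipZl !ipZr (ipC f g) rmorphN /= normCK; congr (_ <= _); ring.
set c := ip f g in key *; have [b0|bn0] := eqVneq (ip g g) 0; last first.
  have bp : 0 < ip g g by rewrite lt_def bn0 ip_ge0.
  have := key (c / ip g g); set b := ip g g in bp bn0 *.
  have br : b^* = b by apply/CrealP/gtr0_real.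
  rewrite rmorphM /= fmorphV /= br normCK rmorphM /= fmorphV /= br.
  have -> : ip f f - c^* / b * c - c / b * c^* + c / b * (c^* / b) * b = ip f f - (c * c^*) / b by field.
  by rewrite -normCK subr_ge0 ler_pdivrMr.
rewrite b0 mulr0; case: (eqVneq c 0) => [->|c0]; first by rewrite normr0 expr0n.
exfalso.
have a0 := ip_ge0 f.
have cp : 0 < `|c| ^+ 2 by rewrite exprn_gt0 // normr_gt0.
(* With <g,g> = 0 the form is affine in t, and this t sends it to -(<f,f> + 2), which is
   negative. *)
have := key ((ip f f + 1) / `|c| ^+ 2 * c); rewrite b0 mulr0 addr0 rmorphM /=.
have -> : ((ip f f + 1) / `|c| ^+ 2)^* = (ip f f + 1) / `|c| ^+ 2.
  by apply/CrealP; rewrite ger0_real // divr_ge0 ?ltW // ltr_wpDl.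
rewrite -!mulrA [c^* * c]mulrC -normCK mulVf ?gt_eqF // mulr1.
have -> : ip f f - (ip f f + 1) - (ip f f + 1) = - (ip f f + 2) by ring.
rewrite oppr_ge0 => h; have p : 0 < ip f f + 2 by rewrite ltr_wpDl // ltr0n.
by have := lt_le_trans p h; rewrite ltxx.
Qed.

Lemma ip_self_eq0 f g : ip f f = 0 -> ip f g = 0.
Proof.
move=> f0; have := ip_CauchySchwarz f g; rewrite f0 mul0r.
by rewrite real_exprn_even_le0 //= ?normr_eq0 ?normr_real // => /eqP.
Qed.

(** The moment matrix is therefore the Gram matrix of the monomials, its row index in the linear
    slot. *)
Lemma ip_monoE a b c d : ip (mono a b) (mono c d) =
  moment mu (c%:Z - a%:Z, d%:Z - b%:Z).
Proof.
apply: eq_cintegral => z; rewrite !pev_mono !opprB rmorphM !rmorphXn /=.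
have n1 := norm_circle_val z.1; have n2 := norm_circle_val z.2.
rewrite [(circle_val z.1)^*]circle_conj // [(circle_val z.2)^*]circle_conj //.
rewrite !expfzDr ?circle_neq0 // -!exprnP !exprVn -!exprnN; ring.
Qed.

End Form.

(** * Rows of the inverse moment matrices as polynomials dual to the monomials *)

Section Dual.
Context {R : realType}.
Local Notation C := R[i].
Local Notation X := (circle R * circle R)%type.
Local Notation pol2 := {poly {poly C}}.
Implicit Types (f g L D : pol2).

Definition bd (N M : nat) f := (size f <= M.+1)%N /\ forall l, (size (f`_l)%R <= N.+1)%N.

Lemma coef_monoM a b f l k :
  ((mono a b * f)`_l)`_k = if (a <= k)%N && (b <= l)%N then (f`_(l - b))`_(k - a) else 0.
Proof.
rewrite /mono -scalerAl coefZ coefXnM coefXnM.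
have [//|ak] := ltnP k a; case: ltnP => bl; rewrite ?coef0 //=.
Qed.

Lemma bd_coef N M f : (forall l k, ((M < l) || (N < k))%N -> (f`_l)`_k = 0) -> bd N M f.
Proof.
move=> h; split.
  by apply/leq_sizeP => l Ml; apply/polyP => k; rewrite coef0 h // Ml.
by move=> l; apply/leq_sizeP => k Nk; rewrite h // Nk orbT.
Qed.

Lemma coef_bd N M f l k : bd N M f -> ((M < l) || (N < k))%N -> (f`_l)`_k = 0.
Proof.
move=> [s1 s2] /orP[h|h]; last by rewrite nth_default // (leq_trans (s2 l)).
by rewrite (_ : f`_l = 0) ?coef0 // nth_default // (leq_trans s1).
Qed.

Lemma bdP N M f : bd N M f <-> (forall l k, ((M < l) || (N < k))%N -> (f`_l)`_k = 0).
Proof. by split=> [h l k|]; [exact: coef_bd|exact: bd_coef]. Qed.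

Lemma bd_mono N M k l : (k <= N)%N -> (l <= M)%N -> bd N M (mono k l).
Proof.
move=> kN lM; apply/bdP => b a; rewrite coef_mono.
by case: eqP => [->|_] //; case: eqP => [->|_] //; rewrite !ltnNge kN lM.
Qed.

Lemma bd_widen N M N' M' f : (N <= N')%N -> (M <= M')%N -> bd N M f -> bd N' M' f.
Proof.
move=> NN MM [s1 s2]; split; first by rewrite (leq_trans s1).
by move=> l; rewrite (leq_trans (s2 l)).
Qed.

Lemma bd_exists M f : (size f <= M.+1)%N -> exists N, bd N M f.
Proof.
move=> sf; exists (\max_(l < size f) size (f`_l)%R); split=> // l.
have [ls|ls] := ltnP l (size f); last by rewrite nth_default // size_poly0.
exact: (leq_trans (leq_bigmax (Ordinal ls)) (leqnSn _)).
Qed.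

Lemma bd_zdiv N M f : bd N.+1 M f -> (forall l, (f`_l)`_0 = 0) ->
  exists2 f' : pol2, f = mono 1 0 * f' & bd N M f'.
Proof.
move=> fb f0; pose f' : pol2 := \poly_(l < M.+1) (\poly_(k < N.+1) (f`_l)`_k.+1).
have c' l k : ((f'`_l)`_k) = (f`_l)`_k.+1.
  rewrite coef_poly; case: ltnP => lM; last by rewrite coef0 (coef_bd fb) ?lM.
  by rewrite coef_poly; case: ltnP => // kN; rewrite (coef_bd fb) // ltnS kN orbT.
exists f'; last by apply/bdP => l k h; rewrite c' (coef_bd fb).
apply/polyP => l; apply/polyP => k; rewrite coef_monoM subn0 andbT c'.
by case: k => [|k] /=; rewrite ?f0 // subn1.
Qed.

Variable (mu : {measure set X -> \bar R}).
Hypothesis mufin : (mu setT < +oo)%E.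
Local Notation ip := (ip mu).

Lemma ip_monor_wide N M f g : bd N M f ->
  ip g f = \sum_(l < M.+1) \sum_(k < N.+1) ((f`_l)`_k)^* * ip g (mono k l).
Proof.
move=> [s1 s2]; rewrite {1}(pol2_mono_wide s1 s2) ip_sumr //; apply: eq_bigr => l _.
by rewrite ip_sumr //; apply: eq_bigr => k _; rewrite ipZr.
Qed.

(* By [dual_moment_inv], the coefficients of such a [D] form the row of index (i, j)
   of the inverse moment matrix, without conjugation. *)
Definition is_dual (N M i j : nat) D := bd N M D /\
  forall k l, (k <= N)%N -> (l <= M)%N -> ip D (mono k l) = ((k == i) && (l == j))%:R.

Lemma is_dual_ip N M i j D f : (i <= N)%N -> (j <= M)%N -> is_dual N M i j D -> bd N M f ->
  ip D f = ((f`_j)`_i)^*.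
Proof.
rewrite -!(ltnS _ N) -!(ltnS _ M) => iN jM [_ Di] fb; rewrite (ip_monor_wide _ fb).
rewrite (bigD1 (Ordinal jM)) //= [X in _ + X]big1 ?addr0; last first.
  move=> l lj; rewrite big1 // => k _; rewrite Di ?leq_ord // (_ : (l == j :> nat) = false) ?andbF ?mulr0 //.
  by apply: contraNF lj => /eqP e; apply/eqP/val_inj.
rewrite (bigD1 (Ordinal iN)) //= [X in _ + X]big1 ?addr0; last first.
  move=> k ki; rewrite Di ?leq_ord // (_ : (k == i :> nat) = false) ?mulr0 //.
  by apply: contraNF ki => /eqP e; apply/eqP/val_inj.
by rewrite Di ?(ltnSE iN) ?(ltnSE jM) // !eqxx mulr1.
Qed.

Hypothesis Hdet : forall N M : nat, \det (moment_mx mu N M) != 0.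

Section Box.
Variables N M : nat.
Local Notation I := ('I_N.+1 * 'I_M.+1)%type.

Let monov (u : I) := @mono R u.1 u.2.
Let mk (x : 'rV[C]_#|{: I}|) : pol2 := \sum_a (x 0 a)%:P *: monov (enum_val a).

Let coef_mk x (u : I) : ((mk x)`_(u.2))`_(u.1) = x 0 (enum_rank u).
Proof.
rewrite /mk !coef_sum (bigD1 (enum_rank u)) //= [X in _ + X]big1 ?addr0.
  by rewrite coefZ coefCM coef_mono enum_rankK !eqxx mulr1.
move=> a au; rewrite coefZ coefCM coef_mono; case: andP => [[/eqP e1 /eqP e2]|_]; last by rewrite mulr0.
case/eqP: au; apply: enum_val_inj; rewrite enum_rankK; case: (enum_val a) e1 e2 => b c /= e1 e2.
by case: u e1 e2 => b' c' /= /val_inj -> /val_inj ->.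
Qed.

Let bd_mk x : bd N M (mk x).
Proof.
apply/bdP => l k h; rewrite /mk !coef_sum big1 // => a _.
rewrite coefZ coefCM coef_mono; case: andP => [[/eqP e1 /eqP e2]|_]; last by rewrite mulr0.
by move: h; rewrite e1 e2 !ltnNge !leq_ord.
Qed.

Let ip_mk x u : ip (mk x) (monov u) = (x *m moment_mx mu N M) 0 (enum_rank u).
Proof.
rewrite /mk ip_suml // mxE; apply: eq_bigr => a _.
by rewrite ipZl // ip_monoE !mxE enum_rankK.
Qed.

Let unitG : moment_mx mu N M \in unitmx.
Proof. by rewrite unitmxE unitfE. Qed.

Lemma bd_ip_eq0 f : bd N M f -> (forall k l, (k <= N)%N -> (l <= M)%N -> ip f (mono k l) = 0) -> f = 0.
Proof.
move=> fb f0; pose x : 'rV[C]_#|{: I}| := \row_(a < #|{: I}|) (f`_((enum_val a : I).2))`_((enum_val a : I).1).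
have fE : f = mk x.
  apply/polyP => l; apply/polyP => k.
  have [lM|lM] := ltnP l M.+1; last by rewrite (coef_bd fb) ?lM // (coef_bd (bd_mk x)) ?lM.
  have [kN|kN] := ltnP k N.+1; last by rewrite (coef_bd fb) ?kN ?orbT // (coef_bd (bd_mk x)) ?kN ?orbT.
  by rewrite (coef_mk x (Ordinal kN, Ordinal lM)) mxE enum_rankK.
have x0 : x *m moment_mx mu N M = 0.
  by apply/rowP => a; rewrite -(enum_valK a) -ip_mk -fE f0 ?leq_ord // mxE.
by rewrite fE /mk big1 // => a _; rewrite -(mulmxK unitG x) x0 mul0mx mxE scale0r.
Qed.

Lemma is_dual_uniq i j D D' : is_dual N M i j D -> is_dual N M i j D' -> D = D'.
Proof.
move=> [bD iD] [bD' iD']; apply/eqP; rewrite -subr_eq0; apply/eqP/bd_ip_eq0.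
  by apply/bdP => l k h; rewrite !coefB (coef_bd bD) // (coef_bd bD') // subrr.
by move=> k l kN lM; rewrite ipDl // ipNl // iD // iD' // subrr.
Qed.

Lemma dual_moment_inv (u : I) : exists2 D, is_dual N M u.1 u.2 D &
  forall v : I, (D`_(v.2))`_(v.1) = moment_inv mu N M u v.
Proof.
exists (mk (row (enum_rank u) (invmx (moment_mx mu N M)))); last first.
  by move=> v; rewrite coef_mk mxE.
split; first exact: bd_mk.
move=> k l; rewrite -ltnS -(ltnS l) => kN lM.
rewrite -[mono k l]/(monov (Ordinal kN, Ordinal lM)) ip_mk -row_mul mulVmx // !mxE.
by rewrite (inj_eq enum_rank_inj) eq_sym -pair_eqE /=.
Qed.

Lemma dual_exists i j : (i <= N)%N -> (j <= M)%N -> exists D, is_dual N M i j D.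
Proof.
rewrite -ltnS -(ltnS j) => iN jM.
by have [D DD _] := dual_moment_inv (Ordinal iN, Ordinal jM); exists D.
Qed.

(** Hermitian symmetry of the inverse matrix: both coefficients are read off the single product of D
    and D', computed from either slot. *)
Lemma is_dual_coefC i j D i' j' D' : (i <= N)%N -> (j <= M)%N -> (i' <= N)%N -> (j' <= M)%N ->
  is_dual N M i j D -> is_dual N M i' j' D' -> (D`_j')`_i' = ((D'`_j)`_i)^*.
Proof.
move=> iN jM iN' jM' DD DD'; rewrite -(is_dual_ip iN jM DD DD'.1).
by rewrite ipC // (is_dual_ip iN' jM' DD' DD.1) conjCK.
Qed.

End Box.

(** A null vector y of the Gram matrix gives f = sum y_l E_l with <f,f> = 0. By Cauchy-Schwarz f is
    orthogonal to e_l, and that product is y_l. This replaces the invertibility of corner blocks of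
    the inverse moment matrix. *)
Lemma gram_family_inj (I : finType) (E e : I -> pol2) (y : I -> C) :
  (forall l l', ip (E l) (e l') = (l == l')%:R) ->
  (forall k, \sum_l y l * ip (E l) (E k) = 0) -> forall l, y l = 0.
Proof.
move=> Ee yE l; pose f := \sum_l (y l)%:P *: E l.
have fE g : ip f g = \sum_l y l * ip (E l) g.
  by rewrite /f ip_suml //; apply: eq_bigr => i _; rewrite ipZl.
have ff : ip f f = 0.
  rewrite {2}/f ip_sumr // big1 // => k _; rewrite ipZr // fE yE mulr0 //.
have := ip_self_eq0 mufin (e l) ff; rewrite fE (bigD1 l) //= Ee eqxx mulr1.
by rewrite big1 ?addr0 // => k kl; rewrite Ee (negbTE kl) mulr0.
Qed.

End Dual.

(** * Stabilization of the rows in the z1-direction *)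

Section TwoSided.
Context {R : realType}.
Local Notation C := R[i].
Local Notation X := (circle R * circle R)%type.
Local Notation pol2 := {poly {poly C}}.
Implicit Types (f g L D : pol2).
Variable (mu : {measure set X -> \bar R}).
Hypothesis mufin : (mu setT < +oo)%E.
Local Notation ip := (ip mu).
Variable n : nat.

(* The z_1-degree of the monomials is not bounded: z_1^-n L_j is a row of the inverse
   of the matrix-valued symbol of mu. *)
Definition twosided M j L := bd (2 * n) M L /\
  forall t k l, (l <= M)%N -> ip (mono t 0 * L) (mono k l) = ((k == n + t)%N && (l == j))%:R.

Lemma twosided_ip M j L f t : (j <= M)%N -> twosided M j L -> (size f <= M.+1)%N ->
  ip (mono t 0 * L) f = ((f`_j)`_(n + t))^*.
Proof.
move=> jM [_ tL] sf; have [N0 fb0] := bd_exists sf.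
have fb : bd (maxn N0 (n + t)) M f by apply: bd_widen fb0; rewrite ?leq_maxl.
rewrite (ip_monor_wide mufin _ fb); rewrite -ltnS in jM.
have nt : (n + t < (maxn N0 (n + t)).+1)%N by rewrite ltnS leq_maxr.
rewrite (bigD1 (Ordinal jM)) //= [X in _ + X]big1 ?addr0; last first.
  move=> l lj; rewrite big1 // => k _; rewrite tL ?leq_ord // (_ : (l == j :> nat) = false) ?andbF ?mulr0 //.
  by apply: contraNF lj => /eqP e; apply/eqP/val_inj.
rewrite (bigD1 (Ordinal nt)) //= [X in _ + X]big1 ?addr0; last first.
  move=> k ki; rewrite tL ?(ltnSE jM) // (_ : (k == n + t :> nat)%N = false) ?mulr0 //.
  by apply: contraNF ki => /eqP e; apply/eqP/val_inj.
by rewrite tL ?(ltnSE jM) // !eqxx mulr1.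
Qed.

Hypothesis Hdet : forall N M : nat, \det (moment_mx mu N M) != 0.
Variable M : nat.
Hypothesis H2 : forall N : nat, (n <= N)%N ->
        forall j k : 'I_M.+1, moment_inv mu N.+1 M (ord0, j) (ord_max, k) = 0.

Lemma dual_first_bd N j D : (n <= N)%N -> (j <= M)%N -> is_dual mu N.+1 M 0 j D -> bd N M D.
Proof.
rewrite -ltnS => nN; rewrite -ltnS => jM DD; have [D' DD' cD] := dual_moment_inv mufin Hdet (@ord0 N.+1, Ordinal jM).
have /= e := is_dual_uniq mufin Hdet DD DD'; subst D'.
apply/bdP => l k h; have [lM|lM] := ltnP l M.+1; last by rewrite (coef_bd DD.1) // lM.
have [kN|kN] := ltnP N.+1 k; first by rewrite (coef_bd DD.1) // kN orbT.
have kE : k = N.+1 by move: h kN lM; rewrite !ltnS; lia.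
by have /= := cD (ord_max, Ordinal lM); rewrite H2 // kE.
Qed.

(** By (2) the first row of the box [0,N+1] has no coefficient at z1^(N+1), so it lies in [0,N] and
    uniqueness identifies it with the first row there. *)
Lemma dual_first_all j D : (j <= M)%N -> is_dual mu n M 0 j D ->
  forall N, (n <= N)%N -> is_dual mu N M 0 j D.
Proof.
move=> jM DD; elim=> [|N IH] nN; first by move: nN DD; rewrite leqn0 => /eqP ->.
move: nN; rewrite leq_eqVlt => /predU1P[<- //|nN].
have [D' DD'] := dual_exists mufin Hdet (leq0n N.+1) jM.
rewrite (_ : D = D') //.
apply: (is_dual_uniq mufin Hdet (IH nN)); split; first exact: dual_first_bd DD'.
by move=> k l kN lM; apply: DD'.2 => //; exact: leqW.
Qed.

(** Hermitian symmetry turns (2) into the absence of z1^0 in the last row of the larger box;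
    dividing by z1 gives the last row of the smaller one. *)
Lemma dual_last_shift N j D : (n <= N)%N -> (j <= M)%N -> is_dual mu N M N j D ->
  is_dual mu N.+1 M N.+1 j (mono 1 0 * D).
Proof.
move=> nN jM DD; have [D' DD'] := dual_exists mufin Hdet (leqnn N.+1) jM.
have c0 l : (D'`_l)`_0 = 0.
  have [lM|lM] := leqP l M; last by rewrite (coef_bd DD'.1) // lM.
  have [F FF] := dual_exists mufin Hdet (leq0n N.+1) lM.
  rewrite (is_dual_coefC mufin (leqnn _) jM (leq0n _) lM DD' FF).
  by rewrite (coef_bd (dual_first_bd nN lM FF)) ?rmorph0 // ltnSn orbT.
have [D'' DE bD''] := bd_zdiv DD'.1 c0.
suff -> : D = D'' by rewrite -DE.
apply: (is_dual_uniq mufin Hdet DD); split=> // k l kN lM.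
rewrite -(ip_shift _ 1 0) -DE monoM add1n add0n DD'.2 //.
Qed.

Lemma dual_last_all j D : (j <= M)%N -> is_dual mu n M n j D ->
  forall t, is_dual mu (n + t) M (n + t) j (mono t 0 * D).
Proof.
move=> jM DD; elim=> [|t IH].
  have m00 : mono 0 0 = 1 :> pol2 by rewrite /mono scale1r.
  by rewrite addn0 m00 mul1r.
rewrite addnS (_ : mono t.+1 0 = mono 1 0 * mono t 0); last by rewrite monoM add1n.
by rewrite -mulrA; apply: dual_last_shift => //; exact: leq_addr.
Qed.

(** Shifted to end at z1^a, the last rows G_k of [0,n] are dual to the monomials (a,k) in the box
    [0,a], hence orthogonal to L, which has no such monomial. Their powers of z1 run from a - n > n
    to a, and below a the products with L vanish by duality or induction. What remains is a
    homogeneous system in the products at z1^a, whose matrix is the Gram matrix of the G_k. *)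
Lemma dual_center_up j L : (j <= M)%N -> is_dual mu (2 * n) M n j L ->
  forall a l, (2 * n < a)%N -> (l <= M)%N -> ip L (mono a l) = 0.
Proof.
move=> jM LL; elim/ltn_ind => a IH l na; rewrite -ltnS => lM.
have [G GG] := choice (fun k : 'I_M.+1 => dual_exists mufin Hdet (leqnn n) (leq_ord k)).
have nn : (n <= a)%N by lia.
have tE : a = (n + (a - n))%N by lia.
have Gd k := dual_last_all (leq_ord k) (GG k) (a - n); rewrite -tE in Gd.
apply: (@gram_family_inj _ _ mufin _ G (fun l : 'I_M.+1 => mono n l) (fun l => ip L (mono a l)) _ _ (Ordinal lM)).
  by move=> k k'; rewrite (GG k).2 // ?leq_ord // eqxx /= eq_sym.
move=> k.
have z : ip L (mono (a - n) 0 * G k) = 0.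
  rewrite ipC // (is_dual_ip mufin (leqnn a) (leq_ord k) (Gd k)).
    by rewrite (coef_bd LL.1) ?rmorph0 ?na ?orbT.
  by apply: bd_widen LL.1 => //; exact: ltnW.
rewrite -[RHS]z; transitivity (\sum_(l < M.+1) \sum_(i < n.+1)
   ((((G k)`_l)`_i)^* * ip L (mono (a - n + i) l))).
  apply: eq_bigr => i _; rewrite big_ord_recr /= big1 ?add0r.
    rewrite subnK // mulrC; congr (_ * _).
    by rewrite (is_dual_ip mufin (leqnn n) (leq_ord i) (GG i) (GG k).1).
  move=> b _; have bn := ltn_ord b.
  have [h|h] := ltnP (2 * n) (a - n + b)%N.
    by rewrite IH ?mulr0 ?leq_ord //; lia.
  rewrite LL.2 ?leq_ord // (_ : (a - n + b == n)%N = false) ?mulr0 //; lia.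
have [s1 s2] := (GG k).1.
have -> : mono (a - n) 0 * G k =
    \sum_(l < M.+1) \sum_(i < n.+1) (((G k)`_l)`_i)%:P *: mono (a - n + i) l.
  rewrite {1}(pol2_mono_wide s1 s2) mulr_sumr; apply: eq_bigr => i _.
  by rewrite mulr_sumr; apply: eq_bigr => b _; rewrite -scalerAr monoM add0n.
rewrite ip_sumr //; apply: eq_bigr => i _; rewrite ip_sumr //; apply: eq_bigr => b _.
by rewrite ipZr.
Qed.

(** The mirror image, with the first rows F_k: they are dual to (0,k) in every larger box, so they
    are orthogonal to z1^t L, which has no z1^0. The powers z1^b with 0 < b <= n contribute nothing,
    by induction on t if b < t and by duality of L if b >= t, since then b - t < n. *)
Lemma dual_center_down j L : (j <= M)%N -> is_dual mu (2 * n) M n j L ->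
  forall t l, (0 < t)%N -> (l <= M)%N -> ip (mono t 0 * L) (mono 0 l) = 0.
Proof.
move=> jM LL; elim/ltn_ind => t IH l t0; rewrite -ltnS => lM.
have [F FF] := choice (fun k : 'I_M.+1 => dual_exists mufin Hdet (leq0n n) (leq_ord k)).
apply: (@gram_family_inj _ _ mufin _ F (fun l : 'I_M.+1 => mono 0 l) (fun l => ip (mono t 0 * L) (mono 0 l)) _ _ (Ordinal lM)).
  by move=> k k'; rewrite (FF k).2 // ?leq_ord // eqxx /= eq_sym.
move=> k.
have btL : bd (2 * n + t) M (mono t 0 * L).
  apply/bdP => a b h; rewrite coef_monoM; case: ifP => // /andP[h1 _].
  by rewrite (coef_bd LL.1) // subn0; lia.
have z : ip (mono t 0 * L) (F k) = 0.
  have Fd := @dual_first_all _ _ (leq_ord k) (FF k) (2 * n + t)%N ltac:(lia).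
  rewrite ipC // (is_dual_ip mufin (leq0n _) (leq_ord k) Fd btL) coef_monoM.
  by rewrite leqn0 eqn0Ngt t0 /= !rmorph0.
rewrite -[RHS]z (ip_monor_wide mufin _ (FF k).1).
apply: eq_bigr => i _; rewrite big_ord_recl /= big1 ?addr0.
  rewrite mulrC; congr (_ * _).
  by rewrite (is_dual_ip mufin (leq0n n) (leq_ord i) (FF i) (FF k).1).
move=> b _; rewrite /bump /= add1n; have bn := ltn_ord b.
have [h|h] := ltnP b.+1 t.
  have -> : ip (mono t 0 * L) (mono b.+1 i) = ip (mono (t - b.+1) 0 * L) (mono 0 i).
    rewrite -(ip_shift _ b.+1 0 _ (mono 0 i)) mulrA !monoM !addn0 add0n; congr (ip (mono _ _ * _) _); lia.
  by rewrite IH ?mulr0 ?leq_ord //; lia.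
have -> : ip (mono t 0 * L) (mono b.+1 i) = ip L (mono (b.+1 - t) i).
  rewrite -[RHS](ip_shift _ t 0) monoM add0n; congr (ip _ (mono _ _)); lia.
rewrite LL.2 ?leq_ord //; last by lia.
rewrite (_ : (b.+1 - t == n)%N = false) ?mulr0 //; lia.
Qed.

Lemma twosided_exists j : (j <= M)%N -> exists2 L, is_dual mu (2 * n) M n j L & twosided M j L.
Proof.
have n2 : (n <= 2 * n)%N by lia.
move=> jM; have [L LL] := dual_exists mufin Hdet n2 jM.
exists L => //; split; first exact: LL.1.
move=> t k l lM; have [tk|tk] := leqP t k.
  have -> : ip (mono t 0 * L) (mono k l) = ip L (mono (k - t) l).
    by rewrite -[RHS](ip_shift _ t 0) monoM add0n subnKC.
  have [h|h] := leqP (k - t)%N (2 * n)%N.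
    by rewrite LL.2 //; congr ((_ && _)%:R); lia.
  rewrite (dual_center_up jM LL) // (_ : (k == n + t)%N = false) //; lia.
have -> : ip (mono t 0 * L) (mono k l) = ip (mono (t - k) 0 * L) (mono 0 l).
  rewrite -(ip_shift _ k 0 _ (mono 0 l)) mulrA !monoM !addn0 add0n; congr (ip (mono _ _ * _) _); lia.
rewrite (dual_center_down jM LL) ?subn_gt0 // (_ : (k == n + t)%N = false) //; lia.
Qed.

End TwoSided.

(** * The rows L_j form a Hermitian, positive definite symbol on the circle *)

Section Positivity.
Context {R : realType}.
Local Notation C := R[i].
Local Notation X := (circle R * circle R)%type.
Local Notation pol2 := {poly {poly C}}.
Implicit Types (f g L D : pol2).
Variable (mu : {measure set X -> \bar R}).
Hypothesis mufin : (mu setT < +oo)%E.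
Local Notation ip := (ip mu).
Variables n M : nat.
Variable L : nat -> pol2.
Hypothesis HL : forall j, (j <= M)%N -> twosided mu n M j (L j).

Lemma monot t f : mono t 0 * f = 'X^t *: f.
Proof. by rewrite /mono -scalerAl mul1r. Qed.

Lemma ip_twosided2 j k s t : (j <= M)%N -> (k <= M)%N ->
  ip ('X^s *: L j) ('X^t *: L k) = if (t <= n + s)%N then (((L k)`_j)`_(n + s - t))^* else 0.
Proof.
move=> jM kM; have [bk _] := HL kM.
rewrite -!monot (twosided_ip mufin _ jM (HL jM)); last first.
  by rewrite monot (leq_trans (size_scale_leq _ _)) ?bk.1.
by rewrite coef_monoM subn0 andbT; case: ifP => // _; rewrite rmorph0.
Qed.

(** On the circle this says that the matrix z1^-n (L_j)_k is Hermitian: a product of shifts of L_j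
    and L_k is evaluated from either slot. *)
Lemma coef_rvE j k : (j <= M)%N -> (k <= M)%N -> (L k)`_j = rv (2 * n) ((L j)`_k).
Proof.
move=> jM kM; apply/polyP => i; rewrite coef_rv; case: leqP => i2n; last first.
  by rewrite (coef_bd (HL kM).1) // i2n orbT.
have := ip_twosided2 n (2 * n - i) jM kM; rewrite ipC // ip_twosided2 // leq_addr.
rewrite ifT; last by lia.
move/(congr1 Num.conj); rewrite !conjCK (_ : (n + (2 * n - i) - n = 2 * n - i)%N); last by lia.
by rewrite (_ : (n + n - (2 * n - i) = i)%N); [move=> <-|lia].
Qed.

Lemma linear_unbounded (a b : C) N0 : 0 < a -> (forall N, (N0 <= N)%N -> N%:R * a <= b) -> False.
Proof.
move=> a0 H; have aE : a = (complex.Re a)%:C%C by rewrite RRe_real // gtr0_real.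
have Ra : 0 < complex.Re a by rewrite -ltcR -aE.
have HR N : (N0 <= N)%N -> N%:R * complex.Re a <= complex.Re b.
  move=> /H; rewrite aE -[N%:R](rmorph_nat (real_complex R)) -rmorphM lecE /=.
  by case/andP.
have b0 : 0 <= complex.Re b by apply: le_trans (HR N0 (leqnn _)); rewrite mulr_ge0 // ltW.
have := archi_boundP (divr_ge0 b0 (ltW Ra)); set n0 := Num.bound _ => hn.
have := HR (maxn N0 n0) (leq_maxl _ _); rewrite leNgt => /negP; apply.
rewrite -ltr_pdivrMr // (lt_le_trans hn) // ler_nat leq_maxr //.
Qed.

Variable x : 'I_M.+1 -> C.
Hypothesis x0 : exists j, x j != 0.
Variable z0 : C.
Hypothesis z01 : `|z0| = 1.

(** The products of the z1-shifts of [Lx] are the coefficients of [tau], so z1^-n [tau] is the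
    symbol of [Lx]. The polynomial [e] is a biorthogonal partner: the products of shifts of [Lx] and
    [e] are those of an orthonormal family, times [X2]. *)
Let tau : {poly C} := \sum_j \sum_k (x j * (x k)^*) *: (L j)`_k.
Let Lx : pol2 := \sum_j (x j)%:P *: L j.
Let e : pol2 := \sum_(j < M.+1) (x j)%:P *: mono n j.
Let X2 := \sum_j `|x j| ^+ 2.

Let z00 : z0 != 0. Proof. exact: circle_neq0. Qed.

Let tau_coef i : tau`_i = \sum_j \sum_k x j * (x k)^* * ((L j)`_k)`_i.
Proof.
by rewrite coef_sum; apply: eq_bigr => j _; rewrite coef_sum; apply: eq_bigr => k _; rewrite coefZ.
Qed.

Let size_tau : (size tau <= (2 * n).+1)%N.
Proof.
apply/leq_sizeP => i i2; rewrite tau_coef big1 // => j _; rewrite big1 // => k _.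
by rewrite (coef_bd (HL (leq_ord j)).1) ?i2 ?orbT ?mulr0.
Qed.

Let tau_conj i : (i <= 2 * n)%N -> (tau`_i)^* = tau`_(2 * n - i).
Proof.
move=> i2; rewrite !tau_coef rmorph_sum [RHS]exchange_big /=; apply: eq_bigr => j _.
rewrite rmorph_sum; apply: eq_bigr => k _ /=.
rewrite (coef_rvE (leq_ord j) (leq_ord k)) coef_rv leq_subr subKn // !rmorphM /= conjCK.
by rewrite [_^* * _]mulrC.
Qed.

Let ip_Lx s t : ip ('X^s *: Lx) ('X^t *: Lx) =
  if (t <= n + s)%N && (s <= n + t)%N then tau`_(n + t - s) else 0.
Proof.
have -> : ip ('X^s *: Lx) ('X^t *: Lx) = \sum_j \sum_k x j * (x k)^* * ip ('X^s *: L j) ('X^t *: L k).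
  rewrite /Lx scaler_sumr ip_suml //; apply: eq_bigr => j _.
  rewrite scaler_sumr ip_sumr //; apply: eq_bigr => k _.
  rewrite !scalerA ![_ * _%:P]mulrC -!scalerA ipZl // ipZr //; ring.
case: ifP => [/andP[h1 h2]|h].
  rewrite tau_coef; apply: eq_bigr => j _; apply: eq_bigr => k _; congr (_ * _).
  rewrite ip_twosided2 ?leq_ord // h1 (coef_rvE (leq_ord j) (leq_ord k)) coef_rv.
  rewrite ifT; last by lia.
  by rewrite conjCK; congr (_`_ _); lia.
rewrite big1 // => j _; rewrite big1 // => k _; rewrite ip_twosided2 ?leq_ord //.
case: ifP => h1; last by rewrite mulr0.
rewrite (coef_bd (HL (leq_ord k)).1) ?rmorph0 ?mulr0 //; apply/orP; right.
by move: h; rewrite h1 /=; lia.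
Qed.

Let ip_Lxe s t : ip ('X^s *: Lx) ('X^t *: e) = (s == t)%:R * X2.
Proof.
rewrite /Lx /e scaler_sumr ip_suml // mulr_sumr; apply: eq_bigr => j _.
rewrite scaler_sumr ip_sumr // (bigD1 j) //= [X in _ + X]big1 ?addr0.
  rewrite !scalerA ![_ * _%:P]mulrC -!scalerA ipZl // ipZr // -(monot s (L j)) -(monot t (mono _ _)) monoM add0n.
  rewrite (HL (leq_ord j)).2 ?leq_ord // eqxx andbT addnC eqn_add2l eq_sym normCK; ring.
move=> k kj; rewrite !scalerA ![_ * _%:P]mulrC -!scalerA ipZl // ipZr // -(monot s (L j)) -(monot t (mono _ _)) monoM add0n.
rewrite (HL (leq_ord j)).2 ?leq_ord // (_ : (k == j :> nat) = false) ?andbF ?mulr0 //.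
by apply: contraNF kj => /eqP h; apply/eqP/val_inj.
Qed.

Let F N : {poly C} := (1 + z0^-1 *: 'X) ^+ N.

Let F_horner N z : (F N).[z] = (1 + z / z0) ^+ N.
Proof. by rewrite /F horner_exp !hornerE mulrC. Qed.

Let F_expand N : F N = \sum_(s < N.+1) ('C(N, s)%:R * z0^-1 ^+ s) *: 'X^s.
Proof.
rewrite /F exprDn; apply: eq_bigr => s _.
by rewrite expr1n mul1r exprZn -scaler_nat scalerA.
Qed.

(** On the circle conj(1 + z/z0) = (z0/z)(1 + z/z0), so |F|^(2N) is a shift of F^(2N), and the
    products below become sums weighted by the binomials C(2N,s). *)
Let F_circle N f g : ip (F N *: f) (F N *: g) = z0 ^+ N * ip (F N.*2 *: f) ('X^N *: g).
Proof.
transitivity (ip ((z0 ^+ N)%:P *: (F N.*2 *: f)) ('X^N *: g)); last by rewrite ipZl.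
apply: ip_eq => z; rewrite !pevZ !F_horner hornerC hornerXn.
have n1 := norm_circle_val z.1; set w := circle_val z.1 in n1 *.
have w0 := circle_neq0 n1.
rewrite !rmorphM !rmorphXn rmorphD rmorph1 rmorphM /= fmorphV /= [z0^*]circle_conj // [w^*]circle_conj // invrK.
rewrite -addnn exprD.
have -> : (1 + w^-1 * z0) ^+ N = z0 ^+ N * (w^-1 ^+ N * (1 + w / z0) ^+ N).
  by rewrite -!exprMn; congr (_ ^+ N); field; rewrite z00 w0.
ring.
Qed.

Let ip_F_sum N f g : ip (F N.*2 *: f) ('X^N *: g) =
  \sum_(s < N.*2.+1) 'C(N.*2, s)%:R * z0^-1 ^+ s * ip ('X^s *: f) ('X^N *: g).
Proof.
rewrite F_expand scaler_suml ip_suml //; apply: eq_bigr => s _.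
set c := _ * _ ^+ s; have -> : (c *: 'X^s) *: f = c%:P *: ('X^s *: f) by rewrite scalerA mul_polyC.
by rewrite ipZl.
Qed.

Let ip_Fe N : ip (F N *: Lx) (F N *: e) = 'C(N.*2, N)%:R * X2.
Proof.
rewrite F_circle ip_F_sum; have Nl : (N < N.*2.+1)%N by lia.
rewrite (bigD1 (Ordinal Nl)) //= [X in _ + X]big1 ?addr0.
  by rewrite ip_Lxe eqxx mul1r exprVn; field; rewrite expf_neq0.
move=> s sN; rewrite ip_Lxe (_ : (s == N :> nat) = false) ?mul0r ?mulr0 //.
by apply: contraNF sN => /eqP h; apply/eqP/val_inj.
Qed.

Let ip_FF N : (n <= N)%N -> ip (F N *: Lx) (F N *: Lx) =
  \sum_(i < (2 * n).+1) 'C(N.*2, N + n - i)%:R * (z0 ^+ i / z0 ^+ n) * tau`_i.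
Proof.
move=> nN; rewrite F_circle ip_F_sum mulr_sumr.
pose G (s : nat) := z0 ^+ N * ('C(N.*2, s)%:R * z0^-1 ^+ s * ip ('X^s *: Lx) ('X^N *: Lx)).
rewrite -(big_mkord xpredT G) (@big_cat_nat _ _ _ (N - n)) //=; last by lia.
rewrite big_nat_cond big1 ?add0r; last first.
  move=> s /andP[/andP[_ h] _]; rewrite /G ip_Lx ifF ?mulr0 //; lia.
rewrite (@big_cat_nat _ _ _ (N + n).+1) /=; [|lia|lia].
rewrite [X in _ + X]big_nat_cond [X in _ + X]big1 ?addr0; last first.
  move=> s /andP[/andP[h _] _]; rewrite /G ip_Lx ifF ?mulr0 //; lia.
rewrite -{1}[(N - n)%N]add0n big_addn (_ : ((N + n).+1 - (N - n) = (2 * n).+1)%N); last by lia.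
rewrite big_mkord (reindex_inj rev_ord_inj) /=; apply: eq_bigr => i _.
have iN := leq_ord i.
rewrite /G ip_Lx ifT; last by lia.
rewrite (_ : ((2 * n).+1 - i.+1 + (N - n) = N + n - i)%N); last by lia.
rewrite (_ : (n + N - (N + n - i) = i)%N); last by lia.
have -> : z0 ^+ i / z0 ^+ n = z0 ^+ N * z0^-1 ^+ (N + n - i).
  by rewrite exprVn; apply/eqP; rewrite eqr_div ?expf_neq0 // -!exprD; apply/eqP; congr (_ ^+ _); lia.
ring.
Qed.

Let ip_ee N : ip (F N *: e) (F N *: e) <= 4 ^+ N * ip e e.
Proof.
have <- : ip ((4 ^+ N)%:P *: e) e = 4 ^+ N * ip e e by rewrite ipZl.
apply: cintegral_le => //; try exact: bm_ip.
move=> z; rewrite !pevZ hornerC F_horner -[X in X <= _]normCK -[X in _ <= X]mulrA -[X in _ <= _ * X]normCK normrM exprMn.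
apply: ler_wpM2r; first by rewrite exprn_ge0.
rewrite normrX -exprM mulnC exprM lerXn2r ?nnegrE ?exprn_ge0 //.
rewrite (_ : 4 = 2 ^+ 2) ?lerXn2r ?nnegrE //; last by rewrite -natrX.
rewrite (le_trans (ler_normD _ _)) // normr1 normrM normfV z01 norm_circle_val invr1 mulr1.
by rewrite -[2]/(1 + 1).
Qed.

(* The kernel K at z0 is tested on F^N with F = 1 + z1 / z0, which concentrates at
   z0: K <= 0 would give N <F^N Lx, F^N Lx> = O('C(2N, N)), whereas Cauchy-Schwarz
   against F^N e gives 'C(2N, N)^2 = O(4^N <F^N Lx, F^N Lx>). *)
Lemma twosided_positive :
  0 < (\sum_j \sum_k (x j * (x k)^*) *: (L j)`_k).[z0] / z0 ^+ n.
Proof.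
rewrite -/tau; set K := _ / _.
have KE : K = \sum_(i < (2 * n).+1) (z0 ^+ i / z0 ^+ n) * tau`_i.
  rewrite /K (horner_coef_wide _ size_tau) mulr_suml; apply: eq_bigr => i _.
  by rewrite -[LHS]mulrA [LHS]mulrC.
have Kreal : K \is Num.real.
  apply/CrealP; rewrite KE rmorph_sum [RHS](reindex_inj rev_ord_inj) /=.
  apply: eq_bigr => i _; have i2 := leq_ord i.
  rewrite subSS !rmorphM /= tau_conj // fmorphV /= !rmorphXn /= circle_conj //; congr (_ * _).
  rewrite !exprVn invrK mulrC; apply/eqP; rewrite eqr_div ?expf_neq0 // -!exprD.
  by apply/eqP; congr (_ ^+ _); lia.
have X2p : 0 < X2.
  have [j xj] := x0; rewrite /X2 (bigD1 j) //= ltr_pwDl ?exprn_gt0 ?normr_gt0 //.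
  by apply: sumr_ge0 => k _; rewrite exprn_ge0.
rewrite real_ltNge ?real0 //; apply/negP => K0.
pose Dt := n%:R ^+ 2 * \sum_(i < (2 * n).+1) `|tau`_i|.
have Dt0 : 0 <= Dt by rewrite mulr_ge0 ?exprn_ge0 // sumr_ge0.
pose b0 N : C := 'C(N.*2, N)%:R.
have b0p N : 0 < b0 N by rewrite ltr0n bin_gt0; lia.
have FFle N : (n < N)%N -> N%:R * ip (F N *: Lx) (F N *: Lx) <= b0 N * Dt.
  move=> nN; have Np : 0 < N%:R :> C by rewrite ltr0n; lia.
  rewrite ip_FF; last exact: ltnW.
  (* [S] is the error of replacing every binomial by the central one. The form equals C(2N,N) K - S,
     so K <= 0 bounds it by |S|. *)
  pose S := \sum_(i < (2 * n).+1) (b0 N - 'C(N.*2, N + n - i)%:R) * (z0 ^+ i / z0 ^+ n) * tau`_i.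
  have -> : \sum_(i < (2 * n).+1) 'C(N.*2, N + n - i)%:R * (z0 ^+ i / z0 ^+ n) * tau`_i = b0 N * K - S.
    rewrite KE mulr_sumr /S -sumrB; apply: eq_bigr => i _; ring.
  have Sr : S \is Num.real.
    have -> : S = b0 N * K - ip (F N *: Lx) (F N *: Lx).
      rewrite ip_FF; last exact: ltnW.
      rewrite KE mulr_sumr -sumrB; apply: eq_bigr => i _; rewrite /b0; ring.
    by apply: rpredB; [apply: rpredM => //; exact: realn|exact/ger0_real/ip_ge0].
  have SN : `|S| * N%:R <= b0 N * Dt.
    rewrite /S; apply: le_trans (ler_wpM2r (ltW Np) (ler_norm_sum _ _ _)) _.
    rewrite mulr_suml /Dt mulrA mulr_sumr; apply: ler_sum => i _.
    rewrite !normrM normfV !normrX z01 !expr1n invr1 !mulr1 mulrAC; apply: ler_wpM2r => //.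
    (* The index N + n - i is within n of the centre, on either side; the symmetry of binomials
       folds it to the right. *)
    have [s [sn sE]] : exists s, (s <= n)%N /\ 'C(N.*2, N + n - i) = 'C(N.*2, N + s).
      have i2 := leq_ord i; have [ni|ni] := leqP i n.
        by exists (n - i)%N; split; [lia|congr 'C(_, _); lia].
      exists (i - n)%N; split; first by lia.
      by rewrite -bin_sub; [congr 'C(_, _); lia|lia].
    rewrite sE; have sN : (s <= N)%N by lia.
    have Ro := @central_binomial_shift R N s sN.
    rewrite ger0_norm ?subr_ge0 /b0 ?ler_nat ?central_binomial_max //.
    have NpR : 0 < N%:R :> R by rewrite ltr0n; lia.
    rewrite ler_pdivlMr // in Ro.
    have : (('C(N.*2, N)%:R - 'C(N.*2, N + s)%:R) * N%:R)%:C%C <= (s%:R ^+ 2 * 'C(N.*2, N)%:R)%:C%C :> C.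
      by rewrite lecR.
    rewrite !rmorphM rmorphB !rmorph_nat => /le_trans; apply.
    by rewrite -expr2 mulrC ler_wpM2l // -!natrX ler_nat leq_sqr.
  apply: le_trans SN; rewrite [X in _ <= X]mulrC ler_wpM2l ?(ltW Np) //.
  have h2 : - S <= `|S| by rewrite -[`|S|]normrN real_ler_norm ?realN.
  by apply: le_trans h2; rewrite gerDr mulr_ge0_le0 // ltW.
have CS N : (b0 N * X2) ^+ 2 <= ip (F N *: Lx) (F N *: Lx) * (4 ^+ N * ip e e).
  have := ip_CauchySchwarz mufin (F N *: Lx) (F N *: e); rewrite ip_Fe -/(b0 N).
  rewrite ger0_norm ?(mulr_ge0 (ltW (b0p N)) (ltW X2p)) // => /le_trans; apply.
  by rewrite ler_wpM2l // ip_ge0.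
have ee0 : 0 <= ip e e by exact: ip_ge0.
have b1 N : (n < N)%N -> N%:R * b0 N * X2 ^+ 2 <= Dt * ip e e * 4 ^+ N.
  move=> nN; rewrite -(ler_pM2l (b0p N)).
  have -> : b0 N * (N%:R * b0 N * X2 ^+ 2) = N%:R * (b0 N * X2) ^+ 2 by ring.
  apply: le_trans (ler_wpM2l (ler0n _ _) (CS N)) _; rewrite [X in X <= _]mulrA.
  have -> : b0 N * (Dt * ip e e * 4 ^+ N) = (b0 N * Dt) * (4 ^+ N * ip e e) by ring.
  apply: ler_wpM2r; last exact: FFle.
  by rewrite mulr_ge0 // exprn_ge0.
(* Squaring [b1] and inserting 16^N <= 4 N C(2N,N)^2 cancels all binomials and leaves a constant
   bound for N X2^4. *)
apply: (@linear_unbounded (X2 ^+ 4) (4 * (Dt * ip e e) ^+ 2) n.+1); first by rewrite exprn_gt0.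
move=> N nN; have N0 : (0 < N)%N by lia.
have Np : 0 < N%:R :> C by rewrite ltr0n.
have b2 : (N%:R * b0 N * X2 ^+ 2) ^+ 2 <= (Dt * ip e e * 4 ^+ N) ^+ 2.
  rewrite lerXn2r ?nnegrE ?b1 //.
    by apply: mulr_ge0; [apply: mulr_ge0; [exact: ltW|exact: ltW]|exact/exprn_ge0/ltW].
  by apply: mulr_ge0; [exact: mulr_ge0|exact: exprn_ge0].
have b3 : 16 ^+ N <= 4 * N%:R * b0 N ^+ 2 :> C.
  by rewrite /b0 -!natrX -!natrM ler_nat central_binomial_lower.
have pp : 0 < N%:R * b0 N ^+ 2 :> C by rewrite mulr_gt0 ?exprn_gt0.
rewrite -(ler_pM2l pp).
have -> : N%:R * b0 N ^+ 2 * (N%:R * X2 ^+ 4) = (N%:R * b0 N * X2 ^+ 2) ^+ 2 by ring.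
apply: le_trans b2 _.
have -> : (Dt * ip e e * 4 ^+ N) ^+ 2 = (Dt * ip e e) ^+ 2 * 16 ^+ N.
  by rewrite exprMn -exprM mulnC exprM -[4 ^+ 2]natrX.
have -> : N%:R * b0 N ^+ 2 * (4 * (Dt * ip e e) ^+ 2) = (Dt * ip e e) ^+ 2 * (4 * N%:R * b0 N ^+ 2) by ring.
by apply: ler_wpM2l b3; rewrite exprn_ge0 // mulr_ge0.
Qed.

End Positivity.

(** * Levinson recursions in z2, zeros of q, and the factorization q = B p *)

Section Recursions.
Context {R : realType}.
Local Notation C := R[i].
Local Notation X := (circle R * circle R)%type.
Local Notation pol2 := {poly {poly C}}.
Implicit Types (f g : pol2).
Variable (mu : {measure set X -> \bar R}).
Hypothesis mufin : (mu setT < +oo)%E.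
Local Notation ip := (ip mu).
Hypothesis Hdet : forall N M : nat, \det (moment_mx mu N M) != 0.

Lemma ip_self_inj f : ip f f = 0 -> f = 0.
Proof.
move=> f0; have [|N bf] := @bd_exists R (size f) f; first exact: leqnSn.
by apply: (bd_ip_eq0 mufin Hdet bf) => k l _ _; exact: ip_self_eq0.
Qed.

(** Pair f with its own monomial expansion: each term vanishes through its coefficient or through
    its product with f, so <f,f> = 0. *)
Lemma ip_mono_orth M f (P : pred nat) : (size f <= M.+1)%N ->
  (forall l, (l <= M)%N -> P l -> f`_l = 0) ->
  (forall k l, (l <= M)%N -> ~~ P l -> ip f (mono k l) = 0) -> f = 0.
Proof.
move=> sf fP f0; apply: ip_self_inj; have [N bf] := bd_exists sf.
rewrite (ip_monor_wide mufin _ bf) big1 // => l _; rewrite big1 // => k _.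
have [Pl|Pl] := boolP (P l); first by rewrite fP ?leq_ord // coef0 rmorph0 mul0r.
by rewrite f0 ?leq_ord // mulr0.
Qed.

Variables n m : nat.
Variable L : nat -> nat -> pol2.
Hypothesis HL : forall M j, (m <= M.+1)%N -> (j <= M)%N -> twosided mu n M j (L M j).
Let q := L m 0%N.
Hypothesis Hq : forall M, (m <= M)%N -> L M 0%N = q.

Lemma ip_scale_twosided M j (c : {poly C}) f : (m <= M.+1)%N -> (j <= M)%N -> (size f <= M.+1)%N ->
  ip (c *: L M j) f = \sum_(t < size c) c`_t * ((f`_j)`_(n + t))^*.
Proof.
move=> mM jM sf; rewrite -{1}[c]coefK poly_def scaler_suml ip_suml //.
apply: eq_bigr => t _; rewrite -mul_polyC -scalerA ipZl //; congr (_ * _).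
by rewrite -monot (twosided_ip mufin _ jM (HL mM jM)).
Qed.

Lemma ip_shiftY (f g : pol2) : ip ('X * f) ('X * g) = ip f g.
Proof.
rewrite -(ip_shift mu 0 1 f g) (_ : mono 0 1 = 'X) // /mono expr1 expr0 scale1r //.
Qed.

Lemma monoS k l : mono k l.+1 = 'X * mono k l :> pol2.
Proof. by rewrite /mono -scalerAr exprS. Qed.

Lemma sizeL M j : (m <= M.+1)%N -> (j <= M)%N -> (size (L M j) <= M.+1)%N.
Proof. by move=> mM jM; have [[]] := HL mM jM. Qed.

Lemma size_sub3 M (f g h : pol2) : (size f <= M)%N -> (size g <= M)%N -> (size h <= M)%N ->
  (size (f - g - h)%R <= M)%N.
Proof.
move=> sf sg sh; rewrite (leq_trans (size_polyD _ _)) // geq_max size_polyN sh andbT.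
by rewrite (leq_trans (size_polyD _ _)) // geq_max size_polyN sf sg.
Qed.

(** The difference of the two sides has no z2^0 coefficient, and it is orthogonal to z2^l for 1 <= l
    <= M + 1, where q contributes nothing and the shift invariance matches the other two terms. The
    factor q_0 in front avoids dividing by a polynomial in z1. *)
Lemma recursion_up M j : (m <= M.+1)%N -> (j <= M)%N ->
  q`_0 *: L M.+1 j.+1 = q`_0 *: ('X * L M j) + (L M.+1 j.+1)`_0 *: q.
Proof.
move=> mM jM; apply/eqP; rewrite -subr_eq0 opprD addrA; apply/eqP.
have mM2 : (m <= M.+2)%N by exact: leqW.
have qE := Hq mM.
have sq : (size q <= M.+2)%N by rewrite -qE sizeL.
have sX : (size ('X * L M j)%R <= M.+2)%N.
  rewrite mulrC; have [->|L0] := eqVneq (L M j) 0; first by rewrite mul0r size_poly0.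
  by rewrite size_mulX // ltnS sizeL.
apply: (@ip_mono_orth M.+1 _ (pred1 0%N)).
- by apply: size_sub3; rewrite (leq_trans (size_scale_leq _ _)) ?sizeL.
- move=> l _ /eqP ->; rewrite !coefB !coefZ coefXM /= mulr0 subr0 mulrC subrr //.
- move=> k [//|l] lM _; rewrite !ipDl // !ipNl // -qE.
  have sm : (size (mono k l.+1 : pol2) <= M.+2)%N by exact: (bd_mono (leqnn k) lM).1.
  have sm' : (size (mono k l : pol2) <= M.+1)%N by exact: (bd_mono (leqnn k) (lM : (l <= M)%N)).1.
  rewrite ip_scale_twosided // [X in _ - _ - X]ip_scale_twosided // monoS.
  rewrite scalerAr ip_shiftY ip_scale_twosided // [X in _ - X]big1 ?subr0 => [|t _]; last first.
    by rewrite coefXM coef0 rmorph0 mulr0.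
  by rewrite -sumrB big1 // => t _; rewrite coefXM /= subrr.
Qed.

(** The same argument at the other end: the difference has no z2^(M+1) coefficient and is orthogonal
    to all lower powers of z2. *)
Lemma recursion_down M j : (m <= M.+1)%N -> (j <= M)%N ->
  (L M.+1 M.+1)`_M.+1 *: L M.+1 j =
  (L M.+1 M.+1)`_M.+1 *: L M j + (L M.+1 j)`_M.+1 *: L M.+1 M.+1.
Proof.
move=> mM jM; apply/eqP; rewrite -subr_eq0 opprD addrA; apply/eqP.
have mM2 : (m <= M.+2)%N by exact: leqW.
have jM1 : (j <= M.+1)%N by exact: leqW.
apply: (@ip_mono_orth M.+1 _ (pred1 M.+1)).
- apply: size_sub3; rewrite (leq_trans (size_scale_leq _ _)) ?sizeL //.
  by rewrite (leq_trans (sizeL mM jM)).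
- move=> l _ /eqP ->; rewrite !coefB !coefZ [(L M j)`_M.+1]nth_default ?sizeL //.
  by rewrite mulr0 subr0 mulrC subrr.
- move=> k l lM /= lM1; rewrite !ipDl // !ipNl //.
  have lM' : (l <= M)%N by rewrite -ltnS ltn_neqAle lM1.
  have sm : (size (mono k l : pol2) <= M.+2)%N by exact: (bd_mono (leqnn k) lM).1.
  have sm' : (size (mono k l : pol2) <= M.+1)%N by exact: (bd_mono (leqnn k) lM').1.
  rewrite !ip_scale_twosided // [X in _ - X]big1 ?subr0 => [|t _]; last first.
    by rewrite coef_mono [M.+1 == l]eq_sym (negbTE lM1) andbF rmorph0 mulr0.
  by rewrite subrr.
Qed.

Local Notation ev f a z := ((f.[a%:P]).[z]).

Lemma evZ (c : {poly C}) f (a z : C) : ev (c *: f) a z = c.[z] * ev f a z.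
Proof. by rewrite hornerZ hornerM. Qed.

Lemma evXM f (a z : C) : ev ('X * f) a z = a * ev f a z.
Proof. by rewrite hornerM hornerX hornerM hornerC. Qed.

Lemma evD f g (a z : C) : ev (f + g) a z = ev f a z + ev g a z.
Proof. by rewrite !hornerD. Qed.

Lemma ev_sum M f (a z : C) : (size f <= M.+1)%N ->
  ev f a z = \sum_(k < M.+1) (f`_k).[z] * a ^+ k.
Proof.
move=> sf; rewrite (horner_coef_wide _ sf) horner_sum; apply: eq_bigr => k _.
by rewrite hornerM -rmorphXn hornerC.
Qed.

Lemma twosided_pos M (x : 'I_M.+1 -> C) (z0 : C) : (m <= M.+1)%N -> `|z0| = 1 ->
  (exists j, x j != 0) ->
  0 < (\sum_j \sum_k (x j * (x k)^*) *: (L M j)`_k).[z0] / z0 ^+ n.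
Proof. by move=> mM z1 x0; apply: (twosided_positive mufin (fun j jM => HL mM jM)). Qed.

Lemma diag_pos M (i : nat) (z0 : C) : (m <= M.+1)%N -> (i <= M)%N -> `|z0| = 1 ->
  0 < ((L M i)`_i).[z0] / z0 ^+ n.
Proof.
rewrite -(ltnS i) => mM iM z1; pose I := Ordinal iM.
have := @twosided_pos M (fun j => (j == I)%:R) z0 mM z1.
have -> : \sum_(j < M.+1) \sum_(k < M.+1) ((j == I)%:R * ((k == I)%:R : C)^*) *: (L M j)`_k = (L M i)`_i.
  rewrite (bigD1 I) //= [X in _ + X]big1 ?addr0 => [|j jI]; last first.
    by rewrite big1 // => k _; rewrite (negbTE jI) mul0r scale0r.
  rewrite (bigD1 I) //= [X in _ + X]big1 ?addr0 => [|j jI]; last first.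
    by rewrite (negbTE jI) rmorph0 mulr0 scale0r.
  by rewrite eqxx conjC1 mulr1 scale1r.
by apply; exists I; rewrite eqxx oner_neq0.
Qed.

(** The positive form is tested on the vector of powers of conj(a), which yields the
    Christoffel-Darboux kernel in z2 on the diagonal. *)
Lemma kernel_pos M (a z0 : C) : (m <= M.+1)%N -> `|z0| = 1 ->
  0 < (\sum_(j < M.+1) a^* ^+ j * ev (L M j) a z0) / z0 ^+ n.
Proof.
move=> mM z1; have := @twosided_pos M (fun j => a^* ^+ j) z0 mM z1.
rewrite horner_sum (eq_bigr (fun j : 'I_M.+1 => a^* ^+ j * ev (L M j) a z0)); last first.
  move=> j _; rewrite (ev_sum _ _ (sizeL mM (leq_ord j))) horner_sum mulr_sumr.
  by apply: eq_bigr => k _; rewrite hornerZ rmorphXn /= conjCK mulrAC mulrA.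
by apply; exists ord0; rewrite expr0 oner_neq0.
Qed.

Lemma rvL M j k : (m <= M.+1)%N -> (j <= M)%N -> (k <= M)%N ->
  (L M k)`_j = rv (2 * n) ((L M j)`_k).
Proof. by move=> mM jM kM; apply: (coef_rvE mufin (fun j jM => HL mM jM)). Qed.

Lemma size_coefL M j k : (m <= M.+1)%N -> (j <= M)%N -> (size ((L M j)`_k)%R <= (2 * n).+1)%N.
Proof. by move=> mM jM; have [[_]] := HL mM jM. Qed.

(* At a zero of q both recursions evaluate the kernel of size m + 2, and comparing
   them gives (|a|^2 - 1) K w0 = |la|^2 with K, w0 > 0. *)
Lemma center_neq0 (z0 a : C) : `|z0| = 1 -> `|a| <= 1 -> ev q a z0 != 0.
Proof.
move=> z1 a1; apply/eqP => qa0.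
have z00 := circle_neq0 z1.
have zn0 : z0 ^+ n != 0 by rewrite expf_neq0.
have mm := leqnSn m; have mm2 := leqW mm.
have h0 : (q`_0).[z0] != 0.
  have := diag_pos mm (leq0n m) z1; rewrite -/q.
  by apply: contraTneq => ->; rewrite mul0r ltxx.
pose K (w : C) := \sum_(j < m.+1) w ^+ j * ev (L m j) a z0.
pose K1 (w : C) := \sum_(j < m.+2) w ^+ j * ev (L m.+1 j) a z0.
(* As q vanishes at (z0, a), the correction term of [recursion_up] drops out. *)
have up j : (j <= m)%N -> ev (L m.+1 j.+1) a z0 = a * ev (L m j) a z0.
  move=> jm; have := congr1 (fun f : pol2 => ev f a z0) (recursion_up mm jm).
  by rewrite evD !evZ evXM qa0 mulr0 addr0 => /(mulfI h0).
have K1up w : K1 w = w * a * K w.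
  rewrite /K1 big_ord_recl (Hq (leqnSn m)) qa0 mulr0 add0r /K mulr_sumr.
  by apply: eq_bigr => j _; rewrite !lift0 up ?leq_ord // exprS; ring.
pose w0 := ((L m.+1 m.+1)`_m.+1).[z0].
have w0p : 0 < w0 / z0 ^+ n by apply: diag_pos.
have w00 : w0 != 0 by apply: contraTneq w0p => ->; rewrite mul0r ltxx.
pose la := ev (L m.+1 m.+1) a z0.
have down j : (j <= m)%N -> w0 * ev (L m.+1 j) a z0 =
    w0 * ev (L m j) a z0 + z0 ^+ (2 * n) * (((L m.+1 m.+1)`_j).[z0])^* * la.
  move=> jm; have := congr1 (fun f : pol2 => ev f a z0) (recursion_down mm jm).
  rewrite [in X in X -> _](@rvL m.+1 m.+1 j) //; last exact: leqW.
  by rewrite evD !evZ horner_rv_circle // size_coefL.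
have K1down w : w0 * K1 w = w0 * K w + z0 ^+ (2 * n) * (ev (L m.+1 m.+1) w^* z0)^* * la.
  rewrite (ev_sum _ _ (sizeL mm2 (leqnn _))) rmorph_sum /K1 [LHS]mulr_sumr [X in _ = _ + X * _]mulr_sumr [X in _ = _ + X]mulr_suml.
  rewrite [LHS]big_ord_recr [X in _ = _ + X]big_ord_recr /= addrA; congr (_ + _); last first.
    have e : w0 = z0 ^+ (2 * n) * w0^*.
      by rewrite -horner_rv_circle ?size_coefL // -rvL.
    by rewrite rmorphM rmorphXn /= conjCK -/w0 -/la {1}e; ring.
  rewrite /K mulr_sumr -big_split /=; apply: eq_bigr => j _.
  have := down j (leq_ord j); rewrite mulrCA => ->.
  by rewrite rmorphM rmorphXn /= conjCK; ring.
have Kp := kernel_pos a mm z1; rewrite -/(K a^*) in Kp.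
have key : (`|a| ^+ 2 - 1) * (K a^* / z0 ^+ n) * (w0 / z0 ^+ n) = `|la| ^+ 2.
  have := K1down a^*; rewrite K1up conjCK -/la => e.
  rewrite normCK [X in _ = X]normCK.
  have -> : (a * a^* - 1) * (K a^* / z0 ^+ n) * (w0 / z0 ^+ n) =
     (w0 * (a^* * a * K a^*) - w0 * K a^*) / (z0 ^+ n * z0 ^+ n) by field.
  by rewrite e mulnC exprM expr2; field.
have an : `|a| = 1.
  apply/eqP; rewrite eq_le a1 /=.
  have : 0 <= `|la| ^+ 2 by rewrite exprn_ge0.
  rewrite -key pmulr_lge0 // pmulr_lge0 // subr_ge0.
  by rewrite expr_ge1.
(* For |a| = 1 the key identity is no contradiction yet and only gives [la] = 0. Then the correction
   in [K1down] disappears as well, so (1 - a w) K(w) = 0 for all w, and K would be the zero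
   polynomial, against its positivity at conj(a). *)
have la0 : la = 0.
  by apply/eqP; rewrite -normr_eq0 -sqrf_eq0 -key an expr1n subrr !mul0r.
pose kp : {poly C} := \poly_(j < m.+1) ev (L m j) a z0.
have kpE w : kp.[w] = K w.
  by rewrite horner_poly; apply: eq_bigr => j _; rewrite mulrC.
have : (1 - a *: 'X) * kp = 0.
  apply: poly_circle_eq0 => w _; rewrite hornerM kpE !hornerE.
  have := K1down w; rewrite la0 mulr0 addr0 => /(mulfI w00); rewrite K1up => e.
  by rewrite mulrBl mul1r [a * w]mulrC e subrr.
move/eqP; rewrite mulf_eq0 => /orP[|/eqP kp0]; last first.
  by move: Kp; rewrite -kpE kp0 horner0 mul0r ltxx.
move/eqP/(congr1 (fun p : {poly C} => p`_0)).
rewrite coefB coef1 coefZ coefX mulr0 subr0 coef0 => /eqP.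
by rewrite oner_eq0.
Qed.

Lemma center_factor : exists (B : {poly C}) (p : pol2),
  [/\ q = B *: p, (size p <= m.+1)%N, forall k, (size (p`_k)%R <= n.+1)%N,
     forall z : C, `|z| = 1 -> (p`_0).[z] = z ^+ n * (B.[z])^* &
     forall z a : C, `|z| = 1 -> `|a| <= 1 -> ev p a z != 0].
Proof.
have mm := leqnSn m; have mm2 := leqW mm.
have q1 : L m.+1 0%N = q by exact: Hq.
have sq k : (size (q`_k)%R <= (2 * n).+1)%N by exact: size_coefL.
have rvq0 : rv (2 * n) q`_0 = q`_0 by rewrite -rvL.
have [|||B [P [QE sP P0]]] := @circle_factor_bounded C n m (fun k => q`_k) _ rvq0.
- by move=> k; exact: sq.
- by move=> z z1; exact: (diag_pos mm (leq0n m) z1).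
- move=> [[|j] jm] [[|k] km] /=.
  + by exists q`_0; rewrite ?rvq0.
  + by exists q`_k.+1; rewrite ?rvq0.
  + by exists (rv (2 * n) q`_j.+1); rewrite ?size_rv // mulrC.
  (* The quotient is read off the z2^(k+1) coefficient of [recursion_up], where the z2^0 coefficient
     of row j + 1 is the reversal of q_(j+1) by Hermitian symmetry. *)
  exists ((L m.+1 j.+1)`_k.+1 - (L m j)`_k).
    by rewrite (leq_trans (size_polyD _ _)) // geq_max size_polyN !size_coefL //; lia.
  have := congr1 (fun f : pol2 => f`_k.+1) (@recursion_up m j mm (ltnW (ltnSE jm))).
  rewrite (@rvL m.+1 0%N j.+1 mm2 (leq0n _) (ltnW jm : (j.+1 <= m.+1)%N)) q1 coefD !coefZ coefXM /= => e.
  by rewrite mulrBr e addrAC subrr add0r.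
pose p : pol2 := \poly_(k < m.+1) P (inord k).
have cp k : p`_k = if (k < m.+1)%N then P (inord k) else 0 by rewrite coef_poly.
have qBp : q = B *: p.
  apply/polyP => k; rewrite coefZ cp; case: ltnP => km.
    by rewrite -QE inordK.
  by rewrite mulr0 nth_default // (leq_trans (sizeL mm (leq0n m))).
exists B, p; split => //.
- exact: size_poly.
- by move=> k; rewrite cp; case: ifP; rewrite ?size_poly0.
- move=> z z1; rewrite cp /= (_ : inord 0 = ord0) ?P0 //.
  by apply/val_inj; rewrite /= inordK.
- move=> z a z1 a1; have := center_neq0 z1 a1; rewrite qBp.
  by rewrite hornerZ hornerM mulf_eq0 negb_or => /andP[].
Qed.

End Recursions.

(** * The moments of |p|^2 dmu *)

Section WeightedMoment.
Context {R : realType}.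
Local Notation C := R[i].
Local Notation X := (circle R * circle R)%type.
Local Notation pol2 := {poly {poly C}}.
Implicit Types (f g : pol2).
Variable (mu : {measure set X -> \bar R}).
Hypothesis mufin : (mu setT < +oo)%E.
Local Notation ip := (ip mu).

Lemma circle_val_neq0 (z : circle R) : circle_val z != 0.
Proof. exact/circle_neq0/norm_circle_val. Qed.

Lemma circle_valJ (z : circle R) : (circle_val z)^* = (circle_val z)^-1.
Proof. exact/circle_conj/norm_circle_val. Qed.

Definition zmono (u : int * int) (z : X) : C := circle_val z.1 ^ u.1 * circle_val z.2 ^ u.2.

Lemma zmonoD u v z : zmono (u + v) z = zmono u z * zmono v z.
Proof. rewrite /zmono /= !expfzDr ?circle_val_neq0 //; ring. Qed.

Lemma conj_expz (z : C) (s : int) : `|z| = 1 -> (z ^ s)^* = z ^ (- s).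
Proof.
move=> z1; case: s => s.
  by rewrite -exprnP rmorphXn /= circle_conj // -exprnN exprVn.
by rewrite NegzE opprK -exprnN fmorphV rmorphXn /= circle_conj // exprVn invrK.
Qed.

Lemma zmonoJ u z : (zmono u z)^* = zmono (- u) z.
Proof. by rewrite /zmono rmorphM /= !conj_expz ?norm_circle_val. Qed.

Lemma bm_circle_expz d (T : measurableType d) (h : T -> circle R) (s : int) :
  measurable_fun setT h -> bounded_measurable (fun t => circle_val (h t) ^ s).
Proof.
move=> mh; have bh := bounded_measurable_comp mh bounded_measurable_circle_val.
case: s => s; first exact: bounded_measurableX.
apply: bounded_measurable_ext (bounded_measurableX s.+1 (bounded_measurableJ bh)) => t /=.
by rewrite circle_valJ NegzE -exprnN exprVn.
Qed.

Lemma bm_zmono u : bounded_measurable (zmono u).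
Proof.
by apply: bounded_measurableM; apply: bm_circle_expz; [exact: measurable_fst|exact: measurable_snd].
Qed.

Lemma pev_monoE a b z : pev (mono a b) z = zmono (a%:Z, b%:Z) z.
Proof. by rewrite pev_mono. Qed.

Variables (n m : nat) (q p : pol2) (B : {poly C}).
Hypothesis Hq : forall t k l, ip (mono t 0 * q) (mono k l) = ((k == n + t)%N && (l == 0%N))%:R.
Hypothesis qE : q = B *: p.
Hypothesis sp : forall k, (size (p`_k)%R <= n.+1)%N.
Hypothesis p0E : forall z : C, `|z| = 1 -> (p`_0).[z] = z ^+ n * (B.[z])^*.
Hypothesis B0 : forall z : C, `|z| = 1 -> B.[z] != 0.

Definition weighted (u : int * int) : C := cintegral mu (fun z => pev p z * (pev p z)^* * zmono u z).

Lemma BE : B = rv n p`_0.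
Proof.
apply: poly_circle_eq => z z1; rewrite horner_rv_circle // p0E // rmorphM rmorphXn /= conjCK.
by rewrite circle_conj // mulrA -exprMn mulfV ?circle_neq0 // expr1n mul1r.
Qed.

Lemma ip_q f t : ip (mono t 0 * q) f = ((f`_0)`_(n + t))^*.
Proof.
have [N bf] := bd_exists (leqnSn (size f)).
have bf' : bd (maxn N (n + t)) (size f) f by apply: bd_widen bf; rewrite ?leq_maxl.
rewrite (ip_monor_wide mufin _ bf') big_ord_recl /= [X in _ + X]big1 ?addr0; last first.
  by move=> l _; rewrite big1 // => k _; rewrite Hq andbF mulr0.
have nt : (n + t < (maxn N (n + t)).+1)%N by rewrite ltnS leq_maxr.
rewrite (bigD1 (Ordinal nt)) //= [X in _ + X]big1 ?addr0; last first.
  move=> k ki; rewrite Hq (_ : (k == n + t :> nat)%N = false) ?mulr0 //.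
  by apply: contraNF ki => /eqP e; apply/eqP/val_inj.
by rewrite Hq !eqxx mulr1.
Qed.

Lemma weighted_ip a b c d : weighted (a%:Z - c%:Z, b%:Z - d%:Z) = ip (mono a b * p) (mono c d * p).
Proof.
apply: eq_cintegral => z; rewrite !pevM rmorphM /= !pev_monoE zmonoJ.
rewrite (_ : (a%:Z - c%:Z, b%:Z - d%:Z) = (a%:Z, b%:Z) + - (c%:Z, d%:Z)) //.
rewrite zmonoD; ring.
Qed.

Lemma weighted_bound u : `|weighted u| <= ip p p.
Proof.
have h (s : int) : exists a c : nat, s = a%:Z - c%:Z.
  by case: s => s; [exists s, 0%N; rewrite subr0|exists 0%N, s.+1; rewrite NegzE sub0r].
case: u => s t; have [a [c ->]] := h s; have [b [d ->]] := h t.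
rewrite weighted_ip.
have := ip_CauchySchwarz mufin (mono a b * p) (mono c d * p); rewrite !ip_shift -expr2.
by rewrite ler_pXn2r ?nnegrE ?ip_ge0.
Qed.

Lemma weightedJ u : (weighted u)^* = weighted (- u).
Proof.
rewrite /weighted -cintegralJ //; last first.
  by apply: bounded_measurableM; [exact: bm_ip|exact: bm_zmono].
by apply: eq_cintegral => z; rewrite rmorphM /= zmonoJ rmorphM /= conjCK; ring.
Qed.

(** Applying B to the shifts in z1 turns one factor p into q = B p, whose products with monomials
    are known. *)
Lemma weighted_sum s t : \sum_(i < size B) B`_i * weighted (s + i%:Z, t) =
  cintegral mu (fun z => pev q z * (pev p z)^* * zmono (s, t) z).
Proof.
transitivity (\sum_(i < size B) cintegral mu (fun z =>
    B`_i * (pev p z * (pev p z)^* * zmono (s + i%:Z, t) z))).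
  apply: eq_bigr => i _; rewrite cintegralZ //.
  by apply: bounded_measurableM; [exact: bm_ip|exact: bm_zmono].
rewrite -cintegral_sum //; last first.
  move=> i _; apply: bounded_measurableM; first exact: bounded_measurable_cst.
  by apply: bounded_measurableM; [exact: bm_ip|exact: bm_zmono].
apply: eq_cintegral => z; rewrite qE pevZ horner_coef !mulr_suml; apply: eq_bigr => i _.
rewrite (_ : (s + i%:Z, t) = (s, t) + (i%:Z, 0)); last first.
  by apply/eqP; rewrite /eq_op /= addr0 !eqxx.
have e : zmono (i%:Z, 0) z = circle_val z.1 ^+ i by rewrite /zmono /= mulr1.
by rewrite zmonoD e; ring.
Qed.

(* The differences from the moments of the torus measure form, in z_1, a bounded
   sequence annihilated by B, which has no zero on the circle. *)
Lemma weighted_lower s (j : nat) : weighted (s, - j%:Z) = ((s == 0) && (j == 0%N))%:R.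
Proof.
pose y (s : int) : C := weighted (s, - j%:Z) - ((s == 0) && (j == 0%N))%:R.
suff : y s = 0 by move/eqP; rewrite subr_eq0 => /eqP.
apply: (@shift_apply_inj _ B y (ip p p + 1)) => // {}s.
  rewrite (le_trans (ler_normB _ _)) // lerD ?weighted_bound //.
  by rewrite normr_nat lern1 leq_b1.
rewrite /shift_apply; under eq_bigr do rewrite mulrBr.
rewrite big_split /= sumrN weighted_sum.
have [a [c [sE ac]]] : exists a c : nat, s = a%:Z - c%:Z /\ (a == 0%N) || (c == 0%N).
  by case: s => s; [exists s, 0%N; rewrite subr0 orbT|exists 0%N, s.+1; rewrite NegzE sub0r].
have -> : cintegral mu (fun z => pev q z * (pev p z)^* * zmono (s, - j%:Z) z) =
    ip (mono a 0 * q) (mono c j * p).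
  apply: eq_cintegral => z; rewrite !pevM rmorphM /= !pev_monoE zmonoJ sE.
  rewrite (_ : (a%:Z - c%:Z, - j%:Z) = (a%:Z, 0) + - (c%:Z, j%:Z)); last first.
    by apply/eqP; rewrite /eq_op /= add0r !eqxx.
  rewrite zmonoD; ring.
(* Biorthogonality of q picks out one coefficient. For j = 0 and a = 0 it is the conjugate of p_0 at
   n - c, that is B_c; for a > 0 it lies beyond the degree n of p_0. *)
rewrite ip_q coef_monoM leqn0; case: (eqVneq j 0%N) => j0; last first.
  rewrite andbF rmorph0 big1 ?subrr // => i _; rewrite andbF mulr0 //.
rewrite j0 andbT.
have cB k : (if (k <= n)%N then ((p`_0)`_(n - k))^* else 0) = B`_k by rewrite BE coef_rv.
have -> : \sum_(i < size B) B`_i * ((s + i%:Z == 0) && true)%:R = if a == 0%N then B`_c else 0.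
  have [cs|cs] := ltnP c (size B).
    rewrite (bigD1 (Ordinal cs)) //= big1 ?addr0.
      rewrite sE subrK andbT; case: (eqVneq a 0%N) => [->|a0]; first by rewrite eqxx mulr1.
      by rewrite (_ : (a%:Z == 0) = false) ?mulr0 //; apply/negbTE.
    move=> i ic; rewrite (_ : (s + i%:Z == 0) = false) ?mulr0 //; apply/negbTE.
    apply: contra ic => /eqP e; apply/eqP/val_inj => /=; move: e ac; rewrite sE.
    by case: a {sE} => [|a]; [lia|move=> /= + /eqP c0; rewrite c0; lia].
  rewrite [B`_c]nth_default // if_same big1 // => i _.
  rewrite (_ : (s + i%:Z == 0) = false) ?mulr0 //; apply/negbTE/eqP => e.
  by have := ltn_ord i; move: e ac cs; rewrite sE; lia.
case: (eqVneq a 0%N) ac sE => [->|a0] /= ac sE.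
  rewrite addn0 -cB; case: ifP => _; first by rewrite subrr.
  by rewrite rmorph0 subrr.
rewrite (eqP ac) /= !subn0 nth_default ?rmorph0 ?subrr //.
by rewrite (leq_trans (sp 0)) // -addn1 leq_add2l lt0n.
Qed.

Lemma weighted_moment u : weighted u = (u == 0)%:R.
Proof.
case: u => s [t|t]; last first.
  by rewrite NegzE weighted_lower.
rewrite -[LHS]conjCK weightedJ (_ : - (s, t%:Z) = (- s, - t%:Z)) // weighted_lower.
by rewrite rmorph_nat oppr_eq0.
Qed.

End WeightedMoment.

(** * Measures with equal moments *)

Section StepPolynomials.
Context {R : realType}.

(* On [0, 1], this tends to 1 for x < 1/2 and to 0 for x >= 1/2. *)
Definition step_poly (N : nat) (x : R) : R := (1 - x ^+ N) ^+ (N * 2 ^ N).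

Lemma bernoulli_ge (h : R) (k : nat) : -1 <= h -> 1 + k%:R * h <= (1 + h) ^+ k.
Proof.
move=> h1; elim: k => [|k IH]; first by rewrite mul0r addr0 expr0.
rewrite exprS -natr1; apply: (@le_trans _ _ ((1 + h) * (1 + k%:R * h))).
  by have := mulr_ge0 (ler0n R k) (sqr_ge0 h); lra.
by apply: ler_wpM2l => //; lra.
Qed.

Lemma step_poly_itv N x : 0 <= x <= 1 -> 0 <= step_poly N x <= 1.
Proof.
move=> /andP[x0 x1]; have xN0 : 0 <= x ^+ N by exact: exprn_ge0.
have xN1 : x ^+ N <= 1 by exact: exprn_ile1.
rewrite /step_poly; apply/andP; split; first by apply: exprn_ge0; lra.
by apply: exprn_ile1; lra.
Qed.

Lemma nat_geometric_le (b : R) N : 0 <= b -> b <= 1 -> N%:R * (1 - b) * b ^+ N <= 1 - b ^+ N.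
Proof.
move=> b0 b1; elim: N => [|N IH]; first by rewrite !mul0r expr0 subrr.
rewrite -natr1 exprS; have bN0 : 0 <= b ^+ N by exact: exprn_ge0.
have bN1 : b ^+ N <= 1 by exact: exprn_ile1.
set y := b ^+ N in IH bN0 bN1 *; set x := N%:R in IH *.
have h1 : b * (x * (1 - b) * y) <= b * (1 - y) by exact: ler_wpM2l.
have h2 : 0 <= (1 - b) * (1 - b * y).
  by apply: mulr_ge0; rewrite subr_ge0 // mulr_ile1.
have -> : (x + 1) * (1 - b) * (b * y) = b * (x * (1 - b) * y) + (1 - b) * (b * y) by ring.
lra.
Qed.

(** Write a = b^2: one factor b^N absorbs N, the other tends to 0. *)
Lemma nat_geometric_cvg0 (a : R) : 0 <= a -> a < 1 -> N%:R * a ^+ N @[N --> \oo] --> (0 : R).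
Proof.
move=> a0 a1; pose b := Num.sqrt a.
have b0 : 0 <= b := sqrtr_ge0 _.
have b2 : b ^+ 2 = a by exact: sqr_sqrtr.
have b1 : b < 1 by rewrite -(@ltr_pXn2r _ 2) ?nnegrE // b2 expr1n.
have b10 : 0 < 1 - b by rewrite subr_gt0.
apply: (@squeeze_cvgr _ _ _ _ (fun=> 0) (fun N => b ^+ N / (1 - b))).
- near=> N; apply/andP; split; first by rewrite mulr_ge0 // exprn_ge0.
  rewrite -b2 -exprM mul2n -addnn exprD ler_pdivlMr //.
  have -> : N%:R * (b ^+ N * b ^+ N) * (1 - b) = b ^+ N * (N%:R * (1 - b) * b ^+ N) by ring.
  rewrite -[leRHS]mulr1; apply: ler_wpM2l; first exact: exprn_ge0.
  apply: (le_trans (nat_geometric_le _ b0 (ltW b1))).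
  by rewrite lerBlDr lerDl exprn_ge0.
- exact: cvg_cst.
- rewrite -[X in _ --> X](mul0r (1 - b)^-1); apply: cvgM; last exact: cvg_cst.
  by apply: cvg_expr; rewrite ger0_norm.
Unshelve. all: by end_near. Qed.

(** With exponent k = N 2^N one has k x^N = N (2x)^N. Below 1/2 Bernoulli's inequality gives at
    least 1 - N (2x)^N. From 1/2 on, (1 - y)(1 + y) <= 1 gives at most 1 / (1 + N (2x)^N) <= 1 / (N
    + 1); the extra factor N in the exponent covers x = 1/2. *)
Lemma step_poly_cvg (x : R) : 0 <= x <= 1 ->
  step_poly N x @[N --> \oo] --> ((x < 2^-1)%R%:R : R).
Proof.
move=> x01; have /andP[x0 x1] := x01.
have kE (N : nat) : (N * 2 ^ N)%:R * x ^+ N = N%:R * (2 * x) ^+ N :> R by rewrite natrM natrX exprMn mulrA.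
have xN0 (N : nat) : 0 <= x ^+ N by exact: exprn_ge0.
have xN1 (N : nat) : x ^+ N <= 1 by exact: exprn_ile1.
have [xl|xg] := ltP x 2^-1.
  apply: (@squeeze_cvgr _ _ _ _ (fun N => 1 - N%:R * (2 * x) ^+ N) (fun=> 1)).
  - near=> N; apply/andP; split; last first.
      by have /andP[] := step_poly_itv N x01.
    rewrite /step_poly -kE -mulrN; apply: bernoulli_ge; have := xN1 N; lra.
  - rewrite -[X in _ --> X]subr0; apply: cvgB; first exact: cvg_cst.
    apply: nat_geometric_cvg0; first by rewrite mulr_ge0.
    lra.
  - exact: cvg_cst.
apply: (@squeeze_cvgr _ _ _ _ (fun=> 0) (fun N => N.+1%:R^-1)).
- near=> N; apply/andP; split; first by have /andP[] := step_poly_itv N x01.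
  have big : N.+1%:R <= (1 + x ^+ N) ^+ (N * 2 ^ N).
    apply: le_trans (_ : 1 + (N * 2 ^ N)%:R * x ^+ N <= _); last first.
      by apply: bernoulli_ge; have := xN0 N; lra.
    rewrite kE -natr1 addrC lerD2l ler_peMr // exprn_ege1 //; lra.
  have Sp : 0 < N.+1%:R :> R by [].
  rewrite -[leRHS]mul1r ler_pdivlMr //.
  apply: le_trans (_ : step_poly N x * (1 + x ^+ N) ^+ (N * 2 ^ N) <= _).
    by apply: ler_wpM2l => //; have /andP[] := step_poly_itv N x01.
  rewrite /step_poly -exprMn; apply: exprn_ile1.
    by apply: mulr_ge0; have := xN0 N; have := xN1 N; lra.
  have := mulr_ge0 (xN0 N) (xN0 N); nra.
- exact: cvg_cst.
- exact: cvg_harmonic.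
Unshelve. all: by end_near. Qed.

End StepPolynomials.

(** * The algebra of trigonometric polynomials *)

Section TrigonometricPolynomials.
Context {R : realType}.
Local Notation C := R[i].
Local Notation X := (circle R * circle R)%type.
Implicit Types (h g : X -> C).

Definition trig h := exists s : seq (C * (int * int)), forall z, h z = \sum_(t <- s) t.1 * zmono t.2 z.

Lemma eq_trig h g : h =1 g -> trig h -> trig g.
Proof. by move=> hg [s hs]; exists s => z; rewrite -hg. Qed.

Lemma trig_scaled_zmono c u : trig (fun z => c * zmono u z).
Proof. by exists [:: (c, u)] => z; rewrite big_seq1. Qed.

Lemma zmono0 (z : X) : zmono 0 z = 1.
Proof. by rewrite /zmono !expr0z mulr1. Qed.

Lemma trig_cst c : trig (fun=> c).
Proof. by apply: eq_trig (trig_scaled_zmono c 0) => z; rewrite zmono0 mulr1. Qed.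

Lemma trigD h g : trig h -> trig g -> trig (fun z => h z + g z).
Proof. by move=> [s hs] [t gt]; exists (s ++ t) => z; rewrite big_cat hs gt. Qed.

Lemma trig_sum (I : Type) (r : seq I) (F : I -> X -> C) :
  (forall i, trig (F i)) -> trig (fun z => \sum_(i <- r) F i z).
Proof.
move=> FT; elim: r => [|i r IH].
  by apply: eq_trig (trig_cst 0) => z; rewrite big_nil.
by apply: eq_trig (trigD (FT i) IH) => z; rewrite big_cons.
Qed.

Lemma trigM h g : trig h -> trig g -> trig (fun z => h z * g z).
Proof.
move=> [s hs] [t gt].
apply: (@eq_trig (fun z => \sum_(i <- s) \sum_(j <- t) (i.1 * j.1) * zmono (i.2 + j.2) z)).
  move=> z; rewrite hs gt mulr_suml; apply: eq_bigr => i _.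
  by rewrite mulr_sumr; apply: eq_bigr => j _; rewrite zmonoD; ring.
by apply: trig_sum => i; apply: trig_sum => j; exact: trig_scaled_zmono.
Qed.

Lemma trigX h k : trig h -> trig (fun z => h z ^+ k).
Proof.
move=> hT; elim: k => [|k IH]; first exact: trig_cst.
by apply: eq_trig (trigM hT IH) => z; rewrite exprS.
Qed.

Lemma trigJ h : trig h -> trig (fun z => (h z)^*).
Proof.
move=> [s hs]; apply: (@eq_trig (fun z => \sum_(i <- s) (i.1)^* * zmono (- i.2) z)).
  by move=> z; rewrite hs rmorph_sum; apply: eq_bigr => i _; rewrite rmorphM /= zmonoJ.
by apply: trig_sum => i; exact: trig_scaled_zmono.
Qed.

Lemma trig_pev f : trig (pev f).
Proof.
apply: (@eq_trig (fun z => \sum_(l < size f) \sum_(k < size (f`_l)%R) (f`_l)`_k * zmono (k%:Z, l%:Z) z)).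
  move=> z; rewrite [in RHS](pol2_mono f) pev_sum; apply: eq_bigr => l _.
  by rewrite pev_sum; apply: eq_bigr => k _; rewrite pevZ hornerC pev_monoE.
by apply: trig_sum => l; apply: trig_sum => k; exact: trig_scaled_zmono.
Qed.

Lemma bm_trig h : trig h -> bounded_measurable h.
Proof.
move=> [s hs]; apply: (@bounded_measurable_ext _ _ _ (fun z => \sum_(t <- s) t.1 * zmono t.2 z)) => //.
apply: bounded_measurable_sum => i _; apply: bounded_measurableM; last exact: bm_zmono.
exact: bounded_measurable_cst.
Qed.

Lemma cintegral_trig_eq (mu nu : {measure set X -> \bar R}) :
    (mu setT < +oo)%E -> (nu setT < +oo)%E ->
    (forall u, cintegral mu (zmono u) = cintegral nu (zmono u)) ->
  forall h, trig h -> cintegral mu h = cintegral nu h.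
Proof.
move=> mf nf e h [s hs].
have bi i : bounded_measurable (fun z => i.1 * zmono i.2 z : C).
  by apply: bounded_measurableM; [exact: bounded_measurable_cst|exact: bm_zmono].
rewrite !(eq_cintegral _ hs) !cintegral_sum //; apply: eq_bigr => i _.
by rewrite !cintegralZ ?e //; exact: bm_zmono.
Qed.

End TrigonometricPolynomials.

Section MeasureDeterminedByMoments.
Context {R : realType}.
Local Notation C := R[i].
Local Notation X := (circle R * circle R)%type.
Local Notation normc := (@ComplexField.Normc.normc R).

(** Two finite measures with equal moments agree on such sets by dominated convergence. Being closed
    under intersection, they form a pi-system, so pointwise approximation of indicators is
    enough. *)
Definition trig_approximable (A : set X) := measurable A /\
  exists r : nat -> X -> R, [/\ forall n, trig (fun z => (r n z)%:C%C),
    forall n z, 0 <= r n z <= 1 & forall z, r n z @[n --> \oo] --> (\1_A z : R)].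

Lemma trig_approximableI A B : trig_approximable A -> trig_approximable B -> trig_approximable (A `&` B).
Proof.
move=> [mA [r [rT r01 rl]]] [mB [s [sT s01 sl]]]; split; first exact: measurableI.
exists (fun n z => r n z * s n z); split.
- by move=> n; apply: eq_trig (trigM (rT n) (sT n)) => z; rewrite rmorphM.
- move=> n z; have /andP[? ?] := r01 n z; have /andP[? ?] := s01 n z.
  by rewrite mulr_ge0 // mulr_ile1.
- by move=> z; rewrite indicI /=; apply: cvgM; [exact: rl|exact: sl].
Qed.

Lemma trig_approximableT : trig_approximable setT.
Proof.
split => //; exists (fun _ _ => 1); split.
- by move=> _; exact: trig_cst.
- by move=> _ _; rewrite ler01 lexx.
- by move=> z; rewrite indicT; exact: cvg_cst.
Qed.

(** A polynomial in a trigonometric polynomial is again one, so [step_poly] may be composed with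
    h. *)
Lemma trig_approximable_lt (h : X -> R) : trig (fun z => (h z)%:C%C) -> (forall z, 0 <= h z <= 1) ->
  trig_approximable [set z | h z < 2^-1].
Proof.
move=> hT h01; split.
  have [mh _ _] := bm_trig hT; rewrite /= in mh.
  have := mh measurableT `]-oo, 2^-1[%classic (measurable_itv _); rewrite setTI.
  by congr measurable; apply/seteqP; split=> z /=; rewrite in_itv.
exists (fun N z => step_poly N (h z)); split.
- move=> N; apply: (@eq_trig _ (fun z => (1 - (h z)%:C%C ^+ N) ^+ (N * 2 ^ N))).
    by move=> z; rewrite /step_poly rmorphXn rmorphB rmorph1 rmorphXn.
  apply: trigX; apply: trigD; first exact: trig_cst.
  by apply: eq_trig (trigM (trig_cst (-1)) (trigX N hT)) => z; rewrite mulN1r.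
- by move=> N z; exact: step_poly_itv.
- move=> z; rewrite indicE.
  have -> : (z \in [set z | h z < 2^-1]) = (h z < 2^-1) by apply/idP/idP; rewrite inE.
  exact: step_poly_cvg.
Qed.

(** The distance is squared because |z - w|^2 is a trigonometric polynomial; [rho] is thus a squared
    radius. *)
Definition disc (w : C) (rho : R) (z : circle R) : Prop := normc (circle_val z - w) ^+ 2 < rho.

Lemma disc_approximable (i : X -> circle R) (w : C) (rho : R) : 0 < rho ->
    trig (fun z => circle_val (i z)) ->
  trig_approximable [set z | disc w rho (i z)].
Proof.
move=> r0 iT; pose x z := normc (circle_val (i z) - w) ^+ 2.
pose K := (1 + normc w) ^+ 2.
have x0 z : 0 <= x z by exact: sqr_ge0.
have K0 : 0 <= K by exact: sqr_ge0.
have xK z : x z <= K.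
  have n0 (y : C) : 0 <= normc y by case: y => u v /=; rewrite sqrtr_ge0.
  rewrite /x /K lerXn2r ?nnegrE ?addr_ge0 //.
  rewrite -lecR rmorphD rmorph1; have := ler_normB (circle_val (i z)) w.
  by rewrite norm_circle_val.
(* An affine rescaling that maps [0, K] into [0, 1] and the threshold [rho] to 1/2. *)
pose h z := 2^-1 + (x z - rho) / (2 * (K + rho)).
have Kr : 0 < K + rho by rewrite ltr_wpDl.
have K2 : 0 < 2 * (K + rho) by rewrite mulr_gt0.
rewrite (_ : [set z | disc w rho (i z)] = [set z | h z < 2^-1]); last first.
  apply/seteqP; split=> z /=; rewrite /disc -/(x z) /h gtrDl pmulr_llt0 ?invr_gt0 ?subr_lt0 //.
apply: trig_approximable_lt.
  apply: (@eq_trig _ (fun z => (2^-1 - rho / (2 * (K + rho)))%:C%C + ((2 * (K + rho))^-1)%:C%C *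
      ((circle_val (i z) - w) * (circle_val (i z) - w)^*))).
    move=> z; rewrite -normCK -[`|_|]/((normc _)%:C%C) -rmorphXn -rmorphM -rmorphD /h -/(x z).
    by congr (_%:C%C); ring.
  apply: trigD; first exact: trig_cst.
  apply: trigM; first exact: trig_cst.
  have wT : trig (fun z => circle_val (i z) - w) by apply: trigD => //; exact: trig_cst.
  by apply: trigM => //; exact: trigJ.
move=> z; rewrite /h; have := x0 z; have := xK z => h1 h2.
have e1 : (x z - rho) / (2 * (K + rho)) <= 2^-1.
  by rewrite ler_pdivrMr // mulrA mulVf // mul1r; lra.
have e2 : - 2^-1 <= (x z - rho) / (2 * (K + rho)).
  by rewrite ler_pdivlMr // mulNr mulrA mulVf // mul1r; lra.
by apply/andP; split; lra.
Qed.

Lemma trig_circle_val1 : trig (fun z : X => circle_val z.1).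
Proof. by apply: eq_trig (trig_scaled_zmono 1 (1, 0)) => z; rewrite /zmono expr0z expr1z mulr1 mul1r. Qed.

Lemma trig_circle_val2 : trig (fun z : X => circle_val z.2).
Proof. by apply: eq_trig (trig_scaled_zmono 1 (0, 1)) => z; rewrite /zmono expr0z expr1z !mul1r. Qed.

Definition rat_disc (t : rat * rat * rat) : set (circle R) :=
  [set z | disc (ratr t.1.1 +i* ratr t.1.2)%C (ratr t.2) z].

(** The rational centre is within [rh] / 2 of the point in each coordinate, hence at distance below
    [rh], and 2 [rh] < [eps] keeps the disc inside U. Countability of these discs is what matters
    later. *)
Lemma open_rat_disc (U : set (circle R)) (z : circle R) :
    open (U : set (set_type (unit_circle R))) -> U z ->
  exists t : rat * rat * rat, [/\ 0 < t.2, rat_disc t z & rat_disc t `<=` U].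
Proof.
move=> oU Uz; have [V oV VU] := oU.
have Vz : V (circle_val z) by move: Uz; rewrite -VU.
have : nbhs (circle_val z : R[i]^o) V by exact: open_nbhs_nbhs.
move=> /nbhs_ballP[e e0 eV].
have [eps eps0 eE] : exists2 eps : R, 0 < eps & e = eps%:C%C.
  move: e0 => /=; rewrite ltcE => /andP[/eqP/= Ime Ree].
  by exists (complex.Re e) => //; rewrite [LHS]complexE Ime rmorph0 mulr0 addr0.
have [rh /andP[rh0 rhe]] : exists q : rat, 0 < (ratr q : R) < eps / 2.
  by have [|q] := @rat_in_itvoo R 0 (eps / 2); [rewrite divr_gt0|exists q].
have near (x : R) : exists q : rat, `|x - ratr q| < ratr rh / 2.
  have [|q] := @rat_in_itvoo R (x - ratr rh / 2) (x + ratr rh / 2); first by lra.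
  by rewrite in_itv /= => /andP[h1 h2]; exists q; rewrite ltr_norml; apply/andP; split; lra.
have [a ha] := near (complex.Re (circle_val z)).
have [b hb] := near (complex.Im (circle_val z)).
exists (a, b, rh ^+ 2); pose w : C := (ratr a +i* ratr b)%C.
have nE (y : C) : normc y ^+ 2 = complex.Re y ^+ 2 + complex.Im y ^+ 2.
  by case: y => u v /=; rewrite sqr_sqrtr // addr_ge0 ?sqr_ge0.
have n0 (y : C) : 0 <= normc y by case: y => u v /=; rewrite sqrtr_ge0.
have zw : normc (circle_val z - w) ^+ 2 < ratr rh ^+ 2.
  rewrite nE !raddfB /=; move: ha hb; rewrite !ltr_norml => /andP[? ?] /andP[? ?]; nra.
split; first by rewrite /= exprn_gt0 // -(ltr0q R).
  by rewrite /rat_disc /disc /= rmorphXn.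
move=> y; rewrite /rat_disc /disc /= rmorphXn /= => yw.
rewrite -VU /=; apply: eV; rewrite /ball /= eE.
have rhp : 0 <= ratr rh :> R by exact: ltW.
have l1 : normc (circle_val z - w) < ratr rh by rewrite -(@ltr_pXn2r _ 2) ?nnegrE.
have l2 : normc (w - circle_val y) < ratr rh.
  by rewrite -normcN opprB -(@ltr_pXn2r _ 2) ?nnegrE.
rewrite -[`|_|]/((normc (circle_val z - circle_val y))%:C%C) ltcR.
have -> : circle_val z - circle_val y = (circle_val z - w) + (w - circle_val y) by ring.
apply: le_lt_trans (le_normcD _ _) _; lra.
Qed.

Section Unique.
Variables (mu nu : {measure set X -> \bar R}).
Hypotheses (mufin : (mu setT < +oo)%E) (nufin : (nu setT < +oo)%E).
Hypothesis Heq : forall u, cintegral mu (zmono u) = cintegral nu (zmono u).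

Let cintegral_indic (la : {measure set X -> \bar R}) A : measurable A ->
  complex.Re (cintegral la (fun z => (\1_A z)%:C%C)) = fine (la A).
Proof. by move=> mA; rewrite /cintegral /= /Rintegral integral_indic // setIT. Qed.

Lemma measure_eq_approximable A : trig_approximable A -> mu A = nu A.
Proof.
move=> [mA [r [rT r01 rl]]].
have lim (la : {measure set X -> \bar R}) : (la setT < +oo)%E ->
    complex.Re (cintegral la (fun z => (r n z)%:C%C)) @[n --> \oo] --> fine (la A).
  move=> lafin; rewrite -cintegral_indic //.
  apply: (cvg_cintegral lafin (B := 1) _ _ _).1.
  - by move=> n; exact: bm_trig.
  - move=> n z; have /andP[h0 h1] := r01 n z.
    by rewrite ger0_norm ?lecR // ler0c.
  - by move=> z; split; [exact: rl|exact: cvg_cst].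
have e : fine (mu A) = fine (nu A).
  have := lim nu nufin; under eq_fun do rewrite -(cintegral_trig_eq mufin nufin Heq (rT _)).
  by move/(cvg_unique _ (lim mu mufin)); exact.
have fin (la : {measure set X -> \bar R}) : (la setT < +oo)%E -> la A \is a fin_num.
  move=> lafin; rewrite ge0_fin_numE //; apply: le_lt_trans lafin.
  by apply: le_measure; rewrite ?inE.
by rewrite -(fineK (fin mu mufin)) -(fineK (fin nu nufin)) e.
Qed.

(** Dynkin's uniqueness theorem on the pi-system of approximable sets; it remains to see that this
    system generates the product sigma-algebra. *)
Lemma measure_eq_moments A : measurable A -> mu A = nu A.
Proof.
pose G : set (set X) := trig_approximable.
have eqG E : <<s G >> E -> mu E = nu E.
  apply: (@g_sigma_algebra_measure_unique _ _ _ G _ (fun=> setT)) => //.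
  - by move=> B [].
  - by move=> _; exact: trig_approximableT.
  - by rewrite bigcup_const.
  - by move=> B1 B2; exact: trig_approximableI.
  - exact: measure_eq_approximable.
have [G0 _ bigcupG] := smallest_sigma_algebra setT G.
pose O : set (set X) := [set U `*` V | U in (@open (set_type (unit_circle R))) & V in (@open (set_type (unit_circle R)))].
have OG : O `<=` <<s G >>.
  move=> _ [U oU [V oV <-]].
  pose D (t : (rat * rat * rat) * (rat * rat * rat)) : set X :=
    [set z | rat_disc t.1 z.1 /\ rat_disc t.2 z.2].
  (* An enumeration of the products of rational discs contained in U x V; codes of nothing, and data
     with a nonpositive radius, give the empty set. *)
  pose F (k : nat) : set X := if (unpickle k : option ((rat * rat * rat) * (rat * rat * rat))) is Some t then
    (if `[< 0 < t.1.2 /\ 0 < t.2.2 /\ D t `<=` U `*` V >] then D t else set0) else set0.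
  have -> : U `*` V = \bigcup_k F k.
    apply/seteqP; split => [z [Uz Vz]|z [k _]].
      have [t [t0 tz tU]] := open_rat_disc oU Uz.
      have [t' [t0' tz' tV]] := open_rat_disc oV Vz.
      have [N NE] : exists N, unpickle N = Some (t, t') by exists (pickle (t, t')); exact: pickleK.
      exists N; first by [].
      rewrite /F NE asboolT //=; split; first exact: t0.
      by split; [exact: t0'|move=> y [/tU ? /tV ?]].
    by rewrite /F; case: unpickle => // t; case: asboolP => // -[_ [_ tUV]] /tUV.
  apply: bigcupG => k; rewrite /F; case: unpickle => [t|//].
  case: asboolP => [[t10 [t20 _]]|//].
  apply: sub_gen_smallest; apply: trig_approximableI.
    by apply: (disc_approximable (i := fst)); [rewrite ltr0q|exact: trig_circle_val1].
  by apply: (disc_approximable (i := snd)); [rewrite ltr0q|exact: trig_circle_val2].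
(* For the sigma-algebra generated by G both projections are measurable, so it contains the product
   sigma-algebra. *)
pose Y := g_sigma_algebraType G.
have mfst : measurable_fun setT (fst : Y -> circle R).
  apply: (@measurability _ _ Y (circle R) setT _ (@open (set_type (unit_circle R)))) => // _ [U oU <-].
  rewrite setTI; apply: OG; exists U => //; exists setT; first exact: openT.
  by apply/seteqP; split=> z //= [].
have msnd : measurable_fun setT (snd : Y -> circle R).
  apply: (@measurability _ _ Y (circle R) setT _ (@open (set_type (unit_circle R)))) => // _ [U oU <-].
  rewrite setTI; apply: OG; exists setT; first exact: openT.
  by exists U => //; apply/seteqP; split=> z //= [].
rewrite measurable_prod_measurableType => mA; apply: eqG; apply: smallest_sub mA.
  exact: smallest_sigma_algebra.
move=> _ [A1 mA1 [A2 mA2 <-]].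
have := measurableI _ _ (mfst measurableT _ mA1) (msnd measurableT _ mA2).
by rewrite !setTI; congr (<<s G >> _); apply/seteqP; split=> z.
Qed.

End Unique.
End MeasureDeterminedByMoments.

(** * Lower bounds for zero-free polynomials, and the moments of the torus measure *)

Section Torus.
Context {R : realType}.
Local Notation C := R[i].
Local Notation X := (circle R * circle R)%type.
Local Notation pol2 := {poly {poly C}}.
Local Notation Re := complex.Re.
Local Notation Im := complex.Im.
Local Notation normc := (@ComplexField.Normc.normc R).
Implicit Types (f : pol2).

Definition ccontinuous (T : topologicalType) (g : T -> C) :=
  continuous (fun t => Re (g t)) /\ continuous (fun t => Im (g t)).

Lemma ccontinuous_cst (T : topologicalType) (c : C) : ccontinuous (fun _ : T => c).
Proof. by split=> t; exact: cvg_cst. Qed.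

Lemma ccontinuousD (T : topologicalType) (g h : T -> C) :
  ccontinuous g -> ccontinuous h -> ccontinuous (fun t => g t + h t).
Proof.
move=> [gR gI] [hR hI]; split => t.
  rewrite (_ : (fun t => _) = (fun t => Re (g t) + Re (h t))); last by apply/funext => x; rewrite raddfD.
  by apply: cvgD; [exact: gR|exact: hR].
rewrite (_ : (fun t => _) = (fun t => Im (g t) + Im (h t))); last by apply/funext => x; rewrite raddfD.
by apply: cvgD; [exact: gI|exact: hI].
Qed.

Lemma ccontinuousM (T : topologicalType) (g h : T -> C) :
  ccontinuous g -> ccontinuous h -> ccontinuous (fun t => g t * h t).
Proof.
move=> [gR gI] [hR hI]; split => t.
  rewrite (_ : (fun t => _) = (fun t => Re (g t) * Re (h t) - Im (g t) * Im (h t))).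
    by apply: cvgB; apply: cvgM; [exact: gR|exact: hR|exact: gI|exact: hI].
  by apply/funext => x; rewrite ReMc.
rewrite (_ : (fun t => _) = (fun t => Re (g t) * Im (h t) + Im (g t) * Re (h t))).
  by apply: cvgD; apply: cvgM; [exact: gR|exact: hI|exact: gI|exact: hR].
by apply/funext => x; rewrite ImMc.
Qed.

Lemma ccontinuous_sum (T : topologicalType) I (r : seq I) (F : I -> T -> C) :
  (forall i, ccontinuous (F i)) -> ccontinuous (fun t => \sum_(i <- r) F i t).
Proof.
move=> FC; elim: r => [|i r IH].
  by under eq_fun do rewrite big_nil; exact: ccontinuous_cst.
by under eq_fun do rewrite big_cons; exact: ccontinuousD.
Qed.

Lemma ccontinuousX (T : topologicalType) (g : T -> C) k :
  ccontinuous g -> ccontinuous (fun t => g t ^+ k).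
Proof.
move=> gC; elim: k => [|k IH]; first exact: ccontinuous_cst.
by under eq_fun do rewrite exprS; exact: ccontinuousM.
Qed.

Lemma circle_cis_surj (z : circle R) : exists2 t : R, -pi <= t <= pi & z = circle_cis t.
Proof.
case: z => -[x y] z1.
have xy : x ^+ 2 + y ^+ 2 = 1.
  have := set_mem z1; rewrite /unit_circle /= normc_def /= => /(congr1 (@complex.Re R)) /= /(congr1 (fun u => u ^+ 2)).
  by rewrite sqr_sqrtr ?expr1n // addr_ge0 ?sqr_ge0.
have x1 : -1 <= x <= 1 by rewrite -ler_norml -(@ler_pXn2r _ 2) ?nnegrE // expr1n real_normK ?num_real // -xy lerDl sqr_ge0.
have cx : cos (acos x) = x by rewrite acosK // in_itv.
have sx : sin (acos x) = `|y|.
  by rewrite sin_acos // (_ : 1 - x ^+ 2 = y ^+ 2) ?sqrtr_sqr // -xy addrC addKr.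
have a0 := acos_ge0 x1; have api := acos_lepi x1; have p0 := pi_ge0 R.
have [y0|y0] := leP 0 y.
  exists (acos x); first lra.
  by apply: val_inj => /=; rewrite cx sx ger0_norm.
exists (- acos x); first lra.
by apply: val_inj => /=; rewrite cosN sinN cx sx ltr0_norm // opprK.
Qed.

Lemma sqr_normc (x : C) : normc x ^+ 2 = Re x ^+ 2 + Im x ^+ 2.
Proof. by case: x => a b /=; rewrite sqr_sqrtr // addr_ge0 ?sqr_ge0. Qed.

(** The torus is parametrized by the compact square of angles [-pi, pi]^2, where a continuous
    function attains its minimum. *)
Lemma pev_lower_bound f : (forall z, pev f z != 0) ->
  exists2 e : R, 0 < e & forall z, e <= normc (pev f z) ^+ 2.
Proof.
move=> f0.
pose z (t : R * R) : X := (circle_cis t.1, circle_cis t.2).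
have zc (h : R * R -> R) : continuous h -> ccontinuous (fun t => circle_val (circle_cis (h t)) : C).
  move=> hc; split=> t /=; apply: continuous_comp; [exact: hc|exact: continuous_cos|exact: hc|exact: continuous_sin].
have fc : ccontinuous (fun t => pev f (z t)).
  have -> : (fun t => pev f (z t)) = (fun t => \sum_(l < size f) \sum_(k < size f`_l)
     f`_l`_k * (circle_val (z t).1 ^+ k * circle_val (z t).2 ^+ l)).
    apply/funext => t; rewrite [in LHS](pol2_mono f).
    rewrite pev_sum; apply: eq_bigr => l _; rewrite pev_sum; apply: eq_bigr => k _.
    by rewrite pevZ hornerC pev_mono.
  apply: ccontinuous_sum => l; apply: ccontinuous_sum => k.
  apply: ccontinuousM; first exact: ccontinuous_cst.
  apply: ccontinuousM; apply: ccontinuousX; apply: zc => t; [exact: cvg_fst|exact: cvg_snd].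
pose g t := normc (pev f (z t)) ^+ 2.
have gc : continuous g.
  have [fR fI] := fc.
  have -> : g = (fun t => Re (pev f (z t)) * Re (pev f (z t)) + Im (pev f (z t)) * Im (pev f (z t))).
    by apply/funext => t; rewrite /g sqr_normc.
  by move=> t; apply: cvgD; apply: cvgM; (exact: fR || exact: fI).
have p0 := pi_ge0 R.
have [| |t0 _ mint] := @compact_EVT_min (R * R)%type R g (`[-pi, pi] `*` `[-pi, pi])%classic _ _ (continuous_subspaceT gc).
- by exists (0, 0); split; rewrite /= in_itv /=; lra.
- by apply: compact_setX; exact: segment_compact.
exists (g t0).
  by rewrite exprn_gt0 // -ltcR -[(normc _)%:C%C]/`|pev f (z t0)| normr_gt0.
move=> [z1 z2]; have [t1 t1p ->] := circle_cis_surj z1; have [t2 t2p ->] := circle_cis_surj z2.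
apply: (mint (t1, t2)); apply/mem_set; split; rewrite /= in_itv //.
Qed.

Lemma circle_expz_moment (s : int) :
  cintegral (circle_measure R) (fun z => circle_val z ^ s) = (s == 0)%:R.
Proof.
case: s => s.
  case: s => [|s]; last exact: circle_moment.
  rewrite /cintegral /= !Rintegral_cst // mul0r mul1r.
  by rewrite [X in fine X]probability_setT.
rewrite NegzE (@eq_cintegral _ _ _ _ _ (fun z => (circle_val z ^+ s.+1)^*)); last first.
  by move=> z; rewrite -exprnN rmorphXn /= circle_valJ exprVn.
rewrite cintegralJ ?circle_measure_fin //; last exact/bounded_measurableX/bounded_measurable_circle_val.
by rewrite circle_moment // rmorph0.
Qed.

Lemma torus_moment u : cintegral (torus_measure R) (zmono u) = (u == 0)%:R.
Proof.
rewrite cintegral_torus; last exact: bm_zmono.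
rewrite (@eq_cintegral _ _ _ _ _ (fun x => (u.2 == 0)%:R * circle_val x ^ u.1)); last first.
  move=> x; rewrite /zmono /= cintegralZ ?circle_measure_fin ?circle_expz_moment 1?mulrC //.
  exact: bm_circle_expz.
rewrite cintegralZ ?circle_measure_fin ?circle_expz_moment //; last exact: bm_circle_expz.
by rewrite -natrM mulnb andbC.
Qed.

End Torus.

(** * The density |p|^-2 *)

Section InverseDensity.
Context {R : realType}.
Local Notation C := R[i].
Local Notation X := (circle R * circle R)%type.
Local Notation pol2 := {poly {poly C}}.
Local Notation Re := complex.Re.
Local Notation Im := complex.Im.
Local Notation normc := (@ComplexField.Normc.normc R).
Local Notation sigma := (torus_measure R).

Section Weight.
Variables (a : X -> R) (e : R).
Hypotheses (aT : trig (fun z => (a z)%:C%C)) (e0 : 0 < e) (ae : forall z, e <= a z).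

Let a_gt0 z : 0 < a z. Proof. exact: lt_le_trans (ae z). Qed.

(** Partial sums of the geometric series of 1/a in powers of 1 - a/K, with K above the range of a.
    The two bounds, on r_N and on r_N a = 1 - (1 - a/K)^N, are the dominating constants for sigma
    and for mu. *)
Lemma trig_approx_inv : exists r : nat -> X -> R, [/\ forall N, trig (fun z => (r N z)%:C%C),
  forall N z, 0 <= r N z <= e^-1, forall N z, 0 <= r N z * a z <= 1 &
  forall z, r N z @[N --> \oo] --> (a z)^-1].
Proof.
have [_ _ [K0 aK0]] := bm_trig aT.
pose K := K0 + 1.
have aK z : a z < K.
  by have [/= h _] := aK0 z; rewrite ltr_pwDr // (le_trans (ler_norm _)).
pose x z := 1 - a z / K.
have K_gt0 (z : X) : 0 < K by apply: (@lt_trans _ _ (a z)); [exact: a_gt0|exact: aK].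
have K_neq0 (z : X) : K != 0 by rewrite gt_eqF ?(K_gt0 z).
have x01 z : 0 <= x z < 1.
  by rewrite /x subr_ge0 ler_pdivrMr ?(K_gt0 z) // mul1r ltW //= ltrBlDr ltrDl divr_gt0 ?(K_gt0 z).
have rE N z : K^-1 * (\sum_(k < N) x z ^+ k) = (1 - x z ^+ N) / a z.
  have a0 : a z != 0 by rewrite gt_eqF.
  have := subrXX 1 (x z) N; rewrite expr1n.
  under eq_bigr do rewrite expr1n mul1r.
  have -> : 1 - x z = a z / K by rewrite /x; ring.
  by move=> ->; field; rewrite a0 K_neq0.
have xN N z : 0 <= x z ^+ N <= 1.
  by have /andP[h0 h1] := x01 z; rewrite exprn_ge0 ?exprn_ile1 // ltW.
exists (fun N z => K^-1 * (\sum_(k < N) x z ^+ k)); split.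
- move=> N; apply: (@eq_trig _ (fun z => (K^-1)%:C%C * \sum_(k < N) (1 + (- K^-1)%:C%C * (a z)%:C%C) ^+ k)).
    move=> z; rewrite rmorphM rmorph_sum; congr (_ * _); apply: eq_bigr => k _.
    by rewrite rmorphXn -rmorphM -[1](rmorph1 (real_complex R)) -rmorphD; congr ((_)%:C%C ^+ _); rewrite /x mulrC mulrN.
  apply: trigM; first exact: trig_cst.
  apply: trig_sum => k; apply: trigX; apply: trigD; first exact: trig_cst.
  by apply: trigM => //; exact: trig_cst.
- move=> N z; have /andP[h0 h1] := xN N z; rewrite rE divr_ge0 ?subr_ge0 //=; last exact: ltW.
  apply: (@le_trans _ _ (a z)^-1); last by rewrite lef_pV2 // posrE.
  by rewrite ler_piMl ?invr_ge0 ?(ltW (a_gt0 z)) // lerBlDr lerDl.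
- move=> N z; have /andP[h0 h1] := xN N z; rewrite rE divfK ?gt_eqF //.
  by rewrite subr_ge0 h1 lerBlDr lerDl.
- move=> z; under eq_fun do rewrite rE.
  suff : (1 - x z ^+ N) / a z @[N --> \oo] --> (1 - 0) / a z by rewrite subr0 mul1r.
  apply: cvgM; last exact: cvg_cst.
  apply: cvgB; first exact: cvg_cst.
  by apply: cvg_expr; have /andP[h0 h1] := x01 z; rewrite ger0_norm.
Qed.

Lemma measurable_inv_weight : measurable_fun setT (fun z => (a z)^-1).
Proof.
have [r [rT _ _ rl]] := trig_approx_inv.
apply: (@measurable_fun_cvg _ _ _ _ r); first by move=> N; have [] := bm_trig (rT N).
by move=> z _; exact: rl.
Qed.

Lemma inv_weight_ge0 z : 0 <= (a z)^-1.
Proof. by rewrite invr_ge0 ltW. Qed.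

Lemma inv_weight_le z : (a z)^-1 <= e^-1.
Proof. by rewrite lef_pV2 // posrE. Qed.

Lemma bm_inv_weight : bounded_measurable (fun z => ((a z)^-1)%:C%C).
Proof.
split; [exact: measurable_inv_weight|exact: measurable_cst|].
exists e^-1 => z /=; rewrite normr0 invr_ge0 (ltW e0); split => //.
by rewrite ger0_norm ?inv_weight_ge0 // inv_weight_le.
Qed.

Definition inv_weighted (A : set X) : \bar R := (\int[sigma]_(z in A) ((a z)^-1)%:E)%E.

Let inv_weighted0 : inv_weighted set0 = 0%E.
Proof. by rewrite /inv_weighted integral_set0. Qed.

Let inv_weighted_ge0 A : (0 <= inv_weighted A)%E.
Proof. by apply: integral_ge0 => z _; rewrite lee_fin inv_weight_ge0. Qed.

Let inv_weighted_sigma_additive : semi_sigma_additive inv_weighted.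
Proof.
apply: (@semi_sigma_additive_nng_induced _ _ _ sigma (fun z => ((a z)^-1)%:E)).
  by apply/measurable_EFinP; exact: measurable_inv_weight.
by move=> z; rewrite lee_fin inv_weight_ge0.
Qed.

HB.instance Definition _ := isMeasure.Build _ _ _ inv_weighted
  inv_weighted0 inv_weighted_ge0 inv_weighted_sigma_additive.

Definition inv_weighted_measure : {measure set X -> \bar R} := inv_weighted.

Lemma inv_weighted_fin : (inv_weighted_measure setT < +oo)%E.
Proof.
have := bounded_integrable torus_measure_fin measurable_inv_weight (B := e^-1) _.
move=> /(_ _)/integrable_fin_num.
rewrite ltey_eq => -> //.
by move=> z; rewrite ger0_norm ?inv_weight_ge0 // inv_weight_le.
Qed.

Section Moments.
Variable (mu : {measure set X -> \bar R}).
Hypothesis mufin : (mu setT < +oo)%E.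
Hypothesis muW : forall u, cintegral mu (fun z => (a z)%:C%C * zmono u z) = (u == 0)%:R.

Let bm_weighted h : trig h -> bounded_measurable (fun z => (a z)%:C%C * h z).
Proof. by move=> hT; apply: bm_trig; apply: trigM. Qed.

Lemma cintegral_weighted_trig h : trig h -> cintegral mu (fun z => (a z)%:C%C * h z) = cintegral sigma h.
Proof.
move=> [s hs].
rewrite (eq_cintegral _ hs) (eq_cintegral _ (g := fun z => \sum_(t <- s) t.1 * ((a z)%:C%C * zmono t.2 z))); last first.
  by move=> z; rewrite hs mulr_sumr; apply: eq_bigr => t _; ring.
have bz t : bounded_measurable (fun z => (a z)%:C%C * zmono t z).
  by apply: bm_weighted; apply: eq_trig (trig_scaled_zmono 1 t) => z; rewrite mul1r.
rewrite !cintegral_sum ?torus_measure_fin //; last 2 first.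
- by move=> t _; apply: bounded_measurableM; [exact: bounded_measurable_cst|exact: bm_zmono].
- by move=> t _; apply: bounded_measurableM; [exact: bounded_measurable_cst|].
apply: eq_bigr => t _; rewrite !cintegralZ ?torus_measure_fin ?muW ?torus_moment //.
exact: bm_zmono.
Qed.

(** The function r_N z^u is a trigonometric polynomial, so its integrals against a dmu and against
    dsigma agree; as N grows, r_N a tends to 1 on the left and r_N to 1/a on the right. *)
Lemma moment_inv_weight u :
  cintegral mu (zmono u) = cintegral sigma (fun z => zmono u z * ((a z)^-1)%:C%C).
Proof.
have [r [rT r0 ra rl]] := trig_approx_inv.
have zT : trig (zmono u : X -> C) by apply: eq_trig (trig_scaled_zmono 1 u) => z; rewrite mul1r.
have rzT N : trig (fun z => (r N z)%:C%C * zmono u z) by apply: trigM.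
have nz z : `|zmono u z| = 1 :> C.
  by apply/eqP; rewrite -sqrp_eq1 // normCK zmonoJ -zmonoD subrr zmono0.
have ReZ (t : R) (c : C) : Re (t%:C%C * c) = t * Re c by rewrite ReMc /= mul0r subr0.
have ImZ (t : R) (c : C) : Im (t%:C%C * c) = t * Im c by rewrite ImMc /= mul0r addr0.
have [muR muI] : (Re (cintegral mu (fun z => (r N z * a z)%:C%C * zmono u z)) @[N --> \oo] --> Re (cintegral mu (zmono u))) /\
    (Im (cintegral mu (fun z => (r N z * a z)%:C%C * zmono u z)) @[N --> \oo] --> Im (cintegral mu (zmono u))).
  apply: (cvg_cintegral mufin (B := 1)).
  - move=> N; apply: bm_trig; apply: eq_trig (trigM (rT N) (trigM aT zT)) => z.
    by rewrite rmorphM mulrA.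
  - move=> N z; have /andP[h0 h1] := ra N z.
    by rewrite normrM nz mulr1 ger0_norm ?lecR // ler0c.
  - have a1 z : r N z * a z @[N --> \oo] --> (1 : R).
      rewrite -(@mulVf _ (a z)) ?gt_eqF //; apply: cvgM; [exact: rl|exact: cvg_cst].
    move=> z; split.
      under eq_fun do rewrite ReZ.
      suff : (r N z * a z) * Re (zmono u z) @[N --> \oo] --> 1 * Re (zmono u z) by rewrite mul1r.
      by apply: cvgM; [exact: a1|exact: cvg_cst].
    under eq_fun do rewrite ImZ.
    suff : (r N z * a z) * Im (zmono u z) @[N --> \oo] --> 1 * Im (zmono u z) by rewrite mul1r.
    by apply: cvgM; [exact: a1|exact: cvg_cst].
have [sR sI] : (Re (cintegral sigma (fun z => (r N z)%:C%C * zmono u z)) @[N --> \oo] -->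
      Re (cintegral sigma (fun z => zmono u z * ((a z)^-1)%:C%C))) /\
    (Im (cintegral sigma (fun z => (r N z)%:C%C * zmono u z)) @[N --> \oo] -->
      Im (cintegral sigma (fun z => zmono u z * ((a z)^-1)%:C%C))).
  apply: (cvg_cintegral torus_measure_fin (B := e^-1)).
  - by move=> N; apply: bm_trig.
  - move=> N z; have /andP[h0 h1] := r0 N z.
    by rewrite normrM nz mulr1 ger0_norm ?lecR // ler0c.
  - move=> z; rewrite mulrC; split.
      under eq_fun do rewrite ReZ; rewrite ReZ.
      by apply: cvgM; [exact: rl|exact: cvg_cst].
    under eq_fun do rewrite ImZ; rewrite ImZ.
    by apply: cvgM; [exact: rl|exact: cvg_cst].
have key N : cintegral mu (fun z => (r N z * a z)%:C%C * zmono u z) =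
    cintegral sigma (fun z => (r N z)%:C%C * zmono u z).
  rewrite -cintegral_weighted_trig //; apply: eq_cintegral => z.
  by rewrite rmorphM /=; ring.
apply/eqP; rewrite eq_complex; apply/andP; split; apply/eqP.
by move: sR; under eq_fun do rewrite -key; move/(cvg_unique _ muR); exact.
by move: sI; under eq_fun do rewrite -key; move/(cvg_unique _ muI); exact.
Qed.

Lemma measure_eq_inv_weighted A : measurable A -> mu A = inv_weighted A.
Proof.
move=> mA; apply: (measure_eq_moments mufin inv_weighted_fin) => // u.
rewrite moment_inv_weight; symmetry.
apply: (cintegral_density measurable_inv_weight inv_weight_ge0 _ inv_weighted_fin torus_measure_fin inv_weight_le) => //.
exact: bm_zmono.
Qed.

End Moments.
End Weight.
End InverseDensity.

Section PolynomialDensity.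
Context {R : realType}.
Local Notation C := R[i].
Local Notation X := (circle R * circle R)%type.
Local Notation pol2 := {poly {poly C}}.
Local Notation normc := (@ComplexField.Normc.normc R).
Local Notation sigma := (torus_measure R).

Lemma normc_sqr_mulC (x : C) : (normc x ^+ 2)%:C%C = x * x^*.
Proof. by rewrite -normCK rmorphXn. Qed.

Lemma trig_normc_sqr (f : pol2) : trig (fun z => (normc (pev f z) ^+ 2)%:C%C).
Proof.
apply: eq_trig (trigM (trig_pev f) (trigJ (trig_pev f))) => z.
by rewrite normc_sqr_mulC.
Qed.

Lemma measure_eq_weighted_moments (mu : {measure set X -> \bar R}) (p : pol2) :
    (mu setT < +oo)%E -> (forall z, pev p z != 0) ->
    (forall u, weighted mu p u = (u == 0)%:R) ->
  forall A, measurable A -> mu A = (\int[sigma]_(z in A) (normc (pev p z) ^- 2)%:E)%E.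
Proof.
move=> mufin p0 wE A mA; have [e e0 pe] := pev_lower_bound p0.
apply: (measure_eq_inv_weighted (trig_normc_sqr p) e0 pe mufin _ mA) => u.
by rewrite -wE; apply: eq_cintegral => z; rewrite normc_sqr_mulC.
Qed.

End PolynomialDensity.

(** * From the three conditions to the density *)

Section Sufficiency.
Context {R : realType}.
Local Notation C := R[i].
Local Notation X := (circle R * circle R)%type.
Local Notation pol2 := {poly {poly C}}.
Local Notation normc := (@ComplexField.Normc.normc R).
Variables (mu : {measure set X -> \bar R}) (n m : nat).
Hypothesis mufin : (mu setT < +oo)%E.
Hypothesis Hdet : forall N M : nat, \det (moment_mx mu N M) != 0.
Hypothesis H2 : forall N M : nat, (n <= N)%N -> (m <= M.+1)%N ->
        forall j k : 'I_M.+1, moment_inv mu N.+1 M (ord0, j) (ord_max, k) = 0.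
Hypothesis H3 : forall M : nat, (m.+1 <= M)%N ->
        forall j : 'I_(2 * n).+1, moment_inv mu (2 * n) M (inord n, ord0) (j, ord_max) = 0.

(** Condition (3) deletes the top z2-coefficient of the row (n,0), so it already lies in the box of
    height M. *)
Lemma center_bd M D : (m <= M)%N -> is_dual mu (2 * n) M.+1 n 0 D -> is_dual mu (2 * n) M n 0 D.
Proof.
move=> mM DD; have n2 : (n < (2 * n).+1)%N by lia.
have [D' DD' cD] := dual_moment_inv mufin Hdet (inord n : 'I_(2 * n).+1, @ord0 M.+1).
move: DD'; rewrite /= inordK // => DD'; have e := is_dual_uniq mufin Hdet DD DD'; subst D'.
split; last by move=> k l kn lM; rewrite DD.2 // (leq_trans lM).
apply/bdP => l k h; have [lM|lM] := ltnP M.+1 l; first by rewrite (coef_bd DD.1) // lM.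
have [kN|kN] := ltnP k (2 * n).+1; last by rewrite (coef_bd DD.1) // kN orbT.
have -> : l = M.+1 by move: h kN lM; rewrite !ltnS; lia.
by have /= := cD (Ordinal kN, ord_max); rewrite H3.
Qed.

Lemma density_exists : exists p : pol2,
  [/\ (size p <= m.+1)%N, forall k, (size (p`_k)%R <= n.+1)%N,
    forall z a : C, `|z| = 1 -> `|a| <= 1 -> (p.[a%:P]).[z] != 0 &
    forall A, measurable A -> mu A = (\int[torus_measure R]_(z in A) (normc (pev p z) ^- 2)%:E)%E].
Proof.
(* The range conditions are moved under the existential, so that rows can be chosen for all M and j
   at once; outside the range the value 0 is a dummy. *)
have LE M j : exists L, (m <= M.+1)%N -> (j <= M)%N -> is_dual mu (2 * n) M n j L /\ twosided mu n M j L.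
  have [mM|mM] := leqP m M.+1; last by exists 0.
  have [jM|jM] := leqP j M; last by exists 0.
  by have [L dL tL] := twosided_exists mufin Hdet (fun N nN => H2 nN mM) jM; exists L.
pose L M j := projT1 (cid (LE M j)).
have LP M j : (m <= M.+1)%N -> (j <= M)%N -> is_dual mu (2 * n) M n j (L M j) /\ twosided mu n M j (L M j).
  exact: (projT2 (cid (LE M j))).
have HL M j : (m <= M.+1)%N -> (j <= M)%N -> twosided mu n M j (L M j) by move=> mM jM; have [] := LP M j mM jM.
have Hq M : (m <= M)%N -> L M 0%N = L m 0%N.
  elim: M => [|M IH]; first by rewrite leqn0 => /eqP ->.
  rewrite leq_eqVlt => /orP[/eqP -> //|]; rewrite ltnS => mM.
  have mM1 : (m <= M.+2)%N by lia.
  rewrite -IH //; have [dS _] := LP M.+1 0%N mM1 isT.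
  have [d _] := LP M 0%N (leqW mM) isT.
  exact: (is_dual_uniq mufin Hdet (center_bd mM dS) d).
have [B [p [qE sp spk p0E pn0]]] := center_factor mufin Hdet HL Hq.
exists p; split=> //.
have B0 (z : C) : `|z| = 1 -> B.[z] != 0.
  move=> z1; have := center_neq0 mufin Hdet HL Hq z1 (a := 0); rewrite normr0 ler01 => /(_ isT).
  by rewrite qE evZ mulf_eq0 negb_or => /andP[].
apply: measure_eq_weighted_moments => //.
  by move=> z; apply: pn0; rewrite norm_circle_val.
move=> u; apply: (weighted_moment mufin _ qE spk p0E B0) => t k l.
(* As q is the row L_0 of every height from m on, the height max(m, l) covers the monomial z2^l. *)
have mM : (m <= maxn m l)%N by rewrite leq_maxl.
have [_] := HL (maxn m l) 0%N (leqW mM) isT; rewrite Hq //; apply; exact: leq_maxr.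
Qed.

End Sufficiency.

(** * Dual polynomials of the density |p|^-2 *)

Section OuterPolynomial.
Context {R : realType}.
Local Notation C := R[i].

(** The one-sided form of [shift_apply_inj]: all roots satisfy |a| > 1, so growth in the forward
    direction alone gives the contradiction. *)
Lemma recurrence_outer_eq0 (P : {poly C}) (y : nat -> C) (B : C) :
    (forall z, `|z| <= 1 -> P.[z] != 0) -> (forall s, `|y s| <= B) ->
    (forall s, \sum_(i < size P) P`_i * y (s + i)%N = 0) ->
  forall s, y s = 0.
Proof.
have [n] := ubnP (size P); elim: n => // n IH in P y B * => sP P0 yB Py.
have wide (Q : {poly C}) (u : nat -> C) s N : (size Q <= N)%N ->
    \sum_(i < size Q) Q`_i * u (s + i)%N = \sum_(i < N) Q`_i * u (s + i)%N.
  move=> sQ; rewrite (big_ord_widen N (fun i => Q`_i * u (s + i)%N)) // big_mkcond.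
  by apply: eq_bigr => i _; case: ltnP => // Qi; rewrite nth_default // mul0r.
have [sP1|sP1] := leqP (size P) 1.
  have p0 : P`_0 != 0.
    by have := P0 1; rewrite (size1_polyC sP1) coefC hornerC normr1; apply.
  move=> s; have := Py s; rewrite (wide _ _ _ 1%N) // big_ord1 addn0.
  by move/eqP; rewrite mulf_eq0 (negbTE p0) => /eqP.
have [a ra] : exists a, root P a by apply: closed_rootP; rewrite neq_ltn sP1 orbT.
have [P' PE] := factor_theorem _ _ ra.
have PN0 : P != 0 by apply: contraTneq sP1 => ->; rewrite size_poly0.
have sP' : (size P = (size P').+1)%N.
  by rewrite PE size_Mmonic ?monicXsubC ?size_XsubC ?addn2 //; apply: contraNneq PN0 => H'0; rewrite PE H'0 mul0r.
have a1 : 1 < `|a|.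
  by rewrite real_ltNge ?real1 ?normr_real //; apply/negP => /P0; rewrite (rootP ra) eqxx.
have y1 : forall s, y s.+1 - a * y s = 0.
  apply: (IH P' _ (B + `|a| * B)).
  - by rewrite -ltnS -sP'.
  - by move=> z z1; have := P0 z z1; rewrite PE hornerM mulf_eq0 negb_or => /andP[].
  - by move=> s; rewrite (le_trans (ler_normB _ _)) // normrM lerD ?ler_wpM2l.
  move=> s; rewrite -[RHS](Py s) (wide P _ _ (size P').+1) ?sP' //.
  rewrite (wide P' (fun s => y s.+1 - a * y s) _ (size P').+1) //.
  under eq_bigr do rewrite mulrBr.
  have cE i : P`_i = (if i == 0%N then 0 else P'`_i.-1) - P'`_i * a.
    by rewrite PE mulrBr coefB coefMX coefMC.
  under [RHS]eq_bigr do rewrite cE mulrBl.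
  rewrite big_split /=.
  rewrite [RHS]big_split /=; congr (_ + _).
    rewrite big_ord_recr /= nth_default // mul0r addr0 [RHS]big_ord_recl /= mul0r add0r.
    by apply: eq_bigr => i _; rewrite /bump /= add1n addnS.
  by apply: eq_bigr => i _; rewrite mulrA.
have yn (n' : nat) s : y (s + n')%N = a ^+ n' * y s.
  elim: n' => [|k IHk]; first by rewrite addn0 mul1r.
  by have /eqP := y1 (s + k)%N; rewrite addnS subr_eq0 => /eqP ->; rewrite IHk exprS mulrA.
move=> s; apply: (@geometric_unboundedC R a _ B) => // k.
by rewrite -normrX -normrM -yn.
Qed.

(** The variance of f is nonnegative. *)
Lemma probability_cintegral_le d (T : measurableType d) (P : probability T R) (f : T -> C) :
  bounded_measurable f -> `|cintegral P f| ^+ 2 <= cintegral P (fun t => f t * (f t)^*).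
Proof.
move=> bf; have Pfin : (P setT < +oo)%E by rewrite probability_setT ltry.
set c := cintegral P f.
have bc x := @bounded_measurable_cst _ T R x; have bJ := bounded_measurableJ bf.
have c1 x : cintegral P (fun=> x) = x.
  transitivity (x * cintegral P (fun=> 1)).
    by rewrite -cintegralZ //; apply: eq_cintegral => t; rewrite mulr1.
  rewrite /cintegral /= !Rintegral_cst // mul0r mul1r.
  by rewrite [X in fine X]probability_setT mulr1.
have : 0 <= cintegral P (fun t => (f t - c) * (f t - c)^*).
  by apply: cintegral_ge0 => t; rewrite -normCK exprn_ge0.
rewrite (@eq_cintegral _ _ _ _ _ (fun t => f t * (f t)^* + ((- c^*) * f t + ((- c) * (f t)^* + c * c^*)))); last first.
  by move=> t; rewrite rmorphB /=; ring.
have b1 : bounded_measurable (fun t => - c * (f t)^*) by exact: bounded_measurableM.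
have b2 : bounded_measurable (fun t => - c * (f t)^* + c * c^*) by exact: bounded_measurableD.
have b3 : bounded_measurable (fun t => - c^* * f t) by exact: bounded_measurableM.
have b4 : bounded_measurable (fun t => f t * (f t)^*) by exact: bounded_measurableM.
have b5 := bounded_measurableD b3 b2.
rewrite (cintegralD Pfin b4 b5) (cintegralD Pfin b3 b2) (cintegralD Pfin b1 (bc _)) !cintegralZ // cintegralJ // c1.
rewrite -/c => h; rewrite normCK -subr_ge0; apply: le_trans h _; rewrite le_eqVlt; apply/orP; left; apply/eqP; ring.
Qed.

(** A substitute for Cauchy's theorem applied to 1/Q: the integrals of z^(s+1) / Q are bounded and
    satisfy the recurrence with coefficients Q_i, because Q/Q = 1 and z^(s+1) has mean 0. *)
Lemma circle_outer_moment (Q : {poly C}) k : (forall a, `|a| <= 1 -> Q.[a] != 0) ->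
    bounded_measurable (fun z : circle R => (Q.[circle_val z])^-1) -> (0 < k)%N ->
  cintegral (circle_measure R) (fun z => circle_val z ^+ k * (Q.[circle_val z])^-1) = 0.
Proof.
move=> Q0 bQ; case: k => // k _.
have bz (s : nat) := bounded_measurableX s (@bounded_measurable_circle_val R).
have byQ s : bounded_measurable (fun z : circle R => circle_val z ^+ s * (Q.[circle_val z])^-1).
  by apply: bounded_measurableM.
pose y s := cintegral (circle_measure R) (fun z => circle_val z ^+ s.+1 * (Q.[circle_val z])^-1).
pose B := cintegral (circle_measure R) (fun z => (Q.[circle_val z])^-1 * ((Q.[circle_val z])^-1)^*).
apply: (@recurrence_outer_eq0 Q y (1 + B)) => // s.
  have yB : `|y s| ^+ 2 <= B.
    have h := probability_cintegral_le (circle_measure R) (byQ s.+1).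
    rewrite [leRHS](_ : _ = cintegral (circle_measure R) (fun z => circle_val z ^+ s.+1 * (Q.[circle_val z])^-1 * (circle_val z ^+ s.+1 * (Q.[circle_val z])^-1)^*)) //.
    apply: eq_cintegral => z; rewrite rmorphM /= mulrACA -[_ ^+ s.+1 * _]normCK normrX norm_circle_val !expr1n mul1r //.
  apply: (@le_trans _ _ (1 + `|y s| ^+ 2)); last by rewrite lerD2l.
  have nr : `|y s| \is Num.real by exact: normr_real.
  have [h|h] := real_leP nr (@real1 C); first by rewrite (le_trans h) // lerDl exprn_ge0.
  by rewrite (@le_trans _ _ (`|y s| ^+ 2)) ?lerDr // expr2 ler_peMl // ltW.
transitivity (cintegral (circle_measure R) (fun z => circle_val z ^+ s.+1)); last exact: circle_moment.
transitivity (\sum_(i < size Q) cintegral (circle_measure R)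
    (fun z => Q`_i * (circle_val z ^+ (s + i).+1 * (Q.[circle_val z])^-1))).
  by apply: eq_bigr => i _; rewrite cintegralZ ?circle_measure_fin //; exact: byQ.
rewrite -cintegral_sum ?circle_measure_fin //; last first.
  by move=> i _; apply: bounded_measurableM => //; exact: bounded_measurable_cst.
apply: eq_cintegral => z; have Qz : Q.[circle_val z] != 0 by apply: Q0; rewrite norm_circle_val.
rewrite -[RHS](mulfK Qz) [X in _ = _ * X / _]horner_coef mulr_sumr mulr_suml; apply: eq_bigr => i _.
by rewrite -addSn exprD; ring.
Qed.

End OuterPolynomial.

Lemma size_sum_leq (A : nzRingType) (I : Type) (r : seq I) (Q : pred I) (F : I -> {poly A}) K :
  (forall i, Q i -> (size (F i) <= K)%N) -> (size (\sum_(i <- r | Q i) F i)%R <= K)%N.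
Proof.
move=> FK; elim/big_ind: _ => [|x y sx sy|//]; first by rewrite size_poly0.
by rewrite (leq_trans (size_polyD _ _)) // geq_max sx.
Qed.

(** * The central rows of the density |P|^-2 *)

Section Necessity.
Context {R : realType}.
Local Notation C := R[i].
Local Notation X := (circle R * circle R)%type.
Local Notation pol2 := {poly {poly C}}.
Local Notation normc := (@ComplexField.Normc.normc R).
Local Notation sigma := (torus_measure R).
Variables (mu : {measure set X -> \bar R}) (n m : nat) (P : pol2).
Hypothesis mufin : (mu setT < +oo)%E.
Hypothesis sP : (size P <= m.+1)%N.
Hypothesis sPk : forall k, (size (P`_k)%R <= n.+1)%N.
Hypothesis P0 : forall z a : C, `|z| = 1 -> `|a| <= 1 -> (P.[a%:P]).[z] != 0.
Hypothesis muE : forall A, measurable A -> mu A = (\int[sigma]_(z in A) (normc (pev P z) ^- 2)%:E)%E.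
Local Notation ip := (ip mu).

Lemma pev_neq0 z : pev P z != 0.
Proof. by apply: P0; rewrite norm_circle_val. Qed.

Lemma invc_conj (x : C) : x^-1 = x^* * ((normc x ^+ 2)^-1)%:C%C.
Proof.
have [->|x0] := eqVneq x 0; first by rewrite invr0 rmorph0 mul0r.
rewrite fmorphV /= normc_sqr_mulC; field.
by rewrite x0 conjC_eq0 x0.
Qed.

Lemma bm_inv_pev : bounded_measurable (fun z => (pev P z)^-1).
Proof.
have [e e0 pe] := pev_lower_bound pev_neq0.
apply: (@bounded_measurable_ext _ _ _ (fun z => (pev P z)^* * ((normc (pev P z) ^+ 2)^-1)%:C%C)).
  by move=> z; rewrite [RHS]invc_conj.
apply: bounded_measurableM; first exact/bounded_measurableJ/bm_pev.
exact: (bm_inv_weight (trig_normc_sqr P) e0 pe).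
Qed.

Lemma cintegral_pev_density f : bounded_measurable f ->
  cintegral mu f = cintegral sigma (fun z => f z * ((pev P z)^-1 * ((pev P z)^-1)^*)).
Proof.
move=> bf; have [e e0 pe] := pev_lower_bound pev_neq0.
rewrite (cintegral_density (measurable_inv_weight (trig_normc_sqr P) e0 pe) (inv_weight_ge0 e0 pe) muE mufin torus_measure_fin (inv_weight_le e0 pe) bf).
apply: eq_cintegral => z; congr (_ * _); have p0 := pev_neq0 z.
by rewrite fmorphV /= normc_sqr_mulC invfM fmorphV.
Qed.

Lemma torus_outer_moment (c : {poly C}) (a b : int) : 0 < b ->
  cintegral sigma (fun z => c.[circle_val z.1] * zmono (a, b) z * (pev P z)^-1) = 0.
Proof.
move=> b0.
have bc : bounded_measurable (fun z : X => c.[circle_val z.1]).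
  apply: (@bounded_measurable_ext _ _ _ (pev c%:P)); last exact: bm_pev.
  by move=> z; rewrite /pev hornerC.
rewrite cintegral_torus; last first.
  by apply: bounded_measurableM bm_inv_pev; apply: bounded_measurableM bc _; exact: bm_zmono.
rewrite (@eq_cintegral _ _ _ _ _ (fun=> 0)) ?cintegral0 // ?circle_measure_fin // => x.
pose Q := (swapXY P).[(circle_val x)%:P].
have QE y : pev P (x, y) = Q.[circle_val y] by rewrite /Q horner2_swapXY.
have bQ : bounded_measurable (fun y : circle R => (Q.[circle_val y])^-1).
  apply: (bounded_measurable_ext (f := (fun z => (pev P z)^-1) \o (pair x))) => [y|].
    by rewrite /= QE.
  exact: (bounded_measurable_comp (pair1_measurable x) bm_inv_pev).
case: b b0 => // b; rewrite ltz_nat => b0.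
transitivity (cintegral (circle_measure R) (fun y => c.[circle_val x] * circle_val x ^ a * (circle_val y ^+ b * (Q.[circle_val y])^-1))).
  by apply: eq_cintegral => y; rewrite QE /zmono /= exprnP; ring.
rewrite cintegralZ ?circle_measure_fin //; last first.
  by apply: bounded_measurableM => //; exact/bounded_measurableX/bounded_measurable_circle_val.
rewrite circle_outer_moment ?mulr0 // => y y1; rewrite /Q horner2_swapXY.
by apply: P0 => //; exact: norm_circle_val.
Qed.

Variable M : nat.
Hypothesis mM : (m <= M.+1)%N.

Definition rvY : pol2 := \sum_(k < M.+2) rv n P`_k *: 'X^(M.+1 - k).

Definition center_term (i : nat) : pol2 := rv n P`_i *: P - P`_(M.+1 - i) *: rvY.

(* A Gohberg-Semencul formula; [rvY] is z_1^n z_2^(M+1) conj(P) on the torus. *)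
Definition center j : pol2 := \sum_(i < M.+2 | (i <= j)%N) 'X^(j - i) * center_term i.

Lemma sPM : (size P <= M.+2)%N.
Proof. exact: leq_trans sP _. Qed.

Lemma pevXn k (z : X) : pev ('X^k : pol2) z = circle_val z.2 ^+ k.
Proof. by rewrite (_ : 'X^k = mono 0 k) ?pev_mono ?mul1r // /mono expr0 scale1r. Qed.

Lemma pevE z : pev P z = \sum_(i < M.+2) (P`_i).[circle_val z.1] * circle_val z.2 ^+ i.
Proof. exact: ev_sum sPM. Qed.

Lemma pev_rvY z : pev rvY z = circle_val z.1 ^+ n * circle_val z.2 ^+ M.+1 * (pev P z)^*.
Proof.
rewrite pevE rmorph_sum mulr_sumr /rvY pev_sum; apply: eq_bigr => i _.
rewrite pevZ pevXn horner_rv_circle ?norm_circle_val //.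
have iM : (i <= M.+1)%N by rewrite -ltnS.
rewrite rmorphM rmorphXn /=.
have yE (y : C) : y ^+ M.+1 = y ^+ (M.+1 - i) * y ^+ i by rewrite -exprD subnK.
rewrite yE.
have := circle_mulC (norm_circle_val z.2); set y := circle_val z.2 => y1.
transitivity ((circle_val z.1 ^+ n * (P`_i).[circle_val z.1]^* * y ^+ (M.+1 - i)) * (y * y^*) ^+ i).
  by rewrite y1 expr1n; ring.
by rewrite exprMn; ring.
Qed.

Lemma size_rvY : (size rvY <= M.+2)%N.
Proof.
apply: size_sum_leq => i _; rewrite (leq_trans (size_scale_leq _ _)) // size_polyXn ltnS; lia.
Qed.

(** The full sum is [rvY] P - P [rvY]. It is what caps the z2-degree of [center j]. *)
Lemma center_telescope : \sum_(i < M.+2) 'X^(M.+1 - i) * center_term i = 0.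
Proof.
have -> : \sum_(i < M.+2) 'X^(M.+1 - i) * center_term i =
    \sum_(i < M.+2) (rv n P`_i *: 'X^(M.+1 - i)) * P - \sum_(i < M.+2) (P`_(M.+1 - i) *: 'X^(M.+1 - i)) * rvY.
  rewrite -sumrB; apply: eq_bigr => i _.
  by rewrite /center_term mulrBr -!scalerAr -!scalerAl.
rewrite -!mulr_suml -/rvY (reindex_inj rev_ord_inj) /=.
rewrite [X in _ - X * _](_ : _ = P) ?[P * _]mulrC ?subrr //.
rewrite -[RHS]coefK poly_def.
rewrite (big_ord_widen M.+2 (fun i => P`_i *: 'X^i)) ?sPM // [RHS]big_mkcond; apply: eq_bigr => i _.
rewrite (_ : (M.+1 - (M.+2 - i.+1) = i)%N); last by have := ltn_ord i; lia.
by case: ltnP => // h; rewrite nth_default // scale0r.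
Qed.

Lemma size_center_term i : (size (center_term i) <= M.+2)%N.
Proof.
rewrite (leq_trans (size_polyD _ _)) // geq_max size_polyN.
by rewrite !(leq_trans (size_scale_leq _ _)) ?size_rvY ?sPM.
Qed.

(** By [center_telescope], z2^(M+1-j) [center j] is minus the sum of the terms with i > j, whose
    degree is at most (M - j) + (M + 1); hence [center j] has degree at most M, one less than its
    terms suggest for j = 0. *)
Lemma size_center j : (j <= M)%N -> (size (center j) <= M.+1)%N.
Proof.
move=> jM; have : 'X^(M.+1 - j) * center j = - \sum_(i < M.+2 | ~~ (i <= j)%N) 'X^(M.+1 - i) * center_term i.
  apply/eqP; rewrite -addr_eq0 -[X in _ == X]center_telescope [X in _ == X](bigID (fun i : 'I_M.+2 => (i <= j)%N)) /=.
  apply/eqP; congr (_ + _); rewrite /center mulr_sumr; apply: eq_bigr => i ij.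
  rewrite mulrA -exprD; congr ('X^ _ * _); lia.
move=> e; have [->|c0] := eqVneq (center j) 0; first by rewrite size_poly0.
suff : (size ('X^(M.+1 - j) * center j)%R <= M.+1 + (M.+1 - j))%N.
  rewrite mulrC size_mulXn //; lia.
rewrite e size_polyN; apply: size_sum_leq => i; rewrite -ltnNge => ij.
have [->|t0] := eqVneq (center_term i) 0; first by rewrite mulr0 size_poly0.
rewrite mulrC size_mulXn //; apply: (leq_trans (leq_add (leqnn _) (size_center_term i))); have iM : (i < M.+2)%N by []; move: (nat_of_ord i) ij iM => i0; clear; lia.
Qed.

Lemma bd_center j : (j <= M)%N -> bd (2 * n) M (center j).
Proof.
move=> jM; split; first exact: size_center.
have sm (a b : {poly C}) : (size a <= n.+1)%N -> (size b <= n.+1)%N -> (size (a * b)%R <= (2 * n).+1)%N.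
  move=> sa sb; apply: leq_trans (size_polyMleq _ _) _; lia.
move=> l; rewrite coef_sum; apply: size_sum_leq => i _; rewrite coefXnM; case: ifP => _; first by rewrite size_poly0.
rewrite coefB !coefZ (leq_trans (size_polyD _ _)) // geq_max size_polyN !sm ?size_rv //.
rewrite coef_sum; apply: size_sum_leq => k _; rewrite coefZ coefXn.
by case: eqP => _; rewrite ?mulr1 ?mulr0 ?size_poly0 ?size_rv.
Qed.

(* Divided by P conj(P), the first half of the sum over i <= j is a monomial minus
   the sum over i > j, and then only positive powers of z_2 over P remain. *)
Lemma twosided_center j : (j <= M)%N -> twosided mu n M j (center j).
Proof.
move=> jM; split; first exact: bd_center.
move=> t k l lM; rewrite /ip cintegral_pev_density; last exact: bm_ip.
pose T1 (i : nat) (z : X) : C := (P`_i).[circle_val z.1] * zmono (k%:Z - t%:Z - n%:Z, l%:Z - j%:Z + i%:Z) z * (pev P z)^-1.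
pose T2 (i : nat) (z : X) : C := (P`_(M.+1 - i)).[circle_val z.1] * zmono (t%:Z - k%:Z + n%:Z, (j - i)%:Z - l%:Z + M.+1%:Z) z * (pev P z)^-1.
have bc (c : {poly C}) : bounded_measurable (fun z : X => c.[circle_val z.1]).
  apply: (@bounded_measurable_ext _ _ _ (pev c%:P)); last exact: bm_pev.
  by move=> z; rewrite /pev hornerC.
have bT (c : {poly C}) u : bounded_measurable (fun z : X => c.[circle_val z.1] * zmono u z * (pev P z)^-1).
  by apply: bounded_measurableM bm_inv_pev; apply: bounded_measurableM (bc c) _; exact: bm_zmono.
have T1s z : \sum_(i < M.+2) T1 i z = zmono (k%:Z - t%:Z - n%:Z, l%:Z - j%:Z) z.
  rewrite -[RHS](mulfK (pev_neq0 z)) [X in _ * X / _]pevE mulr_sumr mulr_suml; apply: eq_bigr => i _.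
  rewrite /T1 (_ : (_, l%:Z - j%:Z + i%:Z) = (k%:Z - t%:Z - n%:Z, l%:Z - j%:Z) + (0, i%:Z)); last by rewrite /GRing.add /= /add_pair /= addr0.
  rewrite zmonoD (_ : zmono (0, i%:Z) z = circle_val z.2 ^+ i); last by rewrite /zmono /= mul1r.
  by rewrite mulrAC; ring.
transitivity (cintegral sigma (fun z =>
   (zmono (k%:Z - t%:Z - n%:Z, l%:Z - j%:Z) z - \sum_(i < M.+2 | ~~ (i <= j)%N) T1 i z)^* - \sum_(i < M.+2 | (i <= j)%N) T2 i z)).
  apply: eq_cintegral => z.
  rewrite -T1s (bigID (fun i : 'I_M.+2 => (i <= j)%N)) /= addrK.
  rewrite pevM /center pev_sum mulr_sumr !mulr_suml rmorph_sum /= -sumrB; apply: eq_bigr => i ij.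
  rewrite pevM !pev_mono pevXn /center_term pevD pevN !pevZ pev_rvY horner_rv_circle ?norm_circle_val //.
  rewrite expr0 mulr1 /T1 /T2; set x := circle_val z.1; set y := circle_val z.2.
  have xE a : x ^+ a = zmono (a%:Z, 0) z by rewrite /zmono /= mulr1.
  have yE a : y ^+ a = zmono (0, a%:Z) z by rewrite /zmono /= mul1r.
  have pairE (u v : int * int) : u.1 = v.1 -> u.2 = v.2 -> u = v by case: u v => [? ?] [? ?] /= -> ->.
  have -> : zmono (t%:Z - k%:Z + n%:Z, (j - i)%:Z - l%:Z + M.+1%:Z) z =
      x ^+ t * x ^+ n * y ^+ (j - i) * (x ^+ k * y ^+ l)^* * y ^+ M.+1.
    by rewrite !xE !yE rmorphM /= !zmonoJ -!zmonoD; congr zmono; apply: pairE => /=; lia.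
  have conjM3 (a b c : C) : (a * b * c)^* = a^* * b^* * c^* by rewrite rmorphM rmorphM.
  rewrite conjM3 zmonoJ.
  have -> : zmono (- (k%:Z - t%:Z - n%:Z, l%:Z - j%:Z + i%:Z)) z =
      x ^+ t * x ^+ n * y ^+ (j - i) * (x ^+ k * y ^+ l)^*.
    by rewrite !xE !yE rmorphM /= !zmonoJ -!zmonoD; congr zmono; apply: pairE => /=; lia.
  have F0 := pev_neq0 z; rewrite fmorphV /=.
  have FJ0 : (pev P z)^* != 0 by rewrite conjC_eq0.
  by field; rewrite F0 FJ0.
have bs1 : bounded_measurable (fun z => \sum_(i < M.+2 | ~~ (i <= j)%N) T1 i z).
  by apply: bounded_measurable_sum => i _; exact: bT.
have bs2 : bounded_measurable (fun z => \sum_(i < M.+2 | (i <= j)%N) T2 i z).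
  by apply: bounded_measurable_sum => i _; exact: bT.
have bz := @bm_zmono R.
have bs1N := bounded_measurableN bs1; have bs2N := bounded_measurableN bs2.
have bs3 := bounded_measurableD (bz (k%:Z - t%:Z - n%:Z, l%:Z - j%:Z)) bs1N.
have sfin := @torus_measure_fin R.
rewrite cintegralD ?cintegralN ?cintegralJ ?cintegralD ?cintegralN //; last exact: bounded_measurableJ.
rewrite !cintegral_sum //; try (by move=> i _; exact: bT).
(* All exponents of z2 are positive here: l - j + i for i > j, and (j - i) - l + M + 1 because l <=
   M. *)
rewrite !big1; last 2 first.
- by move=> i ij; apply: torus_outer_moment; have := ltn_ord i; lia.
- by move=> i ij; apply: torus_outer_moment; have := ltn_ord i; lia.
rewrite !subr0 torus_moment rmorph_nat; congr ((_ : bool)%:R).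
rewrite /eq_op /=; lia.
Qed.

End Necessity.

(** * Complex null sequences *)

Section Vanishing.
Context {R : realType}.
Local Notation C := R[i].
Local Notation normc := (@ComplexField.Normc.normc R).

Definition tends0 (c : nat -> C) := normc (c k) @[k --> \oo] --> (0 : R).

Lemma normc_ge0 (x : C) : 0 <= normc x.
Proof. by case: x => a b; exact: sqrtr_ge0. Qed.

Lemma tends0D c d : tends0 c -> tends0 d -> tends0 (fun k => c k + d k).
Proof.
move=> c0 d0; have cd0 : normc (c k) + normc (d k) @[k --> \oo] --> (0 : R).
  suff : normc (c k) + normc (d k) @[k --> \oo] --> (0 + 0 : R) by rewrite addr0.
  exact: cvgD.
apply: squeeze_cvgr (cvg_cst 0) cd0; apply: nearW => k.
by rewrite normc_ge0 le_normcD.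
Qed.

Lemma tends0M c d : tends0 c -> tends0 d -> tends0 (fun k => c k * d k).
Proof.
move=> c0 d0; rewrite /tends0; under eq_fun do rewrite ComplexField.Normc.normcM.
suff : normc (c k) * normc (d k) @[k --> \oo] --> (0 * 0 : R) by rewrite mulr0.
exact: cvgM.
Qed.

Lemma tends0Z c x : tends0 c -> tends0 (fun k => c k * x).
Proof.
move=> c0; rewrite /tends0; under eq_fun do rewrite ComplexField.Normc.normcM.
suff : normc (c k) * normc x @[k --> \oo] --> (0 * normc x : R) by rewrite mul0r.
by apply: cvgM; [exact: c0|exact: cvg_cst].
Qed.

Lemma tends0_sum I (r : seq I) (F : I -> nat -> C) : (forall i, tends0 (F i)) ->
  tends0 (fun k => \sum_(i <- r) F i k).
Proof.
move=> F0; elim: r => [|i r IH].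
  by rewrite /tends0; under eq_fun do rewrite big_nil ComplexField.Normc.normc0; exact: cvg_cst.
by rewrite /tends0; under eq_fun do rewrite big_cons; exact: tends0D.
Qed.

Lemma tends0_shift c n : tends0 c -> tends0 (fun k => c (n + k)%N).
Proof.
move=> c0; rewrite /tends0; under eq_fun do rewrite addnC.
apply: (@cvg_comp _ _ _ (addn^~ n) (normc \o c) _ _ _ _ c0); exact: cvg_addnr.
Qed.

Lemma normcJ (x : C) : normc x^* = normc x.
Proof. by case: x => a b /=; rewrite sqrrN. Qed.

Lemma tends0J c : tends0 c -> tends0 (fun k => (c k)^*).
Proof. by move=> c0; rewrite /tends0; under eq_fun do rewrite normcJ. Qed.

Lemma tends0_dominated c (x : C) : tends0 c -> (forall k, x <= c k) -> 0 <= x -> x = 0.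
Proof.
move=> c0 xc x0; apply: ComplexField.Normc.eq0_normc.
apply/eqP; rewrite eq_le normc_ge0 andbT.
apply: (cvgr_to_ge c0).
apply: nearW => k /=; rewrite -lecR -[leLHS]/(`|x|) -[leRHS]/(`|c k|) !ger0_norm ?xc //.
exact: le_trans (xc k).
Qed.

End Vanishing.

(** * Condition (2) from the decay of products with far monomials *)

Section Truncation.
Context {R : realType}.
Local Notation C := R[i].
Local Notation X := (circle R * circle R)%type.
Local Notation pol2 := {poly {poly C}}.
Variable (mu : {measure set X -> \bar R}).
Hypothesis mufin : (mu setT < +oo)%E.
Local Notation ip := (ip mu).
Variables (n M : nat) (L : nat -> pol2).
Hypothesis HL : forall j, (j <= M)%N -> twosided mu n M j (L j).
Hypothesis Hvanish : forall (g : pol2) j, tends0 (fun k => ip g (mono k j)).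
Variables (N j : nat) (g : pol2).
Hypotheses (nN : (n <= N)%N) (jM : (j <= M)%N) (gD : is_dual mu N.+1 M 0 j g).

Let d a b := ip g (mono a b).
Let T := (N.+2 - n)%N.
Let nT : (n + T = N.+2)%N. Proof. rewrite /T; lia. Qed.

(* [tail r] has the products of g with the monomials of z_1-degree between N + 2 and
   N + 1 + 2n + r, and product 0 with the others; [eps r] collects its coefficients
   above that range minus n, and [G r], the part below, is orthogonal to [tail r]. *)
Let tail r : pol2 := \sum_(i < 2 * n + r) \sum_(j < M.+1) (d (N.+2 + i) j)%:P *: (mono (T + i) 0 * L j).

Lemma ip_tail r a b : (b <= M)%N -> ip (tail r) (mono a b) =
  if (N.+2 <= a < N.+2 + (2 * n + r))%N then d a b else 0.
Proof.
move=> bM; rewrite ip_suml //.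
transitivity (\sum_(i < 2 * n + r) ((a == N.+2 + i)%N)%:R * d (N.+2 + i) b).
  apply: eq_bigr => i _; rewrite ip_suml //; rewrite -ltnS in bM.
  rewrite (bigD1 (Ordinal bM)) //= [X in _ + X]big1 ?addr0; last first.
    move=> l lb; have [_ tl] := HL (leq_ord l); rewrite ipZl // tl // (_ : (b == l) = false) ?andbF ?mulr0 //.
    by apply: contraNF lb => /eqP e; apply/eqP/val_inj.
  have [_ tb] := HL (leq_ord (Ordinal bM)); rewrite ipZl // tb //= eqxx andbT addnA nT mulrC //.
case: ifPn => h.
  have ai : (a - N.+2 < 2 * n + r)%N by lia.
  rewrite (bigD1 (Ordinal ai)) //= big1 ?addr0.
    by rewrite subnKC ?eqxx ?mul1r //; lia.
  move=> i ine; rewrite (_ : (a == _)%N = false) ?mul0r //; apply/negbTE.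
  by apply: contra ine => /eqP e; apply/eqP/val_inj => /=; lia.
rewrite big1 // => i _; rewrite (_ : (a == _)%N = false) ?mul0r //; have := ltn_ord i; lia.
Qed.

Lemma coef_tail r a l : ((tail r)`_l)`_a = \sum_(i < 2 * n + r) \sum_(j < M.+1)
  d (N.+2 + i) j * (if (T + i <= a)%N then ((L j)`_l)`_(a - (T + i)) else 0).
Proof.
rewrite !coef_sum; apply: eq_bigr => i _; rewrite !coef_sum; apply: eq_bigr => k _.
by rewrite coefZ coefCM coef_monoM leq0n andbT subn0.
Qed.

Lemma size_tail r : (size (tail r) <= M.+1)%N.
Proof.
apply: size_sum_leq => i _; apply: size_sum_leq => k _.
rewrite (leq_trans (size_scale_leq _ _)) //.
rewrite /mono expr0 -scalerAl mul1r (leq_trans (size_scale_leq _ _)) //.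
by have [[]] := HL (leq_ord k).
Qed.

(** The difference of g and [tail r] is orthogonal to the powers z1^k with 0 < k < N + 2 + 2n + r.
    All powers in z1^(a-n) L_l lie in this range, and the product with it is the conjugate of the
    coefficient at z1^a. *)
Lemma coef_tail_mid r a l : (n < a)%N -> (a <= n + N.+1 + r)%N -> (l <= M)%N ->
  ((tail r)`_l)`_a = (g`_l)`_a.
Proof.
move=> na aN lM; apply/eqP; rewrite eq_sym -subr_eq0 -!coefB; apply/eqP.
have sh : (size (g - tail r)%R <= M.+1)%N.
  by rewrite (leq_trans (size_polyD _ _)) // geq_max size_polyN size_tail andbT; have [[]] := gD.
have h0 k b : (0 < k)%N -> (k < N.+2 + (2 * n + r))%N -> (b <= M)%N -> ip (g - tail r) (mono k b) = 0.
  move=> k0 kN bM; rewrite ipDl // ipNl // ip_tail // kN andbT.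
  case: ltnP => [_|kN1]; first by rewrite subrr.
  by rewrite gD.2 // eqn0Ngt k0 subr0.
have [t t0 aE] : exists2 t, (0 < t)%N & a = (n + t)%N by exists (a - n)%N; lia.
have [bL _] := HL lM.
have bLt : bd (t + 2 * n) M (mono t 0 * L l).
  apply/bdP => k b kb; rewrite coef_monoM subn0 leq0n andbT; case: ifP => // tk.
  by apply: (coef_bd bL); lia.
apply: (can_inj conjCK); rewrite rmorph0 aE -(twosided_ip mufin t lM (HL lM) sh).
rewrite ipC // (ip_monor_wide mufin _ bLt) big1 ?rmorph0 // => b _; rewrite big1 // => k _.
rewrite coef_monoM; case: ifPn => [|_]; last by rewrite rmorph0 mul0r.
rewrite leq0n andbT => tk; rewrite h0 ?mulr0 // ?(leq_trans t0) //; last exact: leq_ord.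
have := ltn_ord k; lia.
Qed.

Let c r s l := ((tail r)`_l)`_(N.+2 + n + r + s).

(** Only the last 2n shifts in [tail r] reach these degrees, and their weights are products of g
    with monomials that move off to infinity with r. *)
Lemma tends0_coef_tail s l : tends0 (fun r => c r s l).
Proof.
have cE r : c r s l = \sum_(i < 2 * n) \sum_(k < M.+1) d (N.+1 + 2 * n - i + r) k * ((L k)`_l)`_(s + i.+1).
  rewrite /c coef_tail (reindex_inj rev_ord_inj) /=.
  rewrite big_split_ord /= [X in _ + X]big1 ?addr0; last first.
    move=> i _; rewrite big1 // => k _; case: ifP => _; last by rewrite mulr0.
    rewrite (coef_bd (HL (leq_ord k)).1) ?mulr0 //; have := ltn_ord i; move: nT; lia.
  apply: eq_bigr => i _; apply: eq_bigr => k _; have im := ltn_ord i.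
  have -> : (N.+2 + (2 * n + r - i.+1) = N.+1 + 2 * n - i + r)%N by lia.
  have -> : (T + (2 * n + r - i.+1) <= N.+2 + n + r + s)%N by move: nT; lia.
  by congr (d _ _ * nth _ _ _); move: nT; lia.
rewrite (_ : (fun r => _) = (fun r => \sum_(i < 2 * n) \sum_(k < M.+1) d (N.+1 + 2 * n - i + r) k * ((L k)`_l)`_(s + i.+1))).
  apply: tends0_sum => i; apply: tends0_sum => k; apply: tends0Z.
  apply: (@tends0_shift _ (fun a => d a k)); exact: Hvanish.
by apply/funext => r.
Qed.

Let eps r : pol2 := \sum_(s < 2 * n) \sum_(l < M.+1) (c r s l)%:P *: mono s l.

Lemma coef_eps r a l : (l <= M)%N -> ((eps r)`_l)`_a = if (a < 2 * n)%N then c r a l else 0.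
Proof.
rewrite -ltnS => lM; rewrite !coef_sum.
transitivity (\sum_(s < 2 * n) (a == s)%:R * c r s l).
  apply: eq_bigr => s _; rewrite !coef_sum (bigD1 (Ordinal lM)) //= [X in _ + X]big1 ?addr0; last first.
    move=> k kl; rewrite coefZ coefCM coef_mono (_ : (l == k) = false) ?andbF ?mulr0 //.
    by apply: contraNF kl => /eqP e; apply/eqP/val_inj.
  by rewrite coefZ coefCM coef_mono eqxx andbT mulrC.
case: ltnP => [an|an].
  rewrite (bigD1 (Ordinal an)) //= eqxx mul1r big1 ?addr0 // => s sa.
  rewrite (_ : (a == s) = false) ?mul0r //.
  by apply: contraNF sa => /eqP e; apply/eqP/val_inj.
by rewrite big1 // => s _; rewrite (_ : (a == s) = false) ?mul0r //; have := ltn_ord s; lia.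
Qed.

Lemma tends0_eps : tends0 (fun r => ip (eps r) (eps r)).
Proof.
rewrite (_ : (fun r => _) = (fun r => \sum_(s < 2 * n) \sum_(l < M.+1)
    c r s l * \sum_(s' < 2 * n) \sum_(l' < M.+1) (c r s' l')^* * ip (mono s l) (mono s' l'))); last first.
  apply/funext => r; rewrite {1}/eps ip_suml //; apply: eq_bigr => s _.
  rewrite ip_suml //; apply: eq_bigr => l _; rewrite ipZl //; congr (_ * _).
  rewrite ip_sumr //; apply: eq_bigr => s' _; rewrite ip_sumr //; apply: eq_bigr => l' _.
  by rewrite ipZr.
apply: tends0_sum => s; apply: tends0_sum => l; apply: tends0M; first exact: tends0_coef_tail.
apply: tends0_sum => s'; apply: tends0_sum => l'; apply: tends0Z; apply: tends0J.
exact: tends0_coef_tail.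
Qed.

Let G r := tail r - mono (N.+2 + n + r) 0 * eps r.

(** Between N + 2 and N + 1 + n + r the coefficients of [tail r] are those of g, which are zero
    there; above, [eps r] cancels them. *)
Lemma coef_G r a l : (l <= M)%N ->
  ((G r)`_l)`_a = if (a <= N.+1)%N then ((tail r)`_l)`_a else 0.
Proof.
move=> lM; rewrite /G coefB coefB coef_monoM leq0n andbT subn0 coef_eps //.
have [aN1|aN1] := leqP a N.+1.
  by rewrite (_ : (N.+2 + n + r <= a)%N = false) ?subr0 //; apply/negbTE; rewrite -ltnNge; lia.
have [h|h] := leqP (N.+2 + n + r) a.
  case: ltnP => h2; first by rewrite /c subnKC // subrr.
  rewrite subr0 coef_tail big1 // => i _; rewrite big1 // => k _; case: ifP => _; last by rewrite mulr0.
  rewrite (coef_bd (HL (leq_ord k)).1) ?mulr0 //; have := ltn_ord i; move: nT; lia.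
rewrite subr0 coef_tail_mid //; [|lia|lia].
by rewrite (coef_bd gD.1) // aN1 orbT.
Qed.

Lemma bd_G r : bd N.+1 M (G r).
Proof.
apply/bdP => l a h; have [lM|lM] := leqP l M.
  by rewrite coef_G // leqNgt; move: h; rewrite ltnNge lM /= => ->.
rewrite (_ : (G r)`_l = 0) ?coef0 // nth_default //.
apply: leq_trans lM; rewrite (leq_trans (size_polyD _ _)) // geq_max size_tail size_polyN /=.
rewrite /mono expr0 -scalerAl mul1r (leq_trans (size_scale_leq _ _)) //.
apply: size_sum_leq => s _; apply: size_sum_leq => k _.
rewrite (leq_trans (size_scale_leq _ _)) // (leq_trans (size_scale_leq _ _)) // size_polyXn.
exact: ltn_ord.
Qed.

(** [G r] has z1-degree at most N + 1, hence is orthogonal to [tail r]; so its square is minus its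
    product with the shifted [eps r], and Cauchy-Schwarz applies. *)
Lemma ip_G_le r : ip (G r) (G r) <= ip (eps r) (eps r).
Proof.
have tG : ip (tail r) (G r) = 0.
  rewrite (ip_monor_wide mufin _ (bd_G r)) big1 // => l _; rewrite big1 // => a _.
  by rewrite ip_tail ?leq_ord // [(N.+2 <= a)%N]leqNgt ltn_ord mulr0.
have e0 := ip_ge0 mu (eps r); have g0 := ip_ge0 mu (G r).
have GE : ip (G r) (G r) = - ip (mono (N.+2 + n + r) 0 * eps r) (G r).
  by rewrite {1}/G ipDl // ipNl // tG add0r.
have := ip_CauchySchwarz mufin (mono (N.+2 + n + r) 0 * eps r) (G r).
rewrite ip_shift -normrN -GE ger0_norm // expr2.
have [->|gn0] := eqVneq (ip (G r) (G r)) 0; first by rewrite e0.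
by rewrite ler_pM2r // lt_def gn0.
Qed.

(** The top coefficient of g is also that of [tail r] and of [G r] for every r. As a product of
    [G r] with a shift of L_k it is bounded by the norm of [eps r], which tends to 0. *)
Lemma dual_first_top_eq0 k : (k <= M)%N -> (g`_k)`_N.+1 = 0.
Proof.
move=> kM; pose K := ip (L k) (L k).
have gE r : `|(g`_k)`_N.+1| ^+ 2 <= K * ip (eps r) (eps r).
  have <- : ((tail r)`_k)`_N.+1 = (g`_k)`_N.+1 by apply: coef_tail_mid => //; lia.
  have <- : ((G r)`_k)`_N.+1 = ((tail r)`_k)`_N.+1 by rewrite coef_G // leqnn.
  have sG : (size (G r) <= M.+1)%N by have [] := bd_G r.
  have := twosided_ip mufin (N.+1 - n)%N kM (HL kM) sG.
  rewrite subnKC; last by lia.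
  move=> e; rewrite -norm_conjC -e.
  apply: (le_trans (ip_CauchySchwarz mufin _ _)); rewrite ip_shift.
  by rewrite ler_wpM2l ?ip_G_le ?ip_ge0.
apply/eqP; rewrite -normr_eq0 -sqrf_eq0; apply/eqP.
apply: (@tends0_dominated _ (fun r => ip (eps r) (eps r) * K)).
- exact/tends0Z/tends0_eps.
- by move=> r; rewrite mulrC.
- exact: exprn_ge0.
Qed.

End Truncation.

(** * Comparison with the torus measure; the three conditions for a density |P|^-2 *)

Section Comparison.
Context {R : realType}.
Local Notation C := R[i].
Local Notation X := (circle R * circle R)%type.
Local Notation pol2 := {poly {poly C}}.
Local Notation normc := (@ComplexField.Normc.normc R).
Local Notation sigma := (torus_measure R).
Local Notation sip := (ip sigma).
Variables (mu : {measure set X -> \bar R}) (n m : nat) (P : pol2).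
Hypothesis mufin : (mu setT < +oo)%E.
Hypothesis sP : (size P <= m.+1)%N.
Hypothesis sPk : forall k, (size (P`_k)%R <= n.+1)%N.
Hypothesis P0 : forall z a : C, `|z| = 1 -> `|a| <= 1 -> (P.[a%:P]).[z] != 0.
Hypothesis muE : forall A, measurable A -> mu A = (\int[sigma]_(z in A) (normc (pev P z) ^- 2)%:E)%E.
Local Notation mip := (ip mu).

Lemma torus_ip_mono a b c d : sip (mono a b) (mono c d) = ((a == c) && (b == d))%:R.
Proof.
rewrite ip_monoE; transitivity (cintegral sigma (zmono (a%:Z - c%:Z, b%:Z - d%:Z))).
  by apply: eq_cintegral => z; rewrite /zmono /= !opprB.
by rewrite torus_moment /eq_op /= !subr_eq0.
Qed.

Lemma torus_ip_sum_mono (I : finType) (e : I -> nat * nat) (x : I -> C) k : injective e ->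
  sip (\sum_i (x i)%:P *: mono (e i).1 (e i).2) (mono (e k).1 (e k).2) = x k.
Proof.
move=> ei; rewrite ip_suml ?torus_measure_fin // (bigD1 k) //= ipZl ?torus_measure_fin //.
rewrite torus_ip_mono !eqxx mulr1 big1 ?addr0 // => i ik.
rewrite ipZl ?torus_measure_fin // torus_ip_mono (_ : _ && _ = false) ?mulr0 //.
by apply: contraNF ik => /andP[/eqP h1 /eqP h2]; apply/eqP/ei; case: (e i) (e k) h1 h2 => [? ?] [? ?] /= -> ->.
Qed.

Lemma density_factorE (z : X) : (pev P z)^-1 * ((pev P z)^-1)^* = ((normc (pev P z) ^+ 2)^-1)%:C%C.
Proof. by rewrite [RHS]fmorphV /= normc_sqr_mulC invfM [in LHS]fmorphV. Qed.

Let bm2 := @bm_ip R.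

Lemma bm_density : bounded_measurable (fun z => (pev P z)^-1 * ((pev P z)^-1)^*).
Proof.
have b := bm_inv_pev P0.
by apply: bounded_measurableM => //; exact: bounded_measurableJ.
Qed.

Lemma ip_le_torus : exists2 E : C, 0 <= E & forall f, mip f f <= E * sip f f.
Proof.
have [e e0 pe] := pev_lower_bound (pev_neq0 P0).
exists (e^-1)%:C%C; first by rewrite ler0c invr_ge0 ltW.
move=> f; rewrite /ip (cintegral_pev_density mufin P0 muE) // -cintegralZ ?torus_measure_fin //.
apply: cintegral_le.
- exact: torus_measure_fin.
- exact: bounded_measurableM (bm2 f f) bm_density.
- by apply: bounded_measurableM (bm2 f f); exact: bounded_measurable_cst.
move=> z; rewrite density_factorE mulrC ler_wpM2r //; first by rewrite -normCK exprn_ge0.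
by rewrite lecR (inv_weight_le e0 pe).
Qed.

Lemma torus_le_ip : exists E : C, forall f, sip f f <= E * mip f f.
Proof.
have [_ _ [K PK]] := bm_trig (trig_normc_sqr P).
exists K%:C%C => f; rewrite /ip [X in _ * X](cintegral_pev_density mufin P0 muE) // -cintegralZ ?torus_measure_fin //; last first.
  exact: bounded_measurableM (bm2 f f) bm_density.
apply: cintegral_le => //.
- exact: torus_measure_fin.
- by apply: bounded_measurableM; [exact: bounded_measurable_cst|exact: bounded_measurableM (bm2 f f) bm_density].
move=> z; rewrite density_factorE mulrCA ler_peMr //; first by rewrite -normCK exprn_ge0.
have [/= h _] := PK z.
rewrite -rmorphM -[1](rmorph1 (real_complex R)) lecR.
have p0 : 0 < normc (pev P z) ^+ 2.
  by rewrite exprn_gt0 // -ltcR -[(normc _)%:C%C]/(`|pev P z|) normr_gt0 pev_neq0.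
by rewrite -[_^-1]div1r mulrA mulr1 ler_pdivlMr // mul1r (le_trans (ler_norm _)).
Qed.

(** A null vector gives a polynomial f of norm 0 for mu, hence for the torus measure, where the
    monomials are orthonormal. *)
Lemma moment_det_neq0 N M : \det (moment_mx mu N M) != 0.
Proof.
apply/det0P => -[v v0 vG].
pose e (a : 'I_#|{: 'I_N.+1 * 'I_M.+1}|) : nat * nat := ((enum_val a).1 : nat, (enum_val a).2 : nat).
have ei : injective e.
  move=> a b [h1 h2]; apply: enum_val_inj.
  by case: (enum_val a) (enum_val b) h1 h2 => [? ?] [? ?] /= /val_inj -> /val_inj ->.
pose f : pol2 := \sum_a (v 0 a)%:P *: mono (e a).1 (e a).2.
have f0 : mip f f = 0.
  rewrite {2}/f ip_sumr // big1 // => b _; rewrite ipZr // ip_suml //.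
  have <- : (v *m moment_mx mu N M) 0 b = \sum_a mip ((v 0 a)%:P *: mono (e a).1 (e a).2) (mono (e b).1 (e b).2).
    by rewrite mxE; apply: eq_bigr => a _; rewrite ipZl // ip_monoE mxE.
  by rewrite vG mxE mulr0.
have [E fE] := torus_le_ip.
have sf0 : sip f f = 0.
  by apply/eqP; rewrite eq_le ip_ge0 andbT; have := fE f; rewrite f0 mulr0.
case/eqP: v0; apply/rowP => a; rewrite mxE -(torus_ip_sum_mono _ _ ei).
exact: (ip_self_eq0 (@torus_measure_fin R)).
Qed.

(** Bessel's inequality: with T = sum d_k z1^k z2^j and S = sum |d_k|^2, Cauchy-Schwarz and the
    comparison of norms give S^2 <= <g,g> E S. So the series of |d_k|^2 converges and its terms tend
    to 0. *)
Lemma ip_mono_tends0 g j : tends0 (fun k => mip g (mono k j)).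
Proof.
have [E E0 fE] := ip_le_torus.
pose d k := mip g (mono k j).
have SB K : \sum_(k < K) `|d k| ^+ 2 <= mip g g * E.
  pose e (k : 'I_K) : nat * nat := (k : nat, j).
  have ei : injective e by move=> a b [] /val_inj.
  pose T : pol2 := \sum_k (d (k : 'I_K))%:P *: mono (e k).1 (e k).2.
  pose S := \sum_(k < K) `|d k| ^+ 2.
  have S0 : 0 <= S by apply: sumr_ge0 => k _; rewrite exprn_ge0.
  have gT : mip g T = S.
    by rewrite ip_sumr //; apply: eq_bigr => k _; rewrite ipZr // normCK mulrC.
  have TT : sip T T = S.
    rewrite {2}/T ip_sumr ?torus_measure_fin //; apply: eq_bigr => k _.
    by rewrite ipZr ?torus_measure_fin // (torus_ip_sum_mono _ _ ei) normCK mulrC.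
  have h := ip_CauchySchwarz mufin g T; rewrite gT ger0_norm // in h.
  have h2 : S ^+ 2 <= mip g g * E * S.
    by apply: le_trans h _; rewrite -mulrA ler_wpM2l ?ip_ge0 // -TT.
  rewrite -/S; have [->|Sn0] := eqVneq S 0; first by rewrite mulr_ge0 ?ip_ge0.
  by rewrite -(@ler_pM2r _ S) // lt_def Sn0.
pose B := complex.Re (mip g g * E).
have dB K : series (fun k => normc (d k) ^+ 2) K <= B.
  have := SB K; rewrite lecE => /andP[_]; apply: le_trans.
  rewrite seriesEord raddf_sum le_eqVlt; apply/orP; left; apply/eqP; apply: eq_bigr => k _.
  by rewrite -[`|d k|]/((normc (d k))%:C%C) -rmorphXn.
have dc : cvgn (series (fun k => normc (d k) ^+ 2)).
  apply: nondecreasing_is_cvgn.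
    by apply/nondecreasing_seqP => k; rewrite seriesSr lerDl exprn_ge0 // normc_ge0.
  by exists B => _ [k _ <-].
have := cvg_series_cvg_0 dc => d0.
have := cvg_comp _ _ d0 (@sqrt_continuous R 0); rewrite sqrtr0.
suff -> : Num.sqrt \o (fun k => normc (d k) ^+ 2) = (fun k => normc (d k)) by [].
by apply/funext => k; rewrite /comp sqrtr_sqr ger0_norm ?normc_ge0.
Qed.

Lemma moment_inv_first_eq0 N M : (n <= N)%N -> (m <= M.+1)%N ->
  forall j k : 'I_M.+1, moment_inv mu N.+1 M (ord0, j) (ord_max, k) = 0.
Proof.
move=> nN mM j k; have [D DD cD] := dual_moment_inv mufin moment_det_neq0 (@ord0 N.+1, j).
rewrite -cD /=; apply: (dual_first_top_eq0 mufin _ ip_mono_tends0 nN (leq_ord j) DD (leq_ord k)) => i iM.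
exact: (twosided_center mufin sP sPk P0 muE mM iM).
Qed.

Lemma moment_inv_center_eq0 M : (m.+1 <= M)%N ->
  forall j : 'I_(2 * n).+1, moment_inv mu (2 * n) M (inord n, ord0) (j, ord_max) = 0.
Proof.
move=> mM j; have [D DD cD] := dual_moment_inv mufin moment_det_neq0 (inord n : 'I_(2 * n).+1, @ord0 M).
have n2 : (n < (2 * n).+1)%N by lia.
have mM1 : (m <= M.+1)%N by lia.
have [bL tL] := twosided_center mufin sP sPk P0 muE mM1 (leq0n M).
rewrite -cD (is_dual_uniq (j := 0%N) mufin moment_det_neq0 DD (D' := center n P M 0)) /=; last first.
  split=> // k l k2 lM; rewrite inordK //; have := tL 0%N k l lM; rewrite addn0 => <-.
  by rewrite [mono 0 0]/mono !expr0 scale1r mul1r.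
suff -> : (center n P M 0)`_M = 0 by rewrite coef0.
rewrite nth_default //; apply: (leq_trans _ mM).
(* For j = 0 only the term i = 0 is left, and P_(M+1) = 0 since m < M + 1; so the row is the
   reversal of P_0 times P, of z2-degree at most m < M. *)
rewrite /center (bigD1 (@ord0 M.+1)) //= big1 ?addr0; last by move=> i /andP[]; rewrite leqn0 => /eqP i0 /eqP[]; apply/val_inj.
have PM : P`_M.+1 = 0 by rewrite nth_default // (leq_trans sP) //; lia.
rewrite /center_term /= !subn0 PM scale0r subr0 expr0 mul1r.
by rewrite (leq_trans (size_scale_leq _ _)).
Qed.

End Comparison.

Lemma size_swapXYP (A : nzRingType) (f : {poly {poly A}}) N :
  (size (swapXY f) <= N)%N <-> (forall k, (size (f`_k)%R <= N)%N).
Proof.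
split=> [sf k|sf].
  apply/leq_sizeP => j Nj; rewrite -coef_swapXY [(swapXY f)`_j]nth_default ?coef0 //.
  exact: leq_trans Nj.
apply/leq_sizeP => j Nj; apply/polyP => k; rewrite coef_swapXY coef0 nth_default //.
exact: leq_trans (sf k) Nj.
Qed.

Unset Implicit Arguments.

Theorem theorem9p6 (R : realType) (n m : nat)
    (mu : {finite_measure set (circle R * circle R)%type -> \bar R}) :
  (exists p : {poly {poly R[i]}},
    [/\ (size p <= n.+1)%N,
        (sizeY p <= m.+1)%N,
        forall z1 z2 : R[i], `|z1| = 1 -> `|z2| <= 1 -> p.[z1, z2] != 0
      & forall A : set (circle R * circle R)%type, measurable A ->
          mu A = (\int[torus_measure R]_(z in A)
            (ComplexField.Normc.normc p.[circle_val z.1, circle_val z.2] ^- 2)%:E)%E])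
  <->
  [/\ forall N M : nat, \det (moment_mx mu N M) != 0,
      forall N M : nat, (n <= N)%N -> (m <= M.+1)%N ->
        forall j k : 'I_M.+1, moment_inv mu N.+1 M (ord0, j) (ord_max, k) = 0
    & forall M : nat, (m.+1 <= M)%N ->
        forall j : 'I_(2 * n).+1,
          moment_inv mu (2 * n) M (inord n, ord0) (j, ord_max) = 0].
Proof.
have mufin : (mu setT < +oo)%E by rewrite ltey_eq fin_num_measure.
split=> [[p [sp sYp p0 muE]]|[Hdet H2 H3]].
  (* In the statement the outer variable of p is z1, in the development it is z2; [swapXY] passes
     between the two. *)
  have sP : (size (swapXY p) <= m.+1)%N by rewrite -sizeYE.
  have sPk : forall k, (size ((swapXY p)`_k)%R <= n.+1)%N by apply/size_swapXYP; rewrite swapXYK.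
  have P0 : forall z a : R[i], `|z| = 1 -> `|a| <= 1 -> ((swapXY p).[a%:P]).[z] != 0.
    by move=> z a z1 a1; rewrite horner2_swapXY; exact: p0.
  have muP A : measurable A -> mu A = (\int[torus_measure R]_(z in A)
      (ComplexField.Normc.normc (pev (swapXY p) z) ^- 2)%:E)%E.
    by move=> mA; rewrite muE //; apply: eq_integral => z _; rewrite /pev horner2_swapXY.
  split.
  - exact: (moment_det_neq0 mufin P0 muP).
  - exact: (moment_inv_first_eq0 mufin sP sPk P0 muP).
  - exact: (moment_inv_center_eq0 mufin sP sPk P0 muP).
have [p [sp spk p0 muE]] := density_exists mufin Hdet H2 H3.
exists (swapXY p); split.
- exact/size_swapXYP.
- by rewrite sizeYE swapXYK.
- by move=> z1 z2 h1 h2; rewrite horner2_swapXY; exact: p0.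
- by move=> A mA; rewrite muE //; apply: eq_integral => z _; rewrite horner2_swapXY.
Qed.
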